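(* Let $n\ge1$ be an integer and $c\ge0$. Let $\mathcal R^{\mathrm Q}$ denote the curvature endomorphism of the quaternionic Kähler manifold $(\bar N_{n-1},g_{\mathrm Q})$ obtained by twisting $(N_{n-1},g_{\mathrm H})$ with respect to the twist data $(Z,\omega_{\mathrm H},f_{\mathrm H})$. Then $$\|\mathcal R^{\mathrm Q}\|^2=n(5n+1)+3\left(\frac{f_Z^3}{f_{\mathrm H}^3}+(n-1)\frac{f_Z}{f_{\mathrm H}}\right)^2+3\left(\frac{f_Z^6}{f_{\mathrm H}^6}+(n-1)\frac{f_Z^2}{f_{\mathrm H}^2}\right),$$ where the function on the left (on $\bar N_{n-1}$) and the function on the right (on $N_{n-1}$) are identified by $\mathcal H$-relatedness, i.e. their pullbacks to $P$ agree.
   Context: The flat example. For an integer $m\ge0$ and a real constant $c\ge0$, let $N_m=\{(z_0,\dots,z_m,w_0,\dots,w_m)\in\mathbb C^{m+1}\times\mathbb C^{m+1}\mid -|z_0|^2+\sum_{i=1}^m|z_i|^2<-c\}$ with the flat pseudo-hyper-Kähler structure with metric $g=-(|\mathrm dz_0|^2+|\mathrm dw_0|^2)+\sum_{j=1}^m(|\mathrm dz_j|^2+|\mathrm dw_j|^2)$ and Kähler forms $\omega_1=\frac i2\big(-(\mathrm dz_0\wedge\mathrm d\bar z_0+\mathrm dw_0\wedge\mathrm d\bar w_0)+\sum_{j\ge1}(\mathrm dz_j\wedge\mathrm d\bar z_j+\mathrm dw_j\wedge\mathrm d\bar w_j)\big)$, $\omega_2=\frac i2\sum_{j=0}^m(\mathrm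 dz_j\wedge\mathrm dw_j-\mathrm d\bar z_j\wedge\mathrm d\bar w_j)$, $\omega_3=\frac12\sum_{j=0}^m(\mathrm dz_j\wedge\mathrm dw_j+\mathrm d\bar z_j\wedge\mathrm d\bar w_j)$. Complex structures $I_k$ are defined by $\omega_k=g(I_k\cdot,\cdot)$. The vector field $Z=-i\sum_{j=0}^m(z_j\partial_{z_j}-\bar z_j\partial_{\bar z_j})$ generates a rotating circle symmetry ($L_Zg=L_Z\omega_1=0$, $L_Z\omega_2=\omega_3$, $L_Z\omega_3=-\omega_2$) with $\iota_Z\omega_1=-\mathrm df_Z$, $f_Z=\frac12\big(|z_0|^2-\sum_{j\ge1}|z_j|^2\big)-\frac12c>0$. Put $f_{\mathrm H}=f_Z+g(Z,Z)=-\frac12\big(|z_0|^2-\sum_{j\ge1}|z_j|^2\big)-\frac12c$, $\omega_{\mathrm H}=\omega_1+\mathrm d(\iota_Zg)$, $\omega_0=g$, and $g_{\mathrm H}=\frac1{f_Z}g+\frac1{f_Z^2}\sum_{\mu=0}^3(\iota_Z\omega_\mu)^2$. Twist construction. With twist data $(Z,\omega_{\mathrm H},f_{\mathrm H})$ on $N=N_m$, let $\pi_N:P\to N$ be a principal circle bundle with connection form $\eta$, $\mathrm d\eta=\pi_N^*\omega_{\mathrm H}$, and principal generator $X_P$, $\eta(X_P)=1$; $\mathcal H=\ker\eta$. Let $Z_P=\tilde Z+(\pi_N^*f_{\mathrm H})X_P$ with $\tilde Z$ the horizontal lift of $Z$. The twist is $\bar N=\bar N_m=P/\langle Z_P\rangle$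 (understood locally, on open subsets of $P$ where the orbit space is a manifold, if it is not so globally). $TN$ and $T\bar N$ are both pointwise identified with $\mathcal H$; tensor fields on $N$ and $\bar N$ are $\mathcal H$-related if their lifts to $\mathcal H$ agree. $g_{\mathrm Q}$ is the (positive definite) metric on $\bar N$ that is $\mathcal H$-related to $g_{\mathrm H}$. Curvature norm. $\mathcal R^{\mathrm Q}:\bigwedge^2T\bar N\to\bigwedge^2T\bar N$ is the Riemann curvature tensor $R^{\mathrm Q}$ of $g_{\mathrm Q}$ regarded as a self-adjoint endomorphism, $g_{\mathrm Q}(\mathcal R^{\mathrm Q}(A\wedge B),C\wedge X)=g_{\mathrm Q}(R^{\mathrm Q}(A,B)C,X)$, where $\bigwedge^2$ carries the induced metric for which $\{e_a\wedge e_b\}_{a<b}$ is orthonormal if $\{e_a\}$ is; and $\|\mathcal R^{\mathrm Q}\|^2=\operatorname{tr}(\mathcal R^{\mathrm Q}\circ\mathcal R^{\mathrm Q})=\sum g_{\mathrm Q}(\mathcal R^{\mathrm Q}(e_a\wedge e_b),e_c\wedge e_d)\,g_{\mathrm Q}(\mathcal R^{\mathrm Q}(e_c\wedge e_d),e_a\wedge e_b)$, summed over the orthonormal basis of $\bigwedge^2$. *)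

(* Defs.v *)
From HB Require Import structures.
From mathcomp Require Import all_boot all_order all_algebra.
From mathcomp Require Import complex.
From mathcomp Require Import all_classical all_reals all_analysis.

Set Implicit Arguments.
Unset Strict Implicit.
Unset Printing Implicit Defensive.

Import Order.TTheory GRing.Theory Num.Theory.
Import numFieldNormedType.Exports.

Local Open Scope classical_set_scope.
Local Open Scope ring_scope.

Section Smooth.
Context {R : realType}.

(* On an open subset of a finite-dimensional space this is the usual notion of
   a C^k map, and [smooth_on] is C^oo. *)
Fixpoint Ck {E F : normedModType R} (k : nat) (U : set E) (f : E -> F) : Prop :=
  match k with
  | 0%N => forall x, U x -> {for x, continuous f}
  | k'.+1 => (forall x, U x -> differentiable f x) /\
             (forall v, Ck k' U (fun x => 'D_v f x))
  end.

Definition smooth_on {E F : normedModType R} (U : set E) (f : E -> F) : Prop :=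
  forall k, Ck k U f.

(* A 1-form on (an open subset of) E is [al : E -> E -> R], [al x] being the
   covector at x; u and v are extended as constant vector fields. *)
Definition ext_d {E : normedModType R} (al : E -> E -> R) (x u v : E) : R :=
  'D_u (fun y => al y v : R^o) x - 'D_v (fun y => al y u : R^o) x.

End Smooth.

Section Manifold.
Context {R : realType}.

Record chart (M : topologicalType) (d : nat) := Chart {
  cdom : set M;
  cimg : set 'rV[R]_d;
  cmap : M -> 'rV[R]_d;
  cinv : 'rV[R]_d -> M
}.

Definition is_chart (M : topologicalType) d (c : chart M d) : Prop :=
  [/\ open (cdom c) /\ open (cimg c),
      forall p, cdom c p -> cimg c (cmap c p) /\ cinv c (cmap c p) = p,
      forall x, cimg c x -> cdom c (cinv c x) /\ cmap c (cinv c x) = x,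
      forall p, cdom c p -> {for p, continuous (cmap c)} &
      forall x, cimg c x -> {for x, continuous (cinv c)}].

Definition transition (M : topologicalType) d (c c' : chart M d)
  : 'rV[R]_d -> 'rV[R]_d := fun x => cmap c' (cinv c x).

Record manifold (d : nat) := Manifold {
  mpt :> topologicalType;
  atlas : set (chart mpt d);
  mfd_hausdorff : hausdorff_space mpt;
  mfd_second_countable : @second_countable mpt;
  atlas_chart : forall c, atlas c -> is_chart c;
  atlas_cover : forall p : mpt, exists2 c, atlas c & cdom c p;
  atlas_smooth : forall c c', atlas c -> atlas c' ->
    smooth_on (cimg c `&` cinv c @^-1` cdom c') (transition c c')
}.

(* Tensor fields are given by their components in the charts of the atlas, as
   functions of the coordinates; [x] below is always a coordinate vector. *)

Definition vfield d (M : manifold d) := chart M d -> 'rV[R]_d -> 'rV[R]_d.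
Definition covfield d (M : manifold d) := chart M d -> 'rV[R]_d -> 'cV[R]_d.
Definition tens2 d (M : manifold d) := chart M d -> 'rV[R]_d -> 'M[R]_d.

Definition ev1 d (a : 'cV[R]_d) (v : 'rV[R]_d) : R := (v *m a) 0 0.
Definition ev2 d (G : 'M[R]_d) (u v : 'rV[R]_d) : R := (u *m G *m v^T) 0 0.

Definition riemannian_metric d (M : manifold d) (g : tens2 M) : Prop :=
  (forall c, atlas c ->
     [/\ smooth_on (cimg c) (g c),
         forall x, cimg c x -> (g c x)^T = g c x &
         forall x v, cimg c x -> v != 0 -> 0 < ev2 (g c x) v v]) /\
  (forall c c' x u v, atlas c -> atlas c' -> cimg c x -> cdom c' (cinv c x) ->
     ev2 (g c x) u v =
     ev2 (g c' (transition c c' x))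
         ('D_u (transition c c') x) ('D_v (transition c c') x)).

Definition loc d d' (M : manifold d) (M' : manifold d') (q : M -> M')
    (c : chart M d) (c' : chart M' d') : 'rV[R]_d -> 'rV[R]_d' :=
  fun x => cmap c' (q (cinv c x)).

Definition smooth_map_on d d' (M : manifold d) (M' : manifold d')
    (W : set M) (q : M -> M') : Prop :=
  (forall p, W p -> {for p, continuous q}) /\
  (forall c c', atlas c -> atlas c' ->
     smooth_on (cimg c `&` cinv c @^-1` (W `&` q @^-1` cdom c')) (loc q c c')).

Definition submersion_on d d' (M : manifold d) (M' : manifold d')
    (W : set M) (q : M -> M') : Prop :=
  forall c c' x, atlas c -> atlas c' -> cimg c x ->
    W (cinv c x) -> cdom c' (q (cinv c x)) ->
    forall w, exists v, 'D_v (loc q c c') x = w.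

Definition integral_curve d (M : manifold d) (W : set M) (X : vfield M)
    (ga : R -> M) (a b : R) : Prop :=
  forall t, a < t < b ->
    [/\ W (ga t), {for t, continuous ga} &
        forall c, atlas c -> cdom c (ga t) ->
          is_derive (t : R^o) 1 (fun s : R^o => cmap c (ga s))
                    (X c (cmap c (ga t)))].

Definition same_orbit d (M : manifold d) (W : set M) (X : vfield M)
    (p p' : M) : Prop :=
  exists (ga : R -> M) (a b s t : R),
    [/\ a < s < b, a < t < b, integral_curve W X ga a b, ga s = p & ga t = p'].

End Manifold.

Arguments manifold : clear implicits.

Section Curvature.
Context {R : realType} {d : nat}.
(* The metric, in coordinates. *)
Variable G : 'rV[R]_d -> 'M[R]_d.

Definition pd (i : 'I_d) (f : 'rV[R]_d -> R) (x : 'rV[R]_d) : R :=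
  'D_(delta_mx 0 i) (f : 'rV[R]_d -> R^o) x.

(* nabla_{d_i} d_j = \sum_k (christoffel k i j) d_k *)
Definition christoffel (k i j : 'I_d) (x : 'rV[R]_d) : R :=
  2^-1 * \sum_l invmx (G x) k l *
    (pd i (fun y => G y j l) x + pd j (fun y => G y i l) x
     - pd l (fun y => G y i j) x).

(* R(d_i, d_j) d_k = \sum_l (riemann l i j k) d_l, where
   R(A, B) C = nabla_A nabla_B C - nabla_B nabla_A C - nabla_{[A, B]} C *)
Definition riemann (l i j k : 'I_d) (x : 'rV[R]_d) : R :=
  pd i (christoffel l j k) x - pd j (christoffel l i k) x
  + \sum_m (christoffel l i m x * christoffel m j k x
            - christoffel l j m x * christoffel m i k x).

Definition curvature (x A B C : 'rV[R]_d) : 'rV[R]_d :=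
  \row_l \sum_i \sum_j \sum_k riemann l i j k x * A 0 i * B 0 j * C 0 k.

(* g (curvature endomorphism (A /\ B), C /\ X) *)
Definition curv_form (x A B C X : 'rV[R]_d) : R :=
  ev2 (G x) (curvature x A B C) X.

Definition orthonormal_frame (x : 'rV[R]_d) (e : 'I_d -> 'rV[R]_d) : Prop :=
  forall a b, ev2 (G x) (e a) (e b) = (a == b)%:R.

(* The trace of the square of the curvature endomorphism in the basis
   (e_a /\ e_b), a < b, of the bivectors. *)
Definition curv_norm2 (x : 'rV[R]_d) (e : 'I_d -> 'rV[R]_d) : R :=
  \sum_(a < d) \sum_(b < d | (a < b)%N) \sum_(c < d) \sum_(h < d | (c < h)%N)
    curv_form x (e a) (e b) (e c) (e h) * curv_form x (e c) (e h) (e a) (e b).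

End Curvature.

Section Twist.
Context {R : realType} {E : normedModType R}.

Record twist_data := TwistData {
  td_Z : E -> E;
  td_om : E -> E -> E -> R;
  td_f : E -> R
}.

(* The circle is R / 2 pi Z and acts through [cb_act]. *)
Record circle_bundle (N : set E) (d : nat) := CircleBundle {
  cb_tot :> manifold R d;
  cb_proj : cb_tot -> E;
  cb_act : R -> cb_tot -> cb_tot;
  cb_range : cb_proj @` setT = N;
  cb_proj_cont : continuous cb_proj;
  cb_proj_smooth : forall c, atlas c ->
    smooth_on (cimg c) (fun x => cb_proj (cinv c x));
  cb_proj_submersion : forall c x, atlas c -> cimg c x ->
    forall w, exists v, 'D_v (fun y => cb_proj (cinv c y)) x = w;
  cb_act0 : forall p, cb_act 0 p = p;
  cb_actD : forall s t p, cb_act (s + t) p = cb_act s (cb_act t p);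
  cb_act_free : forall t p,
    cb_act t p = p <-> exists k : int, t = k%:~R * (2 * pi);
  cb_act_cont : continuous (fun tp : R * cb_tot => cb_act tp.1 tp.2);
  cb_act_smooth : forall c c', atlas c -> atlas c' ->
    smooth_on [set tx : R^o * 'rV[R]_d |
                 cimg c tx.2 /\ cdom c' (cb_act tx.1 (cinv c tx.2))]
              (fun tx => cmap c' (cb_act tx.1 (cinv c tx.2)));
  cb_fibers : forall p p',
    cb_proj p = cb_proj p' <-> exists t, p' = cb_act t p
}.

Variables (N : set E) (d : nat) (P : circle_bundle N d).

(* The bundle projection in a chart of P, and its differential. *)
Definition proj_loc (c : chart P d) (x : 'rV[R]_d) : E := cb_proj (cinv c x).
Definition dproj (c : chart P d) (x v : 'rV[R]_d) : E := 'D_v (proj_loc c) x.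

(* X_P *)
Definition generator : vfield P := fun c x =>
  'D_1 (fun t : R^o => cmap c (cb_act t (cinv c x))) 0.

(* The second clause says both that the components of [eta] in the different
   charts agree (t = 0) and that [eta] is invariant. *)
Definition connection_form (eta : covfield P) : Prop :=
  [/\ forall c, atlas c -> smooth_on (cimg c) (eta c),
      forall c c' t x v, atlas c -> atlas c' -> cimg c x ->
        cdom c' (cb_act t (cinv c x)) ->
        ev1 (eta c x) v =
        ev1 (eta c' (loc (cb_act t) c c' x)) ('D_v (loc (cb_act t) c c') x) &
      forall c x, atlas c -> cimg c x -> ev1 (eta c x) (generator c x) = 1].

Variable eta : covfield P.

Definition has_curvature (om : E -> E -> E -> R) : Prop :=
  forall c x u v, atlas c -> cimg c x ->
    ext_d (fun y w => ev1 (eta c y) w) x u v =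
    om (proj_loc c x) (dproj c x u) (dproj c x v).

(* For a connection form there is exactly one such vector. *)
Definition hor_lift (Z : E -> E) : vfield P := fun c x =>
  xget 0 [set v | ev1 (eta c x) v = 0 /\ dproj c x v = Z (proj_loc c x)].

Definition twist_field (td : twist_data) : vfield P := fun c x =>
  hor_lift (td_Z td) c x + td_f td (proj_loc c x) *: generator c x.

(* The quotient of the open subset [tw_dom] of P by the orbits of Z_P. *)
Record twist (td : twist_data) (d' : nat) := Twist {
  tw_mfd :> manifold R d';
  tw_dom : set P;
  tw_proj : P -> tw_mfd;
  tw_open : open tw_dom;
  tw_range : tw_proj @` tw_dom = setT;
  tw_smooth : smooth_map_on tw_dom tw_proj;
  tw_submersion : submersion_on tw_dom tw_proj;
  tw_fibers : forall p p', tw_dom p -> tw_dom p' ->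
    (tw_proj p = tw_proj p' <-> same_orbit tw_dom (twist_field td) p p')
}.

Definition H_related td d' (B : twist td d') (h : E -> E -> E -> R)
    (g : tens2 B) : Prop :=
  forall c b x u v, atlas c -> atlas b -> cimg c x ->
    tw_dom B (cinv c x) -> cdom b (tw_proj B (cinv c x)) ->
    ev1 (eta c x) u = 0 -> ev1 (eta c x) v = 0 ->
    ev2 (g b (loc (@tw_proj _ _ B) c b x))
        ('D_u (loc (@tw_proj _ _ B) c b) x) ('D_v (loc (@tw_proj _ _ B) c b) x)
    = h (proj_loc c x) (dproj c x u) (dproj c x v).

End Twist.

Section FlatExample.
Context {R : realType}.
Variables (m : nat) (c : R).

Local Notation C := R[i].

(* C^(m+1) x C^(m+1) as a real vector space: column j holds
   Re z_j, Im z_j, Re w_j, Im w_j. *)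
Definition flatE := 'M[R]_(4, m.+1).

Definition zc (j : 'I_m.+1) (u : flatE) : C :=
  Complex (u (@Ordinal 4 0 isT) j) (u (@Ordinal 4 1 isT) j).
Definition wc (j : 'I_m.+1) (u : flatE) : C :=
  Complex (u (@Ordinal 4 2 isT) j) (u (@Ordinal 4 3 isT) j).
Definition zbar j (u : flatE) : C := conjc (zc j u).
Definition wbar j (u : flatE) : C := conjc (wc j u).

(* -|z_0|^2 + \sum_{j >= 1} |z_j|^2 *)
Definition zquad (x : flatE) : R :=
  complex.Re (- (zc ord0 x * zbar ord0 x)
              + \sum_(j | j != ord0) zc j x * zbar j x).

Definition flatN : set flatE := [set x | zquad x < - c].

Definition wedge (al be : flatE -> C) (u v : flatE) : C :=
  al u * be v - al v * be u.

(* The symmetric bilinear form |al|^2 of a complex covector al. *)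
Definition absq (al : flatE -> C) (u v : flatE) : R :=
  complex.Re (al u * conjc (al v)).

(* The coordinates being linear, [zc j] is also dz_j, and so on. *)
Definition flat_g (u v : flatE) : R :=
  - (absq (zc ord0) u v + absq (wc ord0) u v)
  + \sum_(j | j != ord0) (absq (zc j) u v + absq (wc j) u v).

Definition flat_om1 (u v : flatE) : R :=
  complex.Re (Complex 0 1 / 2 *
    (- (wedge (zc ord0) (zbar ord0) u v + wedge (wc ord0) (wbar ord0) u v)
     + \sum_(j | j != ord0)
         (wedge (zc j) (zbar j) u v + wedge (wc j) (wbar j) u v))).

Definition flat_om2 (u v : flatE) : R :=
  complex.Re (Complex 0 1 / 2 *
    \sum_j (wedge (zc j) (wc j) u v - wedge (zbar j) (wbar j) u v)).

Definition flat_om3 (u v : flatE) : R :=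
  complex.Re (2^-1 *
    \sum_j (wedge (zc j) (wc j) u v + wedge (zbar j) (wbar j) u v)).

(* -i (z d_z - zbar d_zbar) = y d_x - x d_y for z = x + i y, that is
   dz_j(Z) = - i z_j and dw_j(Z) = 0. *)
Definition flat_Z (x : flatE) : flatE := \matrix_(k, j)
  [:: x (@Ordinal 4 1 isT) j; - x (@Ordinal 4 0 isT) j; 0; 0]`_k.

Definition fZ (x : flatE) : R := 2^-1 * (- zquad x) - 2^-1 * c.
Definition fH (x : flatE) : R := fZ x + flat_g (flat_Z x) (flat_Z x).

Definition flat_omH (x u v : flatE) : R :=
  flat_om1 u v + ext_d (fun y w => flat_g (flat_Z y) w) x u v.

Definition flat_gH (x u v : flatE) : R :=
  (fZ x)^-1 * flat_g u v
  + (fZ x ^+ 2)^-1 *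
    (flat_g (flat_Z x) u * flat_g (flat_Z x) v
     + flat_om1 (flat_Z x) u * flat_om1 (flat_Z x) v
     + flat_om2 (flat_Z x) u * flat_om2 (flat_Z x) v
     + flat_om3 (flat_Z x) u * flat_om3 (flat_Z x) v).

Definition flat_twist_data : twist_data := TwistData flat_Z flat_omH fH.

End FlatExample.

Arguments flatN {R} m c.
Arguments flat_omH {R} m x u v.
Arguments flat_gH {R} m c x u v.
Arguments flat_twist_data {R} m c.

(* Main.v *)
(** Let T be the differential of the bundle projection P -> N followed by the
    projection along Z_P.  It is an N-valued coframe on P vanishing on the kernel
    of the quotient map q : P -> Nbar, and q^* g_Q = g_H (T, T).  Hence both the
    Levi-Civita connection of g_Q, pulled back along q, and the explicit
    connection d + Lam (T) - (eta / f_H) L_Z on the trivial bundle with fibre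
    T N = C^(2 n) are metric and torsion-free for the same degenerate metric on
    P; by Koszul's formula their curvatures agree.  No slice of the Z_P-action is
    needed.  With zeta the z-part of the point and J = (+1, -1) on (z, w),
      Lam X Y = 1 / (2 f_Z) sum_mu (g (I_mu zeta, Y) I_mu X + g (I_mu zeta, X) I_mu Y)
                + 1 / (2 f_H) sum_mu g (I_mu J X, Y) I_mu zeta,
    and the curvature is a quarter of the curvature of quaternionic projective
    space minus 1 / (4 f_Z f_H) times the analogous tensor built from the forms
    g (I_mu J X, Y).  In an orthonormal frame its norm reduces to traces of words
    in the matrices of the I_mu and of J. *)
Require Import Defs.
From HB Require Import structures.
From mathcomp Require Import all_boot all_order all_algebra.
From mathcomp Require Import complex.
From mathcomp Require Import all_classical all_reals all_analysis.
From mathcomp Require Import ring lra.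

Set Implicit Arguments.
Unset Strict Implicit.
Unset Printing Implicit Defensive.

Import Order.TTheory GRing.Theory Num.Theory.
Import numFieldNormedType.Exports.
Local Open Scope classical_set_scope.
Local Open Scope ring_scope.

(** * Differential calculus *)

(** Both nonconstant terms of the norm come from one symmetric matrix A, that of the form g (J -, -)
    in a g_H-orthonormal frame. Its square is f_Z^2 on a subspace of dimension 4 (n - 1) and f_Z^4 /
    f_H^2 on a complementary four-dimensional one. Hence tr (A^2) / (f_Z f_H) = 4 (f_Z^3 / f_H^3 +
    (n - 1) f_Z / f_H), and tr (A^4) / (f_Z f_H)^2 = 4 (f_Z^6 / f_H^6 + (n - 1) f_Z^2 / f_H^2). The
    term n (5 n + 1) is the norm of the model tensor, and no mixed term arises because the two parts
    of the curvature are orthogonal.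

    The obstacle on P is that the metric is degenerate and the two connections live on different
    bundles without a given isomorphism. Only scalar pairings of soldered vectors can be compared,
    and any other vector is first written, at a single point, as the soldering of some tangent
    vector.

    The flat metric is indefinite but nondegenerate. Vector identities are therefore tested against
    an arbitrary vector, which makes them polynomial identities between finitely many scalar
    products. *)

Section SmoothCalculus.
Context {R : realType}.
Implicit Types V W : normedModType R.

Definition bilin {W1 W2 W3 : normedModType R} (b : W1 -> W2 -> W3) :=
  [/\ forall y, linear (b^~ y), forall x, linear (b x) &
      continuous (fun p => b p.1 p.2)].

(** The one Leibniz rule behind all later ones: products, scalings and the pairing by [flat_g] are
    instances. *)
Lemma bilin_diff {V W1 W2 W3} (b : W1 -> W2 -> W3) (f : V -> W1) (g : V -> W2) x :
  bilin b -> differentiable f x -> differentiable g x ->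
  differentiable (fun y => b (f y) (g y)) x /\
  forall v, 'D_v (fun y => b (f y) (g y)) x = b ('D_v f x) (g x) + b (f x) ('D_v g x).
Proof.
move=> [bl br bc] df dg.
have bb : bilinear_for (GRing.Scale.Law.clone _ _ *:%R _)
   (GRing.Scale.Law.clone _ _ *:%R _) b by split.
pose B : {bilinear W1 -> W2 -> W3} :=
  HB.pack b (@bilinear_isBilinear.Build R W1 W2 W3 _ _ b bb).
have dB p : differentiable (fun q => B q.1 q.2) p by exact: differentiable_bilin.
have dp := differentiable_pair df dg.
have E : (fun y => b (f y) (g y)) = (fun q => B q.1 q.2) \o (fun y => (f y, g y)) by [].
have dfg : differentiable (fun y => b (f y) (g y)) x.
  by rewrite E; apply: differentiable_comp.
have dE p : 'd (fun q => B q.1 q.2) p = (fun q => B p.1 q.2 + B q.1 p.2) :> (_ -> _).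
  exact: diff_bilin.
split=> // v; rewrite deriveE // E diff_comp // [LHS]/= dE /= diff_pair //=.
by rewrite !deriveE // addrC.
Qed.

Lemma Ck_sub {V W} k (U U' : set V) (f : V -> W) : U' `<=` U -> Ck k U f -> Ck k U' f.
Proof.
move=> s; elim: k f => [|k IH] f /=; first by move=> h x /s /h.
by move=> [h1 h2]; split=> [x /s /h1|v]; [|apply: IH].
Qed.

Lemma CkS {V W} k (U : set V) (f : V -> W) : Ck k.+1 U f -> Ck k U f.
Proof.
elim: k f => [|k IH] f [h1 h2]; first by move=> x /h1 /differentiable_continuous.
by split=> // v; apply: IH.
Qed.

Lemma open_near_eq {V W} {U : set V} {f g : V -> W} {x} : open U ->
  (forall y, U y -> f y = g y) -> U x -> {near x, f =1 g}.
Proof. by move=> oU fg Ux; near=> y; apply: fg; near: y; exact: open_nbhs_nbhs. 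
Unshelve. all: by end_near. Qed.

(** Differentiability is a local little-o condition, so the differential of [f] at [x] also serves
    for [g]. *)
Lemma near_eq_differentiable {V W} (f g : V -> W) x :
  {near x, f =1 g} -> differentiable f x -> differentiable g x.
Proof.
move=> fg /diff_locallyP [dc dE].
have gE : g \o shift x = cst (g x) + 'd f x +o_ 0 id.
  apply/eqaddoP => _/posnumP[eps]; move/eqaddoP : dE => /(_ eps%:num (gt0 eps)) dE.
  have fgx : f x = g x := nbhs_singleton fg.
  move: fg; rewrite (near_shift 0) /= => fg0.
  apply: filterS2 fg0 dE => y; rewrite subr0 /= => fgy.
  by rewrite /= !fctE /= /shift /= in fgy *; rewrite fgy fgx.
by apply/diff_locallyP; rewrite (diff_unique dc gE).
Qed.

Lemma Ck_eq {V W} k (U : set V) (f g : V -> W) : open U ->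
  (forall x, U x -> f x = g x) -> Ck k U f -> Ck k U g.
Proof.
move=> oU; elim: k f g => [|k IH] f g fg /=.
  move=> h x Ux; rewrite /prop_for /continuous_at -(fg x Ux).
  apply: cvg_trans (h x Ux); apply: near_eq_cvg.
  exact: open_near_eq oU fg Ux.
move=> [h1 h2]; split=> [x Ux|v].
  exact: near_eq_differentiable (open_near_eq oU fg Ux) (h1 x Ux).
apply: IH (h2 v) => x Ux; apply: near_eq_derive; exact: open_near_eq oU fg Ux.
Qed.

Lemma Ck_add {V W} k (U : set V) (f g : V -> W) : open U ->
  Ck k U f -> Ck k U g -> Ck k U (fun x => f x + g x).
Proof.
move=> oU; elim: k f g => [|k IH] f g /=.
  by move=> hf hg x Ux; apply: continuousD; [apply: hf|apply: hg].
move=> [f1 f2] [g1 g2]; split=> [x Ux|v].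
  by apply: differentiableD; [apply: f1|apply: g1].
apply: (@Ck_eq _ _ k U (fun x => 'D_v f x + 'D_v g x)) => //; last exact: IH.
by move=> x Ux; rewrite deriveD //; apply: diff_derivable; [apply: f1|apply: g1].
Qed.

(** The derivative is a sum of two terms of the same bilinear shape; [CkS] lowers the class of the
    undifferentiated factor, so the induction closes. *)
Lemma Ck_bilin {V W1 W2 W3} (b : W1 -> W2 -> W3) k (U : set V) f g :
  open U -> bilin b -> Ck k U f -> Ck k U g -> Ck k U (fun x => b (f x) (g x)).
Proof.
move=> oU hb; elim: k f g => [|k IH] f g /=.
  move=> hf hg x Ux; case: hb => _ _ bc.
  have -> : (fun y => b (f y) (g y)) = (fun q => b q.1 q.2) \o (fun y => (f y, g y)) by [].
  apply: continuous_comp; last exact: bc.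
  by apply: cvg_pair; [apply: hf|apply: hg].
move=> Hf Hg; have [f1 f2] := Hf; have [g1 g2] := Hg; split=> [x Ux|v].
  by have [] := bilin_diff hb (f1 x Ux) (g1 x Ux).
apply: (@Ck_eq _ _ k U (fun x => b ('D_v f x) (g x) + b (f x) ('D_v g x))) => //.
  by move=> x Ux; have [_ ->] := bilin_diff hb (f1 x Ux) (g1 x Ux).
by apply: Ck_add => //; apply: IH => //; apply: CkS.
Qed.

Lemma is_derive_line {V W} (f : V -> W) (p u : V) (s : R) :
  differentiable f (s *: u + p) ->
  is_derive s 1 (fun s : R => f (s *: u + p)) ('D_u f (s *: u + p)).
Proof.
move=> df.
have dl : is_diff s (fun s : R => s *: u + p) (fun s => s *: u).
  have := is_diffD (is_diff_scalel s u) (is_diff_cst p s).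
  by rewrite addr0; apply.
case: dl => dd dE.
have dc : differentiable (fun s : R => f (s *: u + p)) s.
  by apply: (@differentiable_comp _ _ _ _ (fun s : R => s *: u + p) f).
apply: DeriveDef; first exact: diff_derivable.
rewrite !deriveE //.
rewrite (@diff_comp _ _ _ _ (fun s : R => s *: u + p) f) //=.
by rewrite dE scale1r.
Qed.

(** The mean value theorem in the direction [u], applied to the difference of [f] on two parallel
    segments, leaves a difference of values of ['D_u f]. Differentiability of ['D_u f] at [x]
    estimates it. *)
Lemma second_difference {V} (f : V -> R) x u v (e : R) :
  (\forall y \near x, differentiable f y) -> differentiable ('D_u f) x -> 0 < e ->
  exists2 r : R, 0 < r & forall t, 0 < t -> t < r ->
    `|f (t *: u + (t *: v + x)) - f (t *: u + x) - (f (t *: v + x) - f x)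
      - t ^+ 2 * 'D_v ('D_u f) x| <= e * t ^+ 2.
Proof.
move=> nf dg e0.
(* [t * k] bounds the sum of the norms of the increments [s *: u + t *: v] and [s *: u] for
   [s <= t]; the [+ 1] makes [k] positive. *)
set g := 'D_u f; set k := 2 * `|u| + `|v| + 1.
have u0 := normr_ge0 u. have v0 := normr_ge0 v.
have k0 : 0 < k by rewrite /k; lra.
have dgE := diff_locally dg.
move/eqaddoP : dgE => /(_ (e / k) (divr_gt0 e0 k0)) dgE.
move: nf; rewrite (near_shift 0) /= => nf.
have [r /= r0 hr] := nbhs_norm0P.1 (filterI nf dgE).
have {hr} hr h : `|h| < r -> differentiable f (h + x) /\
    `|g (h + x) - g x - 'd g x h| <= e / k * `|h|.
  move=> /hr /=; rewrite subr0 => -[? H].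
  by split=> //; move: H; rewrite !fctE /= opprD addrA.
exists (r / k); first exact: divr_gt0.
move=> t t0 tr.
have tk : t * k < r by rewrite -ltr_pdivlMr.
have sm s : 0 <= s <= t -> `|s *: u + t *: v| <= t * (`|u| + `|v|) /\ `|s *: u| <= t * `|u|.
  move=> /andP[s0 st]; have su : `|s *: u| <= t * `|u|.
    by rewrite normrZ ger0_norm // ler_wpM2r.
  split=> //; rewrite (le_trans (ler_normD _ _)) // mulrDr lerD //.
  by rewrite normrZ gtr0_norm.
have smr s : 0 <= s <= t -> `|s *: u + t *: v| < r /\ `|s *: u| < r.
  move=> /sm[a b]; split; first by apply: le_lt_trans a _; rewrite /k in tk; nra.
  by apply: le_lt_trans b _; rewrite /k in tk; nra.
pose phi := fun s : R => f (s *: u + (t *: v + x)) - f (s *: u + x).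
pose dphi := fun s : R => g (s *: u + (t *: v + x)) - g (s *: u + x).
have dp s : 0 <= s <= t -> is_derive s 1 phi (dphi s).
  move=> /smr[a b]; apply: is_deriveB; apply: is_derive_line.
    by rewrite addrA; have [] := hr _ a.
  by have [] := hr _ b.
have dpo s : s \in `]0, t[%R -> is_derive s 1 phi (dphi s).
  by rewrite in_itv /= => /andP[/ltW a /ltW b]; apply: dp; rewrite a b.
have cp : {within `[0, t], continuous phi}.
  apply: derivable_within_continuous => s; rewrite in_itv /= => hs.
  by case: (dp s hs).
have [s] := MVT t0 dpo cp.
rewrite in_itv /= => /andP[s0 st]; rewrite subr0 /phi !scale0r !add0r => ->.
have hs : 0 <= s <= t by rewrite !ltW.
have [a b] := smr s hs; have [a' b'] := sm s hs.
have [_ A] := hr _ a; have [_ B] := hr _ b.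
rewrite /dphi addrA (deriveE _ dg).
have L : 'd g x (s *: u + t *: v) = 'd g x (s *: u) + t * 'd g x v.
  by rewrite linearD; congr (_ + _); rewrite linearZ.
rewrite L in A.
have ek : 0 <= e / k by rewrite ltW // divr_gt0.
have ekk : e / k * k = e by rewrite divfK // gt_eqF.
set P := g (s *: u + t *: v + x) in A *; set Q := g (s *: u + x) in B *.
have -> : (P - Q) * t - t ^+ 2 * 'd g x v =
  ((P - g x - ('d g x (s *: u) + t * 'd g x v)) - (Q - g x - 'd g x (s *: u))) * t.
  by ring.
rewrite normrM (gtr0_norm t0) expr2 mulrA ler_pM2r //.
apply: le_trans (ler_normB _ _) _.
have H : `|s *: u + t *: v| + `|s *: u| <= t * k by rewrite /k; nra.
apply: (@le_trans _ _ (e / k * (`|s *: u + t *: v| + `|s *: u|))).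
  by rewrite mulrDr lerD.
by apply: le_trans (ler_wpM2l ek H) _; rewrite [t * k]mulrC mulrA ekk.
Qed.

(** The second difference is symmetric in [u] and [v], so both mixed derivatives, times [t ^+ 2],
    approximate the same number. *)
Lemma derive_comm {V} (f : V -> R) x u v :
  (\forall y \near x, differentiable f y) ->
  differentiable ('D_u f) x -> differentiable ('D_v f) x ->
  'D_v ('D_u f) x = 'D_u ('D_v f) x.
Proof.
move=> nf du dv; apply/eqP; rewrite -subr_eq0 -normr_le0; apply/ler_addgt0Pl => e e0.
rewrite addr0; have e2 : 0 < e / 2 by lra.
have [r r0 hr] := second_difference v nf du e2.
have [q q0 hq] := second_difference u nf dv e2.
pose t := Num.min r q / 2.
have m0 : 0 < Num.min r q by rewrite lt_min r0.
have t0 : 0 < t by rewrite /t; lra.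
have tm : t < Num.min r q by rewrite /t; lra.
move: tm; rewrite lt_min => /andP[tr tq].
have := hr t t0 tr; have := hq t t0 tq.
rewrite [t *: v + (t *: u + x)]addrCA; set a := f (_ + (_ + _)); set b := f (_ + _); set c := f (_ + _); set d := f x.
set A := 'D_u ('D_v f) x; set B := 'D_v ('D_u f) x => H1 H2.
have t20 : 0 < t ^+ 2 by rewrite exprn_gt0.
rewrite -(ler_pM2r t20) -{1}(gtr0_norm t20) -normrM.
have -> : (B - A) * t ^+ 2 = (a - b - (c - d) - t ^+ 2 * A) - (a - c - (b - d) - t ^+ 2 * B).
  by ring.
rewrite [X in _ <= X * _]splitr mulrDl; apply: le_trans (ler_normB _ _) _.
clearbody a b c d A B t.
exact: (lerD H1 H2).
Qed.

End SmoothCalculus.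

(** * Derivative formulas, direction by direction *)

Section HasDerivative.
Context {R : realType}.
Implicit Types V W : normedModType R.

(** The differential is a bare function of the direction, so that rules compose by unification and
    the formula is adjusted once, by [has_D_eq]. *)
Definition has_D {V W : normedModType R} (f : V -> W) (x : V) (df : V -> W) :=
  differentiable f x /\ forall v, 'D_v f x = df v.

Lemma has_D_diff {V W} (f : V -> W) x : differentiable f x ->
  has_D f x (fun v => 'D_v f x).
Proof. by []. Qed.

Lemma has_D_eq {V W} (f : V -> W) x df df' : has_D f x df -> df =1 df' -> has_D f x df'.
Proof. by move=> [h1 h2] e; split=> // v; rewrite h2. Qed.

Lemma has_D_cst {V W} (a : W) (x : V) : has_D (fun=> a) x (fun=> 0).
Proof. by split=> [|v]; [exact: differentiable_cst|exact: derive_cst]. Qed.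

Lemma has_D_id {V} (x : V) : has_D id x id.
Proof. by split=> // v; exact: derive_id. Qed.

Lemma has_D_add {V W} (f g : V -> W) x df dg : has_D f x df -> has_D g x dg ->
  has_D (fun y => f y + g y) x (fun v => df v + dg v).
Proof.
move=> [f1 f2] [g1 g2]; split=> [|v]; first exact: differentiableD.
by rewrite -f2 -g2; apply: deriveD; exact: diff_derivable.
Qed.

Lemma has_D_bilin {V W1 W2 W3 : normedModType R} (b : W1 -> W2 -> W3)
    (f : V -> W1) (g : V -> W2) x df dg :
  bilin b -> has_D f x df -> has_D g x dg ->
  has_D (fun y => b (f y) (g y)) x (fun v => b (df v) (g x) + b (f x) (dg v)).
Proof.
move=> hb [f1 f2] [g1 g2]; have [h1 h2] := bilin_diff hb f1 g1.
by split=> // v; rewrite h2 f2 g2.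
Qed.

Lemma has_D_comp {V W1 W2 : normedModType R} (f : V -> W1) (g : W1 -> W2) x df dg :
  has_D f x df -> has_D g (f x) dg -> has_D (fun y => g (f y)) x (fun v => dg (df v)).
Proof.
move=> [f1 f2] [g1 g2].
have d : differentiable (g \o f) x by exact: differentiable_comp.
split=> // v; rewrite -[fun y => _]/(g \o f) deriveE // diff_comp //=.
by rewrite -g2 -f2 !deriveE.
Qed.

Lemma has_D_lin {V W1 W2 : normedModType R} (l : W1 -> W2) (f : V -> W1) x df :
  linear l -> continuous l -> has_D f x df ->
  has_D (fun y => l (f y)) x (fun v => l (df v)).
Proof.
move=> ll cl hf; apply: has_D_comp hf _.
pose L : {linear W1 -> W2} := HB.pack l (GRing.isLinear.Build _ _ _ _ _ ll).
have cL : continuous L by [].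
have dL y : differentiable L y by exact: linear_differentiable.
by split=> [|v]; [exact: dL|rewrite -[l]/(L : _ -> _) deriveE // diff_lin].
Qed.

Lemma bilin_mul : bilin (fun a b : R => a * b).
Proof.
split=> [y a u v|x a u v|]; last exact: mul_continuous.
  by rewrite mulrDl -scalerAl.
by rewrite mulrDr -scalerAr.
Qed.

Lemma bilin_scale (W : normedModType R) : bilin (fun (a : R) (w : W) => a *: w).
Proof.
split=> [y a u v|x a u v|]; last exact: scale_continuous.
  by rewrite scalerDl -scalerA.
by rewrite scalerDr !scalerA mulrC.
Qed.

Lemma has_D_mul {V} (f g : V -> R) x df dg : has_D f x df -> has_D g x dg ->
  has_D (fun y => f y * g y) x (fun v => df v * g x + f x * dg v).
Proof. exact: (has_D_bilin bilin_mul). Qed.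

Lemma has_D_scale {V W} (f : V -> R) (g : V -> W) x df dg :
  has_D f x df -> has_D g x dg ->
  has_D (fun y => f y *: g y) x (fun v => df v *: g x + f x *: dg v).
Proof. exact: (has_D_bilin (@bilin_scale W)). Qed.

Lemma has_D_opp {V W} (f : V -> W) x df : has_D f x df ->
  has_D (fun y => - f y) x (fun v => - df v).
Proof.
move=> [f1 f2]; split=> [|v]; first exact: differentiableN.
by rewrite -f2; apply: deriveN; exact: diff_derivable.
Qed.

Lemma has_D_sub {V W} (f g : V -> W) x df dg : has_D f x df -> has_D g x dg ->
  has_D (fun y => f y - g y) x (fun v => df v - dg v).
Proof. by move=> hf /has_D_opp; apply: has_D_add. Qed.

Lemma has_D_sum {V W} (I : Type) (r : seq I) (P : pred I) (f : I -> V -> W) x df :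
  (forall i, P i -> has_D (f i) x (df i)) ->
  has_D (fun y => \sum_(i <- r | P i) f i y) x (fun v => \sum_(i <- r | P i) df i v).
Proof.
move=> h; elim: r => [|i r IH].
  rewrite (_ : (fun y => _) = (fun=> 0)); last by apply/funext => y; rewrite big_nil.
  by apply: has_D_eq (has_D_cst _ _) _ => v; rewrite big_nil.
have [Pi|nPi] := boolP (P i).
  rewrite (_ : (fun y => _) = (fun y => f i y + \sum_(i <- r | P i) f i y)).
    by apply: has_D_eq (has_D_add (h i Pi) IH) _ => v; rewrite big_cons Pi.
  by apply/funext => y; rewrite big_cons Pi.
rewrite (_ : (fun y => _) = (fun y => \sum_(i <- r | P i) f i y)).
  by apply: has_D_eq IH _ => v; rewrite big_cons (negbTE nPi).
by apply/funext => y; rewrite big_cons (negbTE nPi).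
Qed.

Lemma has_D_inv {V} (f : V -> R) x df : f x != 0 -> has_D f x df ->
  has_D (fun y => (f y)^-1) x (fun v => - (f x) ^- 2 * df v).
Proof.
move=> fx [f1 f2]; split=> [|v]; first exact: differentiableV.
by rewrite -f2; apply: deriveV => //; exact: diff_derivable.
Qed.

Lemma has_D_coord {V} m n (f : V -> 'M[R]_(m, n)) x df i j : has_D f x df ->
  has_D (fun y => f y i j) x (fun v => df v i j).
Proof.
apply: (has_D_lin (l := fun M : 'M[R]_(m, n) => M i j)); last exact: coord_continuous.
by move=> a u v; rewrite !mxE.
Qed.

Lemma has_D_mx {V} m n (f : V -> 'M[R]_(m, n)) x (df : V -> 'M[R]_(m, n)) :
  (forall i j, has_D (fun y => f y i j) x (fun v => df v i j)) -> has_D f x df.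
Proof.
move=> h.
have -> : f = (fun y => \sum_i \sum_j f y i j *: delta_mx i j).
  by apply/funext => y; exact: matrix_sum_delta.
apply: has_D_eq (has_D_sum _ (df := fun i v => \sum_j df v i j *: delta_mx i j) _) _.
  move=> i _; apply: has_D_sum => j _.
  apply: has_D_eq (has_D_scale (h i j) (has_D_cst _ _)) _ => v /=.
  by rewrite scaler0 addr0.
by move=> v; rewrite [RHS]matrix_sum_delta.
Qed.

End HasDerivative.

(** * Closure properties of smooth maps *)

Section SmoothFunctions.
Context {R : realType}.
Implicit Types V W : normedModType R.

Lemma smooth_diff {V W} (U : set V) (f : V -> W) x :
  smooth_on U f -> U x -> differentiable f x.
Proof. by move=> /(_ 1%N)[h _] /h. Qed.

Lemma smooth_D {V W} (U : set V) (f : V -> W) v :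
  smooth_on U f -> smooth_on U ('D_v f).
Proof. by move=> sf k; have [_] := sf k.+1; apply. Qed.

Lemma smooth_has_D {V W} (U : set V) (f : V -> W) x :
  smooth_on U f -> U x -> has_D f x (fun v => 'D_v f x).
Proof. by move=> sf Ux; apply/has_D_diff/(smooth_diff sf). Qed.

Lemma smooth_sub {V W} (U U' : set V) (f : V -> W) :
  U' `<=` U -> smooth_on U f -> smooth_on U' f.
Proof. by move=> s sf k; apply: Ck_sub s (sf k). Qed.

Lemma smooth_eq {V W} (U : set V) (f g : V -> W) : open U ->
  (forall x, U x -> f x = g x) -> smooth_on U f -> smooth_on U g.
Proof. by move=> oU fg sf k; apply: Ck_eq oU fg (sf k). Qed.

Lemma smooth_add {V W} (U : set V) (f g : V -> W) : open U ->
  smooth_on U f -> smooth_on U g -> smooth_on U (fun x => f x + g x).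
Proof. by move=> oU sf sg k; apply: Ck_add. Qed.

Lemma smooth_bilin {V W1 W2 W3 : normedModType R} (b : W1 -> W2 -> W3) (U : set V) f g :
  open U -> bilin b ->
  smooth_on U f -> smooth_on U g -> smooth_on U (fun x => b (f x) (g x)).
Proof. by move=> oU hb sf sg k; apply: Ck_bilin. Qed.

Lemma smooth_cst {V W} (U : set V) (a : W) : open U -> smooth_on U (fun _ : V => a).
Proof.
move=> oU k; elim: k a => [|k IH] a /=; first by move=> x _; exact: cst_continuous.
split=> [x _|v]; first exact: differentiable_cst.
by apply: Ck_eq (IH 0) => // x _; rewrite derive_cst.
Qed.

Lemma smooth_lin {V W1 W2 : normedModType R} (l : W1 -> W2) (U : set V) f :
  open U -> linear l -> continuous l -> smooth_on U f -> smooth_on U (fun x => l (f x)).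
Proof.
move=> oU ll cl sf k; elim: k f sf => [|k IH] f sf /=.
  move=> x Ux; apply: continuous_comp; last exact: cl.
  exact: (sf 0%N).
have h x : U x -> has_D (fun y => l (f y)) x (fun v => l ('D_v f x)).
  by move=> Ux; apply: has_D_lin => //; apply: smooth_has_D Ux.
split=> [x /h[]//|v].
by apply: Ck_eq (IH _ (smooth_D v sf)) => // x /h[_ ->].
Qed.

Lemma smooth_mul {V} (U : set V) (f g : V -> R) : open U ->
  smooth_on U f -> smooth_on U g -> smooth_on U (fun x => f x * g x).
Proof. by move=> oU; apply: smooth_bilin => //; exact: bilin_mul. Qed.

Lemma smooth_scale {V W} (U : set V) (f : V -> R) (g : V -> W) : open U ->
  smooth_on U f -> smooth_on U g -> smooth_on U (fun x => f x *: g x).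
Proof. by move=> oU; apply: smooth_bilin => //; exact: bilin_scale. Qed.

Lemma smooth_opp {V W} (U : set V) (f : V -> W) : open U ->
  smooth_on U f -> smooth_on U (fun x => - f x).
Proof.
move=> oU sf; apply: smooth_eq oU _ (smooth_scale oU (smooth_cst (-1 : R) oU) sf) => x _.
by rewrite scaleN1r.
Qed.

Lemma smooth_sum {V W} (U : set V) (I : Type) (r : seq I) (P : pred I) (f : I -> V -> W) :
  open U -> (forall i, P i -> smooth_on U (f i)) ->
  smooth_on U (fun x => \sum_(i <- r | P i) f i x).
Proof.
move=> oU h; elim: r => [|i r IH].
  by apply: smooth_eq oU _ (smooth_cst 0 oU) => // x _; rewrite big_nil.
have [Pi|nPi] := boolP (P i).
  by apply: smooth_eq oU _ (smooth_add oU (h i Pi) IH) => // x _; rewrite big_cons Pi.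
by apply: smooth_eq oU _ IH => // x _; rewrite big_cons (negbTE nPi).
Qed.

Lemma smooth_prod {V} (U : set V) (I : Type) (r : seq I) (P : pred I) (f : I -> V -> R) :
  open U -> (forall i, P i -> smooth_on U (f i)) ->
  smooth_on U (fun x => \prod_(i <- r | P i) f i x).
Proof.
move=> oU h; elim: r => [|i r IH].
  by apply: smooth_eq oU _ (smooth_cst (1 : R) oU) => // x _; rewrite big_nil.
have [Pi|nPi] := boolP (P i).
  by apply: smooth_eq oU _ (smooth_mul oU (h i Pi) IH) => // x _; rewrite big_cons Pi.
by apply: smooth_eq oU _ IH => // x _; rewrite big_cons (negbTE nPi).
Qed.

(** The derivative of the reciprocal contains the reciprocal again, but only in products, so its
    class rises by one at each step of the induction. *)
Lemma smooth_inv {V} (U : set V) (f : V -> R) : open U ->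
  (forall x, U x -> f x != 0) -> smooth_on U f -> smooth_on U (fun x => (f x)^-1).
Proof.
move=> oU f0 sf.
have h x : U x -> has_D (fun y => (f y)^-1) x (fun v => - (f x) ^- 2 * 'D_v f x).
  by move=> Ux; apply: has_D_inv; [exact: f0|exact: smooth_has_D Ux].
elim=> [|k IH] /=; first by move=> x /h[/differentiable_continuous].
split=> [x /h[]//|v].
apply: (@Ck_eq _ _ _ _ _ (fun x => - ((f x)^-1 * (f x)^-1 * 'D_v f x))) => //.
  by move=> x /h[_ ->]; rewrite mulNr expr2 invfM.
apply: (@Ck_eq _ _ _ _ _ (fun x => (-1) * ((f x)^-1 * (f x)^-1 * 'D_v f x))) => //.
  by move=> x _; rewrite mulN1r.
apply: (Ck_bilin oU bilin_mul); first exact: smooth_cst.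
apply: (Ck_bilin oU bilin_mul); last exact: smooth_D.
exact: (Ck_bilin oU bilin_mul).
Qed.

Lemma smooth_coord {V} m n (U : set V) (f : V -> 'M[R]_(m, n)) i j : open U ->
  smooth_on U f -> smooth_on U (fun x => f x i j).
Proof.
move=> oU; apply: (smooth_lin (l := fun M : 'M[R]_(m, n) => M i j)) => //.
  by move=> a u v; rewrite !mxE.
exact: coord_continuous.
Qed.

Lemma derive_comm_mx {V} m n (U : set V) (f : V -> 'M[R]_(m, n)) x u v : open U ->
  smooth_on U f -> U x -> 'D_v ('D_u f) x = 'D_u ('D_v f) x.
Proof.
move=> oU sf Ux; apply/matrixP => i j.
have E w z : 'D_w ('D_z f) x i j = 'D_w ('D_z (fun y => f y i j)) x.
  have [_ <-] := has_D_coord i j (smooth_has_D (smooth_D z sf) Ux).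
  apply: near_eq_derive; near=> y.
  have Uy : U y by near: y; exact: open_nbhs_nbhs.
  by have [_ <-] := has_D_coord i j (smooth_has_D sf Uy).
apply: (etrans (E v u)); apply: (etrans _ (esym (E u v))); have sc := smooth_coord i j oU sf.
apply: derive_comm.
- near=> y; apply: (smooth_diff sc); near: y; exact: open_nbhs_nbhs.
- exact: smooth_diff (smooth_D u sc) Ux.
- exact: smooth_diff (smooth_D v sc) Ux.
Unshelve. all: by end_near. Qed.

(** Continuity is automatic in finite dimension: on the basis [delta_mx] the map is a finite sum of
    products of coordinates. *)
Lemma bilin_mx (W : normedModType R) m n p q (b : 'M[R]_(m, n) -> 'M[R]_(p, q) -> W) :
  (forall y, linear (b^~ y)) -> (forall x, linear (b x)) -> bilin b.
Proof.
move=> bl br; split=> //.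
pose BL y : {linear _ -> _} := HB.pack (b^~ y) (GRing.isLinear.Build _ _ _ _ _ (bl y)).
pose BR x : {linear _ -> _} := HB.pack (b x) (GRing.isLinear.Build _ _ _ _ _ (br x)).
have -> : (fun p : 'M[R]_(m, n) * 'M[R]_(p, q) => b p.1 p.2) =
  (fun p => \sum_i \sum_j \sum_k \sum_l
     (p.1 i j * p.2 k l) *: b (delta_mx i j) (delta_mx k l)).
  apply/funext => -[x y] /=.
  rewrite {1}[x]matrix_sum_delta -[b _ y]/(BL y _) linear_sum; apply: eq_bigr => i _.
  rewrite linear_sum; apply: eq_bigr => j _; rewrite linearZ /=.
  rewrite {1}[y]matrix_sum_delta -[b _ _]/(BR _ _) linear_sum scaler_sumr.
  apply: eq_bigr => k _; rewrite linear_sum scaler_sumr; apply: eq_bigr => l _.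
  by rewrite linearZ /= scalerA.
move=> p0; apply: differentiable_continuous.
have h1 : has_D (fun p : 'M[R]_(m, n) * 'M[R]_(p, q) => p.1) p0 fst.
  by apply: (has_D_lin (l := fst)) (has_D_id p0) => // ?; exact: cvg_fst.
have h2 : has_D (fun p : 'M[R]_(m, n) * 'M[R]_(p, q) => p.2) p0 snd.
  by apply: (has_D_lin (l := snd)) (has_D_id p0) => // ?; exact: cvg_snd.
have h i j k l : has_D (fun p : 'M[R]_(m, n) * 'M[R]_(p, q) =>
    (p.1 i j * p.2 k l) *: b (delta_mx i j) (delta_mx k l)) p0 _ :=
  has_D_scale (has_D_mul (has_D_coord i j h1) (has_D_coord k l h2)) (has_D_cst _ _).
by have [] := has_D_sum (index_enum _) (P := xpredT) (fun i _ =>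
  has_D_sum (index_enum _) (P := xpredT) (fun j _ =>
  has_D_sum (index_enum _) (P := xpredT) (fun k _ =>
  has_D_sum (index_enum _) (P := xpredT) (fun l _ => h i j k l)))).
Qed.

End SmoothFunctions.

(** * The Levi-Civita connection along a map *)

Lemma derive_coord (R : realType) (W : normedModType R) d (f : 'rV[R]_d -> W) x e :
  differentiable f x -> 'D_e f x = \sum_i e 0 i *: 'D_(delta_mx 0 i) f x.
Proof.
move=> df; rewrite deriveE // {1}[e]row_sum_delta linear_sum.
by apply: eq_bigr => i _; rewrite linearZ deriveE.
Qed.

Lemma smooth_det (R : realType) (V : normedModType R) (U : set V) n (M : V -> 'M[R]_n) :
  open U -> (forall i j, smooth_on U (fun x => M x i j)) ->
  smooth_on U (fun x => \det (M x)).
Proof.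
move=> oU sM; apply: smooth_sum => // s _; apply: smooth_mul => //; first exact: smooth_cst.
exact: smooth_prod.
Qed.

(** Cancellation pattern of [cov_commutator]: the second derivatives of the section ([D]) and of the
    map ([g]) and the mixed terms ([h1], [h2]) drop out, leaving derivatives of Christoffel symbols
    ([r1], [r2]) and their products ([k1], [k2]). *)
Lemma commutator_alg (W : zmodType) (D r1 r2 g h1 h2 k1 k2 : W) :
  D + (r1 + g + h1) + (h2 + k1) - (D + (r2 + g + h2) + (h1 + k2)) = r1 - r2 + k1 - k2.
Proof.
have -> : D + (r1 + g + h1) + (h2 + k1) = (D + (g + h1 + h2)) + (r1 + k1).
  by rewrite [LHS](AC (1*3*2) (1*(3*4*5)*(2*6))).
have -> : D + (r2 + g + h2) + (h1 + k2) = (D + (g + h1 + h2)) + (r2 + k2).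
  by rewrite [LHS](AC (1*3*2) (1*(3*5*4)*(2*6))).
by rewrite opprD addrACA subrr add0r opprD addrA [LHS](AC (2*1*1) (1*3*2*4)).
Qed.

Section ChristoffelConnection.
Context {R : realType} {d : nat} (G : 'rV[R]_d -> 'M[R]_d) (Om : set 'rV[R]_d).
Hypotheses (oOm : open Om) (sG : smooth_on Om G)
  (symG : forall y, Om y -> (G y)^T = G y)
  (uG : forall y, Om y -> G y \in unitmx).

Lemma smooth_metric_coord i j : smooth_on Om (fun y => G y i j).
Proof. exact: smooth_coord. Qed.

Lemma smooth_invmx k l : smooth_on Om (fun y => invmx (G y) k l).
Proof.
apply: (smooth_eq oOm (f := fun y => (\det (G y))^-1 * cofactor (G y) l k)).
  by move=> y Oy; rewrite /invmx uG // !mxE.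
apply: smooth_mul => //.
  apply: smooth_inv => //; last exact: smooth_det smooth_metric_coord.
  by move=> y Oy; rewrite -unitfE -unitmxE uG.
apply: smooth_mul => //; first exact: smooth_cst.
apply: smooth_det => // i j.
apply: smooth_eq oOm _ (smooth_metric_coord (lift l i) (lift k j)) => y _.
by rewrite !mxE.
Qed.

Lemma smooth_christoffel k i j : smooth_on Om (christoffel G k i j).
Proof.
apply: smooth_mul => //; first exact: smooth_cst.
apply: smooth_sum => // l _; apply: smooth_mul => //; first exact: smooth_invmx.
apply: smooth_add => //; last apply: smooth_opp => //.
  by apply: smooth_add => //; apply: smooth_D; exact: smooth_metric_coord.
by apply: smooth_D; exact: smooth_metric_coord.
Qed.

Lemma gram_sym y i j : Om y -> G y i j = G y j i.
Proof. by move=> Oy; rewrite -[in RHS]symG // mxE. Qed.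

Lemma pd_gram_sym y l i j : Om y ->
  pd l (fun z => G z i j) y = pd l (fun z => G z j i) y.
Proof.
move=> Oy; apply: near_eq_derive; near=> z; apply: gram_sym.
near: z; exact: open_nbhs_nbhs.
Unshelve. all: by end_near. Qed.

Lemma christoffel_sym y k i j : Om y -> christoffel G k i j y = christoffel G k j i y.
Proof.
move=> Oy; rewrite /christoffel; congr (_ * _); apply: eq_bigr => l _.
by rewrite [pd l _ y]pd_gram_sym // [pd i _ y + _]addrC.
Qed.

Lemma christoffel_lower y i j p : Om y ->
  \sum_k christoffel G k i j y * G y k p =
  2^-1 * (pd i (fun z => G z j p) y + pd j (fun z => G z i p) y - pd p (fun z => G z i j) y).
Proof.
move=> Oy; set E := fun l => pd i (fun z => G z j l) y + pd j (fun z => G z i l) y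
   - pd l (fun z => G z i j) y.
under eq_bigr => k _ do rewrite /christoffel -mulrA mulr_suml.
rewrite -mulr_sumr; congr (_ * _); rewrite exchange_big /=.
transitivity (\sum_l (G y *m invmx (G y)) p l * E l).
  apply: eq_bigr => l _; rewrite !mxE mulr_suml; apply: eq_bigr => k _.
  by rewrite (gram_sym k p Oy) mulrC mulrA.
rewrite mulmxV ?uG // (bigD1 p) //= mxE eqxx mul1r big1 ?addr0 // => l lp.
by rewrite mxE eq_sym (negbTE lp) mul0r.
Qed.

(** Four of the six derivatives in the two lowered symbols cancel by symmetry of [G]; the other two
    agree. *)
Lemma christoffel_metric y m i j : Om y ->
  pd m (fun z => G z i j) y =
  \sum_k christoffel G k m i y * G y k j + \sum_k christoffel G k m j y * G y i k.
Proof.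
move=> Oy; rewrite christoffel_lower //.
under [X in _ + X]eq_bigr => k _ do rewrite (gram_sym i k Oy).
rewrite christoffel_lower // (pd_gram_sym m j i Oy).
by rewrite (pd_gram_sym i m j Oy) (pd_gram_sym j m i Oy); field.
Qed.

Definition Gam y (a b : 'rV[R]_d) : 'rV[R]_d :=
  \row_l \sum_i \sum_j christoffel G l i j y * (a 0 i * b 0 j).

Lemma Gam_sym y a b : Om y -> Gam y a b = Gam y b a.
Proof.
move=> Oy; apply/rowP => l; rewrite !mxE exchange_big; apply: eq_bigr => i _.
by apply: eq_bigr => j _; rewrite christoffel_sym // [a 0 j * _]mulrC.
Qed.

Lemma GamDr y a b c : Gam y a (b + c) = Gam y a b + Gam y a c.
Proof.
apply/rowP => l; rewrite !mxE -big_split; apply: eq_bigr => i _.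
by rewrite -big_split; apply: eq_bigr => j _; rewrite /= !mxE !mulrDr.
Qed.

Lemma ev2E (M : 'M[R]_d) u v : ev2 M u v = \sum_i \sum_j u 0 i * M i j * v 0 j.
Proof.
rewrite /ev2 mxE exchange_big; apply: eq_bigr => j _.
by rewrite !mxE mulr_suml.
Qed.

Lemma ev2Dl (M : 'M[R]_d) u v w : ev2 M (u + v) w = ev2 M u w + ev2 M v w.
Proof. by rewrite /ev2 !mulmxDl mxE. Qed.

Lemma ev2Dr (M : 'M[R]_d) u v w : ev2 M w (u + v) = ev2 M w u + ev2 M w v.
Proof. by rewrite /ev2 linearD mulmxDr mxE. Qed.

Lemma derive_metric y e a b : Om y ->
  ev2 ('D_e G y) a b = ev2 (G y) (Gam y e a) b + ev2 (G y) a (Gam y e b).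
Proof.
move=> Oy.
have dG i j : 'D_e G y i j =
    \sum_m e 0 m * (\sum_k christoffel G k m i y * G y k j +
                    \sum_k christoffel G k m j y * G y i k).
  have [_ <-] := has_D_coord i j (smooth_has_D sG Oy).
  rewrite derive_coord; last exact: smooth_diff (smooth_metric_coord i j) Oy.
  by apply: eq_bigr => m _; rewrite -christoffel_metric.
rewrite !ev2E.
transitivity (\sum_i \sum_j \sum_m \sum_k
   (a 0 i * b 0 j * e 0 m * (christoffel G k m i y * G y k j)) +
   \sum_i \sum_j \sum_m \sum_k
   (a 0 i * b 0 j * e 0 m * (christoffel G k m j y * G y i k))).
  rewrite -big_split; apply: eq_bigr => i _; rewrite -big_split; apply: eq_bigr => j _.
  rewrite dG mulr_sumr mulr_suml -big_split; apply: eq_bigr => m _ /=.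
  by rewrite -!mulr_sumr; ring.
congr (_ + _).
  rewrite exchange_big [RHS]exchange_big; apply: eq_bigr => j _ /=.
  transitivity (\sum_i \sum_k \sum_m a 0 i * b 0 j * e 0 m * (christoffel G k m i y * G y k j)).
    by apply: eq_bigr => i _; rewrite exchange_big.
  rewrite exchange_big; apply: eq_bigr => k _; rewrite mxE !mulr_suml.
  rewrite exchange_big /=; apply: eq_bigr => m _; rewrite !mulr_suml.
  by apply: eq_bigr => i _; ring.
apply: eq_bigr => i _.
transitivity (\sum_j \sum_k \sum_m a 0 i * b 0 j * e 0 m * (christoffel G k m j y * G y i k)).
  by apply: eq_bigr => j _; rewrite exchange_big.
rewrite exchange_big; apply: eq_bigr => k _; rewrite mxE mulr_sumr exchange_big.
apply: eq_bigr => m _; rewrite mulr_sumr; apply: eq_bigr => j _; ring.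
Qed.

Section AlongMap.
Context {V : normedModType R} (phi : V -> 'rV[R]_d).

(** The pull-back of the Levi-Civita connection to vector fields along [phi]; here [phi] may be a
    submersion with fibres of positive dimension. *)
Definition cov (u : V) (a : V -> 'rV[R]_d) (x : V) : 'rV[R]_d :=
  'D_u a x + Gam (phi x) ('D_u phi x) (a x).

Lemma has_D_ev2 (M : V -> 'M[R]_d) (a b : V -> 'rV[R]_d) x dM da db :
  has_D M x dM -> has_D a x da -> has_D b x db ->
  has_D (fun y => ev2 (M y) (a y) (b y)) x
    (fun v => ev2 (dM v) (a x) (b x) + ev2 (M x) (da v) (b x) + ev2 (M x) (a x) (db v)).
Proof.
move=> hM ha hb.
have h : has_D (fun y => \sum_i \sum_j a y 0 i * M y i j * b y 0 j) x
  (fun v => \sum_i \sum_j ((da v 0 i * M x i j + a x 0 i * dM v i j) * b x 0 j +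
     a x 0 i * M x i j * db v 0 j)).
  apply: has_D_sum => i _; apply: has_D_sum => j _.
  by apply: has_D_mul; [apply: has_D_mul|]; apply: has_D_coord.
have -> : (fun y => ev2 (M y) (a y) (b y)) = (fun y => \sum_i \sum_j a y 0 i * M y i j * b y 0 j).
  by apply/funext => y; rewrite ev2E.
apply: has_D_eq h _ => v; rewrite !ev2E -!big_split; apply: eq_bigr => i _.
by rewrite -!big_split; apply: eq_bigr => j _ /=; ring.
Qed.

Lemma cov_metric x u a b : Om (phi x) -> differentiable phi x ->
  differentiable a x -> differentiable b x ->
  'D_u (fun y => ev2 (G (phi y)) (a y) (b y)) x =
  ev2 (G (phi x)) (cov u a x) (b x) + ev2 (G (phi x)) (a x) (cov u b x).
Proof.
move=> Ox dphi da db.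
have hG := has_D_comp (has_D_diff dphi) (smooth_has_D sG Ox).
have [_ ->] := has_D_ev2 hG (has_D_diff da) (has_D_diff db).
by rewrite derive_metric // /cov ev2Dl ev2Dr; ring.
Qed.

Lemma has_D_Gam x (a b : V -> 'rV[R]_d) da db : Om (phi x) -> differentiable phi x ->
  has_D a x da -> has_D b x db ->
  has_D (fun y => Gam (phi y) (a y) (b y)) x (fun v =>
    \row_l (\sum_i \sum_j 'D_('D_v phi x) (christoffel G l i j) (phi x) * (a x 0 i * b x 0 j))
    + Gam (phi x) (da v) (b x) + Gam (phi x) (a x) (db v)).
Proof.
move=> Ox dphi ha hb; apply: has_D_mx => i0 l; rewrite ord1.
have h : has_D (fun y => \sum_i \sum_j christoffel G l i j (phi y) * (a y 0 i * b y 0 j)) x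
  (fun v => \sum_i \sum_j ('D_('D_v phi x) (christoffel G l i j) (phi x) * (a x 0 i * b x 0 j)
     + christoffel G l i j (phi x) * (da v 0 i * b x 0 j + a x 0 i * db v 0 j))).
  apply: has_D_sum => i _; apply: has_D_sum => j _; apply: has_D_mul.
    exact: has_D_comp (has_D_diff dphi) (smooth_has_D (smooth_christoffel l i j) Ox).
  by apply: has_D_mul; apply: has_D_coord.
have -> : (fun y => Gam (phi y) (a y) (b y) 0 l) =
  (fun y => \sum_i \sum_j christoffel G l i j (phi y) * (a y 0 i * b y 0 j)).
  by apply/funext => y; rewrite mxE.
apply: has_D_eq h _ => v; rewrite !mxE -!big_split; apply: eq_bigr => i _.
by rewrite -!big_split; apply: eq_bigr => j _ /=; ring.
Qed.

(** Derivatives of the symbols and iterated [Gam]: the shape in which the curvature comes out of a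
    commutator. *)
Lemma curvature_Gam y A B C : Om y ->
  curvature G y A B C =
  \row_l (\sum_j \sum_k 'D_A (christoffel G l j k) y * (B 0 j * C 0 k))
  - \row_l (\sum_j \sum_k 'D_B (christoffel G l j k) y * (A 0 j * C 0 k))
  + Gam y A (Gam y B C) - Gam y B (Gam y A C).
Proof.
move=> Oy; apply/rowP => l; rewrite !mxE.
have dchr e j k : 'D_e (christoffel G l j k) y = \sum_i e 0 i * pd i (christoffel G l j k) y.
  by rewrite derive_coord //; exact: smooth_diff (smooth_christoffel l j k) Oy.
have GG (P Q : 'rV[R]_d) : \sum_i \sum_j christoffel G l i j y * (P 0 i * Gam y Q C 0 j)
  = \sum_i \sum_j \sum_k (\sum_m christoffel G l i m y * christoffel G m j k y)
      * P 0 i * Q 0 j * C 0 k.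
  apply: eq_bigr => i _.
  transitivity (\sum_m \sum_j \sum_k christoffel G l i m y * christoffel G m j k y
      * P 0 i * Q 0 j * C 0 k).
    apply: eq_bigr => m _; rewrite mxE !mulr_sumr; apply: eq_bigr => j _.
    by rewrite !mulr_sumr; apply: eq_bigr => k _; ring.
  rewrite exchange_big; apply: eq_bigr => j _; rewrite exchange_big; apply: eq_bigr => k _.
  by rewrite /= !mulr_suml.
have dG (P Q : 'rV[R]_d) : \sum_j \sum_k 'D_P (christoffel G l j k) y * (Q 0 j * C 0 k)
  = \sum_i \sum_j \sum_k pd i (christoffel G l j k) y * P 0 i * Q 0 j * C 0 k.
  rewrite [RHS]exchange_big; apply: eq_bigr => j _; rewrite [RHS]exchange_big.
  apply: eq_bigr => k _; rewrite dchr mulr_suml; apply: eq_bigr => i _ /=; ring.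
rewrite (dG A B) (dG B A) (GG A B) (GG B A).
rewrite [X in _ - X + _]exchange_big [X in _ + _ - X]exchange_big /=.
rewrite -!sumrN -!big_split; apply: eq_bigr => i _ /=.
rewrite -!sumrN -!big_split; apply: eq_bigr => j _ /=.
rewrite -!sumrN -!big_split; apply: eq_bigr => k _ /=.
rewrite /riemann sumrB.
move: (\sum_m christoffel G l i m y * _) (\sum_m christoffel G l j m y * _) => s1 s2.
by move: (pd i _ y) (pd j _ y) => p1 p2; ring.
Qed.

Opaque derive Gam christoffel.

(** The directions [u] and [v] are constant fields, so no bracket term appears. *)
Lemma cov_commutator (U : set V) x u v (a : V -> 'rV[R]_d) : open U -> U x ->
  (forall y, U y -> Om (phi y)) -> smooth_on U phi ->
  smooth_on U a ->
  cov u (cov v a) x - cov v (cov u a) x =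
  curvature G (phi x) ('D_u phi x) ('D_v phi x) (a x).
Proof.
move=> oU Ux UO sphi sa.
have dphi : differentiable phi x := smooth_diff sphi Ux.
have hcov w : has_D (cov w a) x _ :=
  has_D_add (smooth_has_D (smooth_D w sa) Ux)
   (has_D_Gam (UO x Ux) dphi (smooth_has_D (smooth_D w sphi) Ux) (smooth_has_D sa Ux)).
have E w z : cov w (cov z a) x = 'D_w ('D_z a) x +
    (\row_l (\sum_i \sum_j 'D_('D_w phi x) (christoffel G l i j) (phi x) *
        (('D_z phi x) 0 i * a x 0 j))
     + Gam (phi x) ('D_w ('D_z phi) x) (a x) + Gam (phi x) ('D_z phi x) ('D_w a x))
    + (Gam (phi x) ('D_w phi x) ('D_z a x)
       + Gam (phi x) ('D_w phi x) (Gam (phi x) ('D_z phi x) (a x))).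
  have [_ <-] := hcov z; rewrite -GamDr; reflexivity.
rewrite (E u v) (E v u) (curvature_Gam _ _ _ (UO x Ux)).
have e1 := derive_comm_mx v u oU sa Ux; have e2 := derive_comm_mx v u oU sphi Ux.
rewrite e1 e2.
exact: commutator_alg.
Qed.

End AlongMap.
End ChristoffelConnection.

(** * Comparison of soldered connections *)

Section Comparison.
Context {R : realType} {V : normedModType R} (U : set V).
Hypothesis oU : open U.

(* [s v] is the section of the bundle with fibre W over U into which the vector
   v is soldered, and [nabla u] the covariant derivative in the direction u. *)
Record soldered_LC (W : normedModType R) (G : V -> W -> W -> R)
    (s : V -> V -> W) (nabla : V -> (V -> W) -> V -> W) : Prop := SolderedLC {
  slc_sym : forall x a b, U x -> G x a b = G x b a;
  slc_metric : forall x u a b, U x -> differentiable a x -> differentiable b x ->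
    'D_u (fun y => G y (a y) (b y)) x = G x (nabla u a x) (b x) + G x (a x) (nabla u b x);
  slc_torsion : forall x u v, U x -> nabla u (s v) x = nabla v (s u) x;
  slc_diff : forall x v, U x -> differentiable (s v) x;
  slc_diff2 : forall x u v, U x -> differentiable (nabla u (s v)) x;
  slc_onto : forall x w, U x -> exists v, s v x = w
}.

(** Koszul's formula for the commuting constant fields [u], [v], [w]. It fixes the connection only
    through its pairings with soldered vectors. *)
Lemma koszul W G s nabla x u v w : @soldered_LC W G s nabla -> U x ->
  G x (nabla u (s v) x) (s w x) =
  2^-1 * ('D_u (fun y => G y (s v y) (s w y)) x + 'D_v (fun y => G y (s u y) (s w y)) x
     - 'D_w (fun y => G y (s u y) (s v y)) x).
Proof.
move=> h Ux; have d z := slc_diff h z Ux.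
rewrite (slc_metric h u Ux (d v) (d w)) (slc_metric h v Ux (d u) (d w)).
rewrite (slc_metric h w Ux (d u) (d v)).
rewrite [G x (s v x) _](slc_sym h _ _ Ux) ![G x (s u x) _](slc_sym h _ _ Ux).
rewrite (slc_torsion h u w Ux) (slc_torsion h v w Ux) (slc_torsion h v u Ux).
by field.
Qed.

Context {W1 W2 : normedModType R}.
Context (G1 : V -> W1 -> W1 -> R) (s1 : V -> V -> W1) (nabla1 : V -> (V -> W1) -> V -> W1).
Context (G2 : V -> W2 -> W2 -> R) (s2 : V -> V -> W2) (nabla2 : V -> (V -> W2) -> V -> W2).
Hypotheses (h1 : soldered_LC G1 s1 nabla1) (h2 : soldered_LC G2 s2 nabla2).
Hypothesis iso : forall x v w, U x -> G1 x (s1 v x) (s1 w x) = G2 x (s2 v x) (s2 w x).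

Lemma derive_iso x u v w : U x ->
  'D_u (fun y => G1 y (s1 v y) (s1 w y)) x = 'D_u (fun y => G2 y (s2 v y) (s2 w y)) x.
Proof.
move=> Ux; apply: near_eq_derive; apply: open_near_eq oU _ Ux => y Uy; exact: iso.
Qed.

Lemma nabla_iso x u v w : U x ->
  G1 x (nabla1 u (s1 v) x) (s1 w x) = G2 x (nabla2 u (s2 v) x) (s2 w x).
Proof. by move=> Ux; rewrite !(koszul _ _ _ h1, koszul _ _ _ h2) // !derive_iso. Qed.

(** Neither derivative is given as a soldered vector, but at [x] each is the soldering of some
    tangent vector by [slc_onto]. The pairing is carried over one argument at a time, with [iso] and
    [nabla_iso]. *)
Lemma nabla_nabla_iso x u v w z : U x ->
  G1 x (nabla1 u (s1 v) x) (nabla1 w (s1 z) x) =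
  G2 x (nabla2 u (s2 v) x) (nabla2 w (s2 z) x).
Proof.
move=> Ux.
have [q q1] := slc_onto h1 (nabla1 u (s1 v) x) Ux.
have [r r2] := slc_onto h2 (nabla2 w (s2 z) x) Ux.
have [q' q2] := slc_onto h1 (nabla1 w (s1 z) x) Ux.
rewrite -r2 -nabla_iso // -q1 iso // [RHS](slc_sym h2) // r2 -nabla_iso // -q2 iso //.
by rewrite (slc_sym h2) //; rewrite -iso.
Qed.

(** Differentiating the identity [nabla_iso], which holds on a neighbourhood, gives the second
    derivative paired with a soldered vector plus a product of first derivatives; the latter agree
    by [nabla_nabla_iso]. *)
Lemma curvature_iso x u v w z : U x ->
  G1 x (nabla1 u (nabla1 v (s1 w)) x) (s1 z x) - G1 x (nabla1 v (nabla1 u (s1 w)) x) (s1 z x)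
  = G2 x (nabla2 u (nabla2 v (s2 w)) x) (s2 z x) - G2 x (nabla2 v (nabla2 u (s2 w)) x) (s2 z x).
Proof.
move=> Ux.
have E u' v' : G1 x (nabla1 u' (nabla1 v' (s1 w)) x) (s1 z x) =
               G2 x (nabla2 u' (nabla2 v' (s2 w)) x) (s2 z x).
  have M1 := slc_metric h1 u' Ux (slc_diff2 h1 v' w Ux) (slc_diff h1 z Ux).
  have M2 := slc_metric h2 u' Ux (slc_diff2 h2 v' w Ux) (slc_diff h2 z Ux).
  rewrite nabla_nabla_iso // in M1.
  apply: (@addIr _ (G2 x (nabla2 v' (s2 w) x) (nabla2 u' (s2 z) x))).
  rewrite -M1 -M2; apply: near_eq_derive; apply: open_near_eq oU _ Ux => y Uy.
  exact: nabla_iso.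
by rewrite (E u v) (E v u).
Qed.

End Comparison.

(** * Norm of the curvature tensor in a quaternionic frame *)

Section TensorContraction.
Context {R : comNzRingType} {d : nat}.
Local Notation tensor := ('I_d -> 'I_d -> 'I_d -> 'I_d -> R).
Implicit Types (S T : tensor) (M N : 'M[R]_d).

Definition contr S T : R := \sum_a \sum_b \sum_c \sum_h S a b c h * T a b c h.
(** Half the Kulkarni-Nomizu square of [M] when [M] is symmetric, up to sign; for the identity it is
    the tensor of constant curvature -1 in the convention of [curv_form]. *)
Definition tQ M : tensor := fun a b c h => M a c * M b h - M b c * M a h.
Definition tE M : tensor := fun a b c h => M a b * M c h.

Lemma contrC S T : contr S T = contr T S.
Proof. by do 4!apply: eq_bigr => ? _; rewrite mulrC. Qed.

Definition tadd S T : tensor := fun a b c h => S a b c h + T a b c h.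
Definition tscale k T : tensor := fun a b c h => k * T a b c h.

Lemma contrDl S S' T : contr (tadd S S') T = contr S T + contr S' T.
Proof. by rewrite -big_split; do 4!(apply: eq_bigr => ? _; rewrite -?big_split) => /=; rewrite mulrDl. Qed.

Lemma contrDr S S' T : contr T (tadd S S') = contr T S + contr T S'.
Proof. by rewrite contrC contrDl !(contrC T). Qed.

Lemma contrZl k S T : contr (tscale k S) T = k * contr S T.
Proof. by rewrite mulr_sumr; do 4!(apply: eq_bigr => ? _; rewrite ?mulr_sumr) => /=; rewrite mulrA. Qed.

Lemma contrZr k S T : contr T (tscale k S) = k * contr T S.
Proof. by rewrite contrC contrZl contrC. Qed.

Lemma contr_comb k l S T : contr (tadd (tscale k S) (tscale l T)) (tadd (tscale k S) (tscale l T)) =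
  k ^+ 2 * contr S S + 2 * k * l * contr S T + l ^+ 2 * contr T T.
Proof. by rewrite !(contrDl, contrDr, contrZl, contrZr) (contrC T S); ring. Qed.

Lemma contr_sum5 S0 S1 S2 S3 T :
  let S := tadd (tadd (tadd S0 S1) (tadd S2 S3)) (tscale 2 T) in
  contr S S = contr S0 S0 + contr S1 S1 + contr S2 S2 + contr S3 S3
    + 2 * (contr S0 S1 + contr S0 S2 + contr S0 S3 + contr S1 S2 + contr S1 S3 + contr S2 S3)
    + 4 * (contr S0 T + contr S1 T + contr S2 T + contr S3 T) + 4 * contr T T.
Proof.
rewrite /= !(contrDl, contrDr, contrZl, contrZr) !(contrC T).
by rewrite !(contrC S3) !(contrC S2 S0, contrC S2 S1, contrC S1 S0); ring.
Qed.

Lemma contr_acbd M N M' N' :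
  \sum_a \sum_b \sum_c \sum_h (M a c * N b h) * (M' a c * N' b h) =
  \tr (M^T *m M') * \tr (N^T *m N').
Proof.
have trE (P Q : 'M[R]_d) : \tr (P^T *m Q) = \sum_a \sum_c P a c * Q a c.
  rewrite /mxtrace exchange_big; apply: eq_bigr => c _; rewrite mxE.
  by apply: eq_bigr => a _; rewrite mxE.
rewrite !trE mulr_suml; apply: eq_bigr => a _; rewrite mulr_sumr.
apply: eq_bigr => b _; rewrite mulr_suml; apply: eq_bigr => c _; rewrite mulr_sumr.
by apply: eq_bigr => h _; ring.
Qed.

Lemma contr_cycle M N M' N' :
  \sum_a \sum_b \sum_c \sum_h (M c a * N a b) * (M' b h * N' h c) =
  \tr (M *m N *m M' *m N').
Proof.
rewrite /mxtrace.
transitivity (\sum_c \sum_a \sum_b \sum_h (M c a * N a b) * (M' b h * N' h c)).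
  rewrite exchange_big /=.
  under eq_bigr => b _ do rewrite exchange_big /=.
  rewrite exchange_big /=; apply: eq_bigr => c _; exact: exchange_big.
apply: eq_bigr => c _; rewrite -!mulmxA mxE; apply: eq_bigr => a _.
rewrite mxE mulr_sumr; apply: eq_bigr => b _; rewrite mxE !mulr_sumr.
by apply: eq_bigr => h _; rewrite !mulrA.
Qed.

Lemma sum_swap T : \sum_a \sum_b \sum_c \sum_h T a b c h = \sum_a \sum_b \sum_c \sum_h T b a c h.
Proof. exact: exchange_big. Qed.

Lemma sumB4 S T : \sum_a \sum_b \sum_c \sum_h (S a b c h - T a b c h) =
  \sum_a \sum_b \sum_c \sum_h S a b c h - \sum_a \sum_b \sum_c \sum_h T a b c h.
Proof. by do 4!(rewrite -sumrB; apply: eq_bigr => ? _). Qed.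

Lemma sum4_eq S T : (forall a b c h, S a b c h = T a b c h) ->
  \sum_a \sum_b \sum_c \sum_h S a b c h = \sum_a \sum_b \sum_c \sum_h T a b c h.
Proof. by move=> e; do 4!(apply: eq_bigr => ? _). Qed.

Lemma contr_acbh_bcah M N :
  \sum_a \sum_b \sum_c \sum_h (M a c * M b h) * (N b c * N a h) =
  \tr (M^T *m N *m M^T *m N).
Proof.
rewrite -contr_cycle; apply: eq_bigr => a _.
transitivity (\sum_c \sum_h \sum_b M a c * M b h * (N b c * N a h)).
  rewrite exchange_big; apply: eq_bigr => c _; exact: exchange_big.
rewrite exchange_big /=; apply: eq_bigr => h _; apply: eq_bigr => c _; apply: eq_bigr => b _.
rewrite !mxE; ring.
Qed.

Lemma contr_acbh_abch M N :
  \sum_a \sum_b \sum_c \sum_h (M a c * M b h) * (N a b * N c h) =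
  \tr (M^T *m N *m M *m N^T).
Proof. by rewrite -contr_cycle; apply: sum4_eq => a b c h; rewrite !mxE; ring. Qed.

(** [tQ N] changes sign when the first two indices are exchanged, so both halves of [tQ M]
    contribute equally: hence the factor 2. *)
Lemma contr_QQ M N : contr (tQ M) (tQ N) =
  2 * ((\tr (M^T *m N)) ^+ 2 - \tr (M^T *m N *m M^T *m N)).
Proof.
have H : contr (fun a b c h => M a c * M b h) (tQ N) =
    (\tr (M^T *m N)) ^+ 2 - \tr (M^T *m N *m M^T *m N).
  rewrite expr2 -contr_acbd -contr_acbh_bcah -sumB4; apply: sum4_eq => a b c h.
  by rewrite /tQ mulrBr.
rewrite -H mulr2n mulrDl mul1r {2}/contr sum_swap /contr -big_split.
apply: eq_bigr => a _; rewrite -big_split; apply: eq_bigr => b _.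
rewrite -big_split; apply: eq_bigr => c _; rewrite -big_split; apply: eq_bigr => h _ /=.
by rewrite /tQ; ring.
Qed.

(** Skewness of [N] makes the two halves of [tQ M] contribute equally. *)
Lemma contr_QE M N : N^T = - N -> contr (tQ M) (tE N) = 2 * \tr (M^T *m N *m M *m N^T).
Proof.
move=> sN; have sNE a b : N b a = - N a b by move/matrixP : sN => /(_ a b); rewrite !mxE.
rewrite -contr_acbh_abch mulr2n mulrDl mul1r {2}sum_swap /contr -big_split.
apply: eq_bigr => a _; rewrite -big_split; apply: eq_bigr => b _.
rewrite -big_split; apply: eq_bigr => c _; rewrite -big_split; apply: eq_bigr => h _ /=.
by rewrite /tQ /tE [N b a]sNE; ring.
Qed.

Lemma contr_EE M N : contr (tE M) (tE N) = (\tr (M^T *m N)) ^+ 2.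
Proof.
rewrite expr2 -contr_acbd /contr; apply: eq_bigr => a _.
rewrite exchange_big /=; apply: eq_bigr => b _; apply: eq_bigr => c _; apply: eq_bigr => h _.
by rewrite /tE; ring.
Qed.
End TensorContraction.

(** * Traces of words in quaternionic matrices and A *)

Section QuaternionicNorm.
Context {R : realFieldType} {d : nat}.
Variables O1 O2 O3 A : 'M[R]_d.
Hypotheses (O1T : O1^T = - O1) (O2T : O2^T = - O2) (O3T : O3^T = - O3) (AT : A^T = A)
  (O11 : O1 *m O1 = - 1%:M) (O22 : O2 *m O2 = - 1%:M) (O12 : O1 *m O2 = - O3)
  (O1A : O1 *m A = A *m O1) (O2A : O2 *m A = - (A *m O2)) (O3A : O3 *m A = - (A *m O3)).

Lemma O21 : O2 *m O1 = O3.
Proof. by apply: trmx_inj; rewrite trmx_mul O1T O2T mulNmx mulmxN opprK O12 O3T. Qed.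
Lemma O31 : O3 *m O1 = - O2.
Proof. by rewrite -O21 -mulmxA O11 mulmxN mulmx1. Qed.
Lemma O13 : O1 *m O3 = O2.
Proof. by rewrite -O21 mulmxA O12 mulNmx O31 opprK. Qed.
Lemma O23 : O2 *m O3 = - O1.
Proof. by rewrite -O21 mulmxA O22 mulNmx mul1mx. Qed.
Lemma O32 : O3 *m O2 = O1.
Proof. by rewrite -O21 -mulmxA O12 mulmxN O23 opprK. Qed.
Lemma O33 : O3 *m O3 = - 1%:M.
Proof. by rewrite -{1}O21 -mulmxA O13 O22. Qed.

(** Applies a relation inside a left-associated product. The relations together bring a word to a
    signed power of [A] followed by at most one [O]. *)
Lemma word2 (p : nat) (X : 'M[R]_(p, d)) (P Q S : 'M[R]_d) :
  P *m Q = S -> X *m P *m Q = X *m S.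
Proof. by move=> <-; rewrite mulmxA. Qed.

Definition wordE := (O11, O22, O33, O12, O21, O13, O31, O23, O32, O1A, O2A, O3A).
Definition wordsE (X : 'M[R]_d) :=
  (word2 X O11, word2 X O22, word2 X O33, word2 X O12, word2 X O21, word2 X O13,
   word2 X O31, word2 X O23, word2 X O32, word2 X O1A, word2 X O2A, word2 X O3A).
Definition mxE' := (@mulNmx R d d d, @mulmxN R d d d, @opprK 'M[R]_d, @mul1mx R d d,
  @mulmx1 R d d, @mulmxA R d d d d).

Lemma tr_skew (M : 'M[R]_d) : M^T = - M -> \tr M = 0.
Proof. by move=> h; have := mxtrace_tr M; rewrite h raddfN /=; lra. Qed.

Lemma trO1 : \tr O1 = 0. Proof. exact: tr_skew. Qed.
Lemma trO2 : \tr O2 = 0. Proof. exact: tr_skew. Qed.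
Lemma trO3 : \tr O3 = 0. Proof. exact: tr_skew. Qed.

(** Conjugation by [O2] turns [A] into [- A] and preserves the trace. *)
Lemma trA : \tr A = 0.
Proof.
have := mxtrace_mulC (A *m O2) O2.
by rewrite !(mxE', wordE, wordsE) !raddfN /=; lra.
Qed.
Lemma trAO1 : \tr (A *m O1) = 0.
Proof. by apply: tr_skew; rewrite trmx_mul AT O1T mulNmx O1A. Qed.
(** Unlike [A *m O1], this product is symmetric, so skewness gives nothing; it anticommutes with
    [O1] instead. *)
Lemma trAO2 : \tr (A *m O2) = 0.
Proof.
have := mxtrace_mulC (A *m O2 *m O1) O1.
by rewrite !(mxE', wordE, wordsE) !raddfN /=; lra.
Qed.
Lemma trAO3 : \tr (A *m O3) = 0.
Proof.
have := mxtrace_mulC (A *m O3 *m O1) O1.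
by rewrite !(mxE', wordE, wordsE) !raddfN /=; lra.
Qed.
Lemma trAAO1 : \tr (A *m A *m O1) = 0.
Proof. by apply: tr_skew; rewrite !trmx_mul AT O1T !(mxE', wordE, wordsE). Qed.
Lemma trAAO2 : \tr (A *m A *m O2) = 0.
Proof. by apply: tr_skew; rewrite !trmx_mul AT O2T !(mxE', wordE, wordsE). Qed.
Lemma trAAO3 : \tr (A *m A *m O3) = 0.
Proof. by apply: tr_skew; rewrite !trmx_mul AT O3T !(mxE', wordE, wordsE). Qed.
Definition trE := (trO1, trO2, trO3, trA, trAO1, trAO2, trAO3, trAAO1, trAAO2, trAAO3).

Lemma trN (M : 'M[R]_d) : \tr (- M) = - \tr M. Proof. exact: raddfN. Qed.

(** Four times the curvature of quaternionic hyperbolic space, with sectional curvatures between -1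
    and -1/4. *)
Definition tO : 'I_d -> 'I_d -> 'I_d -> 'I_d -> R :=
  tadd (tadd (tadd (tQ 1%:M) (tQ O1)) (tadd (tQ O2) (tQ O3)))
    (tscale 2 (tadd (tE O1) (tadd (tE O2) (tE O3)))).
(** The analogue with [A] inserted. Only [A *m O1] is skew, hence a single [tE] term instead of
    three. *)
Definition tS : 'I_d -> 'I_d -> 'I_d -> 'I_d -> R :=
  tadd (tadd (tadd (tQ A) (tQ (A *m O1))) (tadd (tQ (A *m O2)) (tQ (A *m O3))))
    (tscale 2 (tE (A *m O1))).

Lemma sAO1 : (A *m O1)^T = - (A *m O1). Proof. by rewrite trmx_mul AT O1T mulNmx O1A. Qed.

Definition contrE := (@contrDl R d, @contrDr R d, @contrZl R d, @contrZr R d,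
  @contr_QQ R d, @contr_EE R d,
  fun M => contr_QE M O1T, fun M => contr_QE M O2T, fun M => contr_QE M O3T,
  fun M => contr_QE M sAO1,
  fun M => contrC (tE O1) (tQ M), fun M => contrC (tE O2) (tQ M), fun M => contrC (tE O3) (tQ M),
  fun M => contrC (tE (A *m O1)) (tQ M)).
Definition trmxE := (@trmx_mul R d d d, @trmx1 R d, O1T, O2T, O3T, AT).

Lemma contr_OO : contr tO tO = 20 * d%:R ^+ 2 + 16 * d%:R.
Proof.
rewrite /tO !contrE !trmxE !(mxE', wordE, wordsE) !trN !trE !mxtrace1.
by ring.
Qed.

Ltac trace_word := rewrite !contrE !trmxE ?(mxE', wordE, wordsE) ?trN ?trE; by ring.

(** [tS] behaves as a quaternionic Weyl tensor: it is orthogonal to each of the seven summands of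
    [tO]. The individual pairings are multiples of [\tr (A *m A)] that cancel over the summands of
    [tS]. *)
Lemma contr_OS : contr tO tS = 0.
Proof.
have q0 : contr (tQ 1%:M) tS = 0 by rewrite /tS; trace_word.
have q1 : contr (tQ O1) tS = 0 by rewrite /tS; trace_word.
have q2 : contr (tQ O2) tS = 0 by rewrite /tS; trace_word.
have q3 : contr (tQ O3) tS = 0 by rewrite /tS; trace_word.
have e1 : contr (tE O1) tS = 0 by rewrite /tS; trace_word.
have e2 : contr (tE O2) tS = 0 by rewrite /tS; trace_word.
have e3 : contr (tE O3) tS = 0 by rewrite /tS; trace_word.
rewrite /tO (contrDl (tadd (tadd _ _) _)) (contrDl (tadd (tQ _) _)) 2!(contrDl (tQ _) (tQ _)).
by rewrite contrZl (contrDl (tE _)) (contrDl (tE _) (tE _)) q0 q1 q2 q3 e1 e2 e3 !addr0 mulr0 addr0.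
Qed.

Lemma contr_SS : contr tS tS = 12 * \tr (A *m A) ^+ 2 + 48 * \tr (A *m A *m A *m A).
Proof.
set t := \tr (A *m A); set q := \tr (A *m A *m A *m A).
have e00 : contr (tQ A) (tQ A) = 2 * (t ^+ 2 - q) by trace_word.
have e11 : contr (tQ (A *m O1)) (tQ (A *m O1)) = 2 * (t ^+ 2 - q) by trace_word.
have e22 : contr (tQ (A *m O2)) (tQ (A *m O2)) = 2 * (t ^+ 2 - q) by trace_word.
have e33 : contr (tQ (A *m O3)) (tQ (A *m O3)) = 2 * (t ^+ 2 - q) by trace_word.
have e01 : contr (tQ A) (tQ (A *m O1)) = 2 * q by trace_word.
have e02 : contr (tQ A) (tQ (A *m O2)) = 2 * q by trace_word.
have e03 : contr (tQ A) (tQ (A *m O3)) = 2 * q by trace_word.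
have e12 : contr (tQ (A *m O1)) (tQ (A *m O2)) = 2 * q by trace_word.
have e13 : contr (tQ (A *m O1)) (tQ (A *m O3)) = 2 * q by trace_word.
have e23 : contr (tQ (A *m O2)) (tQ (A *m O3)) = 2 * q by trace_word.
have f0 : contr (tQ A) (tE (A *m O1)) = 2 * q by trace_word.
have f1 : contr (tQ (A *m O1)) (tE (A *m O1)) = 2 * q by trace_word.
have f2 : contr (tQ (A *m O2)) (tE (A *m O1)) = 2 * q by trace_word.
have f3 : contr (tQ (A *m O3)) (tE (A *m O1)) = 2 * q by trace_word.
have ff : contr (tE (A *m O1)) (tE (A *m O1)) = t ^+ 2 by trace_word.
rewrite /tS contr_sum5 e00 e11 e22 e33 e01 e02 e03 e12 e13 e23 f0 f1 f2 f3 ff.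
by ring.
Qed.

End QuaternionicNorm.

(** * From all pairs of indices to a basis of bivectors *)

Section PairSums.
Context {R : realFieldType} {d : nat}.

Lemma sum_lt_pairs (F : 'I_d -> 'I_d -> R) : (forall a b, F a b = F b a) ->
  (forall a, F a a = 0) ->
  \sum_(a < d) \sum_(b < d | (a < b)%N) F a b = 2^-1 * \sum_a \sum_b F a b.
Proof.
move=> Fs F0.
have E : \sum_a \sum_b F a b = \sum_(a < d) \sum_(b < d | (a < b)%N) F a b
     + \sum_(a < d) \sum_(b < d | (b < a)%N) F a b.
  rewrite -big_split; apply: eq_bigr => a _ /=.
  rewrite (bigID (fun b : 'I_d => (a < b)%N)) /=; congr (_ + _).
  rewrite (bigD1 a) /= ?ltnn // F0 add0r; apply: eq_bigl => b.
  by rewrite -leqNgt ltn_neqAle andbC.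
have S : \sum_(a < d) \sum_(b < d | (b < a)%N) F a b = \sum_(a < d) \sum_(b < d | (a < b)%N) F a b.
  rewrite (exchange_big_dep predT) //=; apply: eq_bigr => a _; apply: eq_bigr => b _.
  exact: Fs.
by rewrite E S; field.
Qed.

Lemma sum_lt_contr (T : 'I_d -> 'I_d -> 'I_d -> 'I_d -> R) :
  (forall a b c h, T b a c h = - T a b c h) -> (forall a b c h, T c h a b = T a b c h) ->
  \sum_(a < d) \sum_(b < d | (a < b)%N) \sum_(c < d) \sum_(h < d | (c < h)%N)
    T a b c h * T c h a b = 4^-1 * contr T T.
Proof.
move=> Ts Tp.
have T0 a c h : T a a c h = 0 by have := Ts a a c h; lra.
rewrite sum_lt_pairs => [|a b|a]; first last.
- by rewrite big1 // => c _; rewrite big1 // => h _; rewrite T0 mul0r.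
- apply: eq_bigr => c _; apply: eq_bigr => h _.
  by rewrite (Tp b a c h) (Ts a b c h) (Tp a b c h) mulrNN.
have -> : (4^-1 : R) = 2^-1 * 2^-1 by field.
rewrite -mulrA; congr (_ * _); rewrite mulr_sumr; apply: eq_bigr => a _.
rewrite mulr_sumr; apply: eq_bigr => b _; rewrite sum_lt_pairs => [|c h|c].
- by congr (_ * _); apply: eq_bigr => c _; apply: eq_bigr => h _; rewrite (Tp a b c h).
- by rewrite (Tp h c a b) (Ts c h a b) (Tp c h a b) mulrNN.
- by rewrite T0 mulr0.
Qed.

End PairSums.

(** * The twisted connection on a quaternionic module *)

(** [qf_g_nd] replaces positivity, [g] being indefinite in the example. [J] commutes with [I1] only,
    which singles out [I1] among the three structures. *)
Record quaternionic_form (R : realFieldType) (V : lmodType R) (g : V -> V -> R)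
    (I1 I2 I3 J : V -> V) : Prop := QuaternionicForm {
  qf_gDl : forall u v w, g (u + v) w = g u w + g v w;
  qf_gZl : forall a u w, g (a *: u) w = a * g u w;
  qf_gC : forall u v, g u v = g v u;
  qf_g_nd : forall u v, (forall t, g u t = g v t) -> u = v;
  qf_I1l : linear I1;
  qf_I2l : linear I2;
  qf_I3l : linear I3;
  qf_Jl : linear J;
  qf_I11 : forall u, I1 (I1 u) = - u;
  qf_I22 : forall u, I2 (I2 u) = - u;
  qf_I12 : forall u, I1 (I2 u) = I3 u;
  qf_I21 : forall u, I2 (I1 u) = - I3 u;
  qf_JJ : forall u, J (J u) = u;
  qf_JI1 : forall u, J (I1 u) = I1 (J u);
  qf_JI2 : forall u, J (I2 u) = - I2 (J u);
  qf_gI1 : forall u v, g u (I1 v) = - g (I1 u) v;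
  qf_gI2 : forall u v, g u (I2 v) = - g (I2 u) v;
  qf_gJ : forall u v, g u (J v) = g (J u) v
}.

(* In the flat example zeta is the z-part of the point, fi = 1 / f_Z and
   hi = 1 / f_H; the last clause is f_H - f_Z = g(Z, Z). *)
Record base_point (R : realFieldType) (V : lmodType R) (g : V -> V -> R) (J : V -> V)
    (zeta : V) (fi hi : R) : Prop := BasePoint {
  bp_J : J zeta = zeta;
  bp_fi : fi != 0;
  bp_hi : hi != 0;
  bp_g : g zeta zeta = hi^-1 - fi^-1
}.

Section TwistedConnection.
Context {R : realFieldType} {V : lmodType R}.
Variables (g : V -> V -> R) (I1 I2 I3 J : V -> V) (zeta : V) (fi hi : R).
Hypothesis Q : quaternionic_form g I1 I2 I3 J.
Hypothesis Pt : base_point g J zeta fi hi.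

Let gDl := qf_gDl Q.
Let gZl := qf_gZl Q.
Let gC := qf_gC Q.
Let g_nd := qf_g_nd Q.
Let I1l := qf_I1l Q.
Let I2l := qf_I2l Q.
Let I3l := qf_I3l Q.
Let Jl := qf_Jl Q.
Let I11 := qf_I11 Q.
Let I22 := qf_I22 Q.
Let I12 := qf_I12 Q.
Let I21 := qf_I21 Q.
Let JJ := qf_JJ Q.
Let JI1 := qf_JI1 Q.
Let JI2 := qf_JI2 Q.
Let gI1 := qf_gI1 Q.
Let gI2 := qf_gI2 Q.
Let gJ := qf_gJ Q.
Let Jzeta := bp_J Pt.
Let fi0 := bp_fi Pt.
Let hi0 := bp_hi Pt.
Let gzeta := bp_g Pt.

Definition q4 (F : (V -> V) -> V) : V := F id + F I1 + F I2 + F I3.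
Definition s4 (F : (V -> V) -> R) : R := F id + F I1 + F I2 + F I3.

(** Up to sign and order, the four forms iota_Z omega_mu, since Z = - I1 zeta. *)
Definition gam (I : V -> V) X := g (I zeta) X.

Definition Lam X Y : V :=
  q4 (fun I => (fi / 2 * gam I Y) *: I X + (fi / 2 * gam I X) *: I Y
     + (hi / 2 * g (I (J X)) Y) *: I zeta).

(** Derivative of the coefficients of [Lam] when the base point moves by [W]: then zeta moves by
    [pW], [fi] by [fi ^+ 2 * g zeta W] and [hi] by [- hi ^+ 2 * g zeta W]. *)
Definition dLam W X Y : V := let pW := 2^-1 *: (W + J W) in
  q4 (fun I => (fi / 2 * g (I pW) Y + fi ^+ 2 / 2 * gam id W * gam I Y) *: I X
     + (fi / 2 * g (I pW) X + fi ^+ 2 / 2 * gam id W * gam I X) *: I Y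
     + (hi / 2 * g (I (J X)) Y) *: I pW
     - (hi ^+ 2 / 2 * gam id W * g (I (J X)) Y) *: I zeta).

Definition Zt : V := - I1 zeta.
(** The linear vector field Z as an endomorphism, that is, its own differential. *)
Definition ZZ X : V := - (2^-1 *: I1 (X + J X)).
(** The form omega_H: d (iota_Z g) is - 2 omega_1 on the z-directions, so omega_1 changes sign there
    and is unchanged on the w-directions. *)
Definition omH X Y := - g (I1 (J X)) Y.

(** The last term collects the exterior derivatives of the coframe and of eta / f_H, both
    proportional to omega_H on horizontal vectors. *)
Definition Rhat X Y U : V :=
  dLam X Y U - dLam Y X U + Lam X (Lam Y U) - Lam Y (Lam X U)
  - (omH X Y * hi) *: (Lam Zt U + ZZ U).

Definition hH X Y := fi * g X Y + fi ^+ 2 * s4 (fun I => gam I X * gam I Y).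

Lemma gNl u w : g (- u) w = - g u w. Proof. by rewrite -scaleN1r gZl mulN1r. Qed.
Lemma gDr u v w : g w (u + v) = g w u + g w v. Proof. by rewrite gC gDl !(gC w). Qed.
Lemma gZr a u w : g w (a *: u) = a * g w u. Proof. by rewrite gC gZl (gC w). Qed.
Lemma gNr u w : g w (- u) = - g w u. Proof. by rewrite gC gNl (gC w). Qed.

Lemma linD (L : V -> V) u v : linear L -> L (u + v) = L u + L v.
Proof. by move=> l; rewrite -[u]scale1r l !scale1r. Qed.
Lemma linZ (L : V -> V) a u : linear L -> L (a *: u) = a *: L u.
Proof. 
move=> l; have L0 : L 0 = 0 by apply: (addrI (L 0)); rewrite -linD // !addr0.
by rewrite -[a *: u]addr0 l L0 addr0.
Qed.
Lemma linN (L : V -> V) u : linear L -> L (- u) = - L u.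
Proof. by move=> l; rewrite -scaleN1r linZ // scaleN1r. Qed.

Definition linE := (fun u v => linD u v I1l, fun u v => linD u v I2l,
  fun u v => linD u v I3l, fun u v => linD u v Jl,
  fun a u => linZ a u I1l, fun a u => linZ a u I2l,
  fun a u => linZ a u I3l, fun a u => linZ a u Jl,
  fun u => linN u I1l, fun u => linN u I2l, fun u => linN u I3l, fun u => linN u Jl).

Lemma I13 u : I1 (I3 u) = - I2 u. Proof. by rewrite -I12 I11. Qed.
Lemma I31 u : I3 (I1 u) = I2 u. Proof. by rewrite -I12 I21 linE -I12 I11 opprK. Qed.
Lemma I23 u : I2 (I3 u) = I1 u. Proof. by rewrite -I12 I21 -I12 I22 linE opprK. Qed.
Lemma I32 u : I3 (I2 u) = - I1 u. Proof. by rewrite -I12 I22 linE. Qed.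
Lemma I33 u : I3 (I3 u) = - u. Proof. by rewrite -{1}I12 I23 I11. Qed.
Lemma JI3 u : J (I3 u) = - I3 (J u). Proof. by rewrite -I12 JI1 JI2 linE I12. Qed.
Lemma gI3 u v : g u (I3 v) = - g (I3 u) v.
Proof. by rewrite -I12 gI1 gI2 opprK I21 gNl. Qed.

Definition quatE := (I11, I22, I33, I12, I21, I13, I31, I23, I32, JJ, JI1, JI2, JI3, Jzeta).
Definition gE := (gDl, gZl, gNl, gDr, gZr, gNr, gI1, gI2, gI3).

Lemma gflip1 X Y : g (I1 Y) X = - g (I1 X) Y. Proof. by rewrite gC gE. Qed.
Lemma gflip2 X Y : g (I2 Y) X = - g (I2 X) Y. Proof. by rewrite gC gE. Qed.
Lemma gflip3 X Y : g (I3 Y) X = - g (I3 X) Y. Proof. by rewrite gC gE. Qed.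
Lemma gflipJ X Y : g (J Y) X = g (J X) Y. Proof. by rewrite gC gJ. Qed.
Lemma gflipJ1 X Y : g (I1 (J Y)) X = - g (I1 (J X)) Y.
Proof. by rewrite gC gI1 gJ JI1. Qed.
Lemma gflipJ2 X Y : g (I2 (J Y)) X = g (I2 (J X)) Y.
Proof. by rewrite gC gI2 gJ JI2 gNl opprK. Qed.
Lemma gflipJ3 X Y : g (I3 (J Y)) X = g (I3 (J X)) Y.
Proof. by rewrite gC gI3 gJ JI3 gNl opprK. Qed.
(** Orients every scalar product of [X] and [Y] the same way, so that [ring] and [field] see equal
    atoms. *)
Definition gflip X Y := (gC Y X, gflip1 X Y, gflip2 X Y, gflip3 X Y,
  gflipJ X Y, gflipJ1 X Y, gflipJ2 X Y, gflipJ3 X Y).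

Lemma g_skew0 (a : R) : a = - a -> a = 0.
Proof. by move=> e; lra. Qed.
Lemma gz1 : g (I1 zeta) zeta = 0. Proof. by apply: g_skew0; rewrite {1}gflip1. Qed.
Lemma gz2 : g (I2 zeta) zeta = 0. Proof. by apply: g_skew0; rewrite {1}gflip2. Qed.
Lemma gz3 : g (I3 zeta) zeta = 0. Proof. by apply: g_skew0; rewrite {1}gflip3. Qed.
Definition gzE := (gz1, gz2, gz3, gzeta).

(** Everything is symmetric in [X] and [Y] except the pairing by [I1] after [J]; the skew part found
    here cancels the torsion of the coframe. *)
Lemma Lam_torsion X Y : Lam X Y - Lam Y X = (omH X Y * hi) *: Zt.
Proof.
apply: g_nd => T; rewrite /Lam /omH /Zt /q4 /gam !gE !(gflip X Y). by field.
Qed.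

Lemma gLam X Y T : g (Lam X Y) T = s4 (fun I => fi / 2 * g (I zeta) Y * g (I X) T
   + fi / 2 * g (I zeta) X * g (I Y) T + hi / 2 * g (I (J X)) Y * g (I zeta) T).
Proof. by rewrite /Lam /q4 /gam !(gDl, gZl). Qed.

Lemma gdLam W X Y T : g (dLam W X Y) T = s4 (fun I =>
     (fi / 4 * (g (I W) Y + g (I (J W)) Y) + fi ^+ 2 / 2 * g zeta W * g (I zeta) Y) * g (I X) T
   + (fi / 4 * (g (I W) X + g (I (J W)) X) + fi ^+ 2 / 2 * g zeta W * g (I zeta) X) * g (I Y) T
   + hi / 4 * g (I (J X)) Y * (g (I W) T + g (I (J W)) T)
   - hi ^+ 2 / 2 * g zeta W * g (I (J X)) Y * g (I zeta) T).
Proof.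
rewrite /dLam /q4 /s4 /gam !linE !(gDl, gZl, gNl).
by field.
Qed.

Lemma gII A B : (g (I1 A) (I1 B) = g A B) * (g (I1 A) (I2 B) = g (I3 A) B) *
  (g (I1 A) (I3 B) = - g (I2 A) B) * (g (I2 A) (I1 B) = - g (I3 A) B) *
  (g (I2 A) (I2 B) = g A B) * (g (I2 A) (I3 B) = g (I1 A) B) *
  (g (I3 A) (I1 B) = g (I2 A) B) * (g (I3 A) (I2 B) = - g (I1 A) B) * (g (I3 A) (I3 B) = g A B) *
  (g A (I1 B) = - g (I1 A) B) * (g A (I2 B) = - g (I2 A) B) * (g A (I3 B) = - g (I3 A) B).
Proof. by rewrite !gE !quatE !gE !opprK. Qed.

Lemma gIJ A B : (g (I1 A) (J B) = g (I1 (J A)) B) *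
  (g (I2 A) (J B) = - g (I2 (J A)) B) * (g (I3 A) (J B) = - g (I3 (J A)) B) *
  (g A (J B) = g (J A) B).
Proof. by rewrite !gJ !quatE !gE. Qed.

(** Here the value of g (zeta, zeta) enters, through [gzE]; it ties [fi] and [hi] together in the
    quadratic terms. *)
Lemma gamLam Y U :
  [/\ g zeta (Lam Y U) = fi * (2 * g zeta Y * g zeta U
         - s4 (fun I => g (I zeta) Y * g (I zeta) U)) + hi / 2 * g (J Y) U * (hi^-1 - fi^-1),
      g (I1 zeta) (Lam Y U) = fi * (g zeta Y * g (I1 zeta) U + g zeta U * g (I1 zeta) Y)
         + hi / 2 * g (I1 (J Y)) U * (hi^-1 - fi^-1),
      g (I2 zeta) (Lam Y U) = fi * (g zeta Y * g (I2 zeta) U + g zeta U * g (I2 zeta) Y)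
         + hi / 2 * g (I2 (J Y)) U * (hi^-1 - fi^-1) &
      g (I3 zeta) (Lam Y U) = fi * (g zeta Y * g (I3 zeta) U + g zeta U * g (I3 zeta) Y)
         + hi / 2 * g (I3 (J Y)) U * (hi^-1 - fi^-1)].
Proof.
rewrite ![g _ (Lam Y U)]gC !gLam /s4 /= !(gII, gzE) !(gflip zeta Y, gflip zeta U).
split; by field; rewrite fi0 hi0.
Qed.

(** The left side is the derivative of g_H along [W] on constant vectors, so this is metric
    compatibility of [Lam]. *)
Lemma hH_metric W X Y : let pW := 2^-1 *: (W + J W) in
  fi ^+ 2 * g zeta W * g X Y + 2 * fi ^+ 3 * g zeta W * s4 (fun I => gam I X * gam I Y)
  + fi ^+ 2 * s4 (fun I => g (I pW) X * gam I Y + gam I X * g (I pW) Y)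
  = hH (Lam W X) Y + hH X (Lam W Y).
Proof.
have [a0 a1 a2 a3] := gamLam W X; have [b0 b1 b2 b3] := gamLam W Y.
rewrite /= /hH /s4 /gam /= a0 a1 a2 a3 b0 b1 b2 b3 (gC X (Lam W Y)) !gLam /s4 /= !linE.
rewrite !(gDl, gZl) !(gflip X Y, gflip W X, gflip W Y).
by field; rewrite fi0 hi0.
Qed.

Lemma gLamZt U T : g (Lam Zt U) T = - (fi / 2) * (hi^-1 - fi^-1) * g (I1 U) T
  + (hi - fi) / 2 * (g zeta U * g (I1 zeta) T - g (I1 zeta) U * g zeta T
     - g (I2 zeta) U * g (I3 zeta) T + g (I3 zeta) U * g (I2 zeta) T).
Proof.
rewrite gLam /Zt /s4 /= !(linE, quatE, gE, gzE).
by field; rewrite fi0 hi0.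
Qed.

(** [fi] times g (K^-1 W, T), where g_H = g (-, K -) and K is [Kl] below. *)
Definition kT W T := g W T - hi * s4 (fun I => g (I zeta) W * g (I zeta) T).

Definition curvT X Y U T :=
  4^-1 * (s4 (fun I => hH (I X) U * g (I Y) T - hH (I Y) U * g (I X) T)
    + 2 * (hH (I1 X) Y * g (I1 U) T + hH (I2 X) Y * g (I2 U) T + hH (I3 X) Y * g (I3 U) T))
  - 4^-1 * hi * (s4 (fun I => g (I (J X)) U * kT (I (J Y)) T - g (I (J Y)) U * kT (I (J X)) T)
    + 2 * g (I1 (J X)) Y * kT (I1 (J U)) T).

(** Pairing with g instead of g_H keeps the degree in zeta low enough for a polynomial check; g_H is
    recovered in [hH_Rhat] by taking [T = Kl W]. *)
Lemma gRhat X Y U T : g (Rhat X Y U) T = curvT X Y U T.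
Proof.
have -> : g (Rhat X Y U) T = g (dLam X Y U) T - g (dLam Y X U) T
  + g (Lam X (Lam Y U)) T - g (Lam Y (Lam X U)) T
  + g (I1 (J X)) Y * hi * (g (Lam Zt U) T - 2^-1 * (g (I1 U) T + g (I1 (J U)) T)).
  by rewrite /Rhat /omH /ZZ !linE !(gDl, gNl, gZl); ring.
rewrite !gdLam gLamZt (gLam X) (gLam Y (Lam X U)).
have [a0 a1 a2 a3] := gamLam Y U; have [b0 b1 b2 b3] := gamLam X U.
rewrite /curvT /hH /kT /gam /s4 /=.
rewrite a0 a1 a2 a3 b0 b1 b2 b3.
rewrite (gC (Lam Y U) T) (gC (Lam X U) T).
(* Moves each structure off the inner [Lam], so that [gLam] can expand it. *)
have Hc W S A : (g (I1 (Lam S A)) W = - g (Lam S A) (I1 W)) *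
  (g (I2 (Lam S A)) W = - g (Lam S A) (I2 W)) * (g (I3 (Lam S A)) W = - g (Lam S A) (I3 W)).
  by rewrite !gE !opprK.
rewrite !(Hc T Y U) !(Hc T X U) !(gC T) ![g _ (Lam Y U)]gC ![g _ (Lam X U)]gC.
rewrite !(gLam Y U) !(gLam X U) /s4 /=.
rewrite !(gII Y T, gII X T, gII U T, gII zeta T).
rewrite !(gII Y (J X), gII U (J X), gII zeta (J X)).
rewrite !(gII X (J Y), gII U (J Y), gII zeta (J Y)) !(gII zeta (J U)).
rewrite !(gII zeta X, gII zeta Y).
rewrite !(gIJ Y X, gIJ U X, gIJ zeta X, gIJ X Y, gIJ U Y, gIJ zeta Y, gIJ zeta U) !Jzeta.
rewrite !(gflip X Y, gflip X U, gflip Y U).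
by field; rewrite fi0 hi0.
Qed.

Lemma hH_sym X Y : hH X Y = hH Y X.
Proof. by rewrite /hH /s4 gC; ring. Qed.
Lemma hHDl X X' Y : hH (X + X') Y = hH X Y + hH X' Y.
Proof. by rewrite /hH /s4 /gam !gDr gDl; ring. Qed.
Lemma hHZl a X Y : hH (a *: X) Y = a * hH X Y.
Proof. by rewrite /hH /s4 /gam !gZr gZl; ring. Qed.
Lemma hHNl X Y : hH (- X) Y = - hH X Y.
Proof. by rewrite -scaleN1r hHZl mulN1r. Qed.

Lemma hHI X Y : (hH X (I1 Y) = - hH (I1 X) Y) * (hH X (I2 Y) = - hH (I2 X) Y) *
  (hH X (I3 Y) = - hH (I3 X) Y).
Proof.
rewrite /hH /s4 /gam /= !(gII X Y, gII zeta X, gII zeta Y).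
by do !split; ring.
Qed.

Definition Kl W := fi *: W + fi ^+ 2 *: q4 (fun I => gam I W *: I zeta).

Lemma gKl A W : g A (Kl W) = hH A W.
Proof.
rewrite /Kl /hH /q4 /s4 /gam !(gDr, gZr) /=.
by rewrite !(gC A) -!/(gam _ _); ring.
Qed.

Lemma kT_Kl A W : kT A (Kl W) = fi * g A W.
Proof.
rewrite /kT /s4 /= !gKl /hH /s4 /gam /= !gII !gzE.
by field; rewrite fi0 hi0.
Qed.

Definition curvH X Y U W :=
  4^-1 * (s4 (fun I => hH (I X) U * hH (I Y) W - hH (I Y) U * hH (I X) W)
    + 2 * (hH (I1 X) Y * hH (I1 U) W + hH (I2 X) Y * hH (I2 U) W + hH (I3 X) Y * hH (I3 U) W))
  - 4^-1 * hi * fi * (s4 (fun I => g (I (J X)) U * g (I (J Y)) W - g (I (J Y)) U * g (I (J X)) W)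
    + 2 * g (I1 (J X)) Y * g (I1 (J U)) W).

Lemma hH_Rhat X Y U W : hH (Rhat X Y U) W = curvH X Y U W.
Proof.
rewrite -gKl gRhat /curvT /curvH /s4 /= !gKl !kT_Kl; ring.
Qed.

Definition dhH W X Y := let pW := 2^-1 *: (W + J W) in
  fi ^+ 2 * g zeta W * g X Y + 2 * fi ^+ 3 * g zeta W * s4 (fun I => gam I X * gam I Y)
  + fi ^+ 2 * s4 (fun I => g (I pW) X * gam I Y + gam I X * g (I pW) Y).

(** Z is a Killing field of g_H: the left side is the Lie derivative L_Z g_H. *)
Lemma dhH_Zt X Y : dhH Zt X Y + hH (ZZ X) Y + hH X (ZZ Y) = 0.
Proof.
rewrite /dhH /hH /ZZ /Zt /s4 /gam /=.
rewrite !(linE, quatE, gE) !gzE !gIJ !Jzeta.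
by field.
Qed.

(** * The curvature in an orthonormal frame *)

Section Frame.
Context {d : nat} (X : 'I_d -> V).
Hypotheses (onb : forall a b, hH (X a) (X b) = (a == b)%:R)
  (span : forall Y, Y = \sum_b hH (X b) Y *: X b).

Definition frO (I : V -> V) : 'M[R]_d := \matrix_(a, b) hH (I (X a)) (X b).
Definition frA : 'M[R]_d := \matrix_(a, b) g (J (X a)) (X b).

Lemma expand (l : V -> R) : (forall a u v, l (a *: u + v) = a * l u + l v) ->
  forall Y, \sum_b hH Y (X b) * l (X b) = l Y.
Proof.
move=> ll Y; have l0 : l 0 = 0.
  by have := ll 1 0 0; rewrite scale1r addr0 mul1r; lra.
rewrite {2}[Y]span; elim/big_rec2: _ => [|b u v _ IH]; first by rewrite l0.
by rewrite ll (hH_sym Y) IH.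
Qed.

Lemma expand_g L Y W : linear L -> \sum_b hH Y (X b) * g (L (X b)) W = g (L Y) W.
Proof.
move=> Ll; apply: (expand (l := fun y => g (L y) W)) => a u v.
by rewrite Ll gDl gZl.
Qed.

Lemma expand_h L Y W : linear L -> \sum_b hH Y (X b) * hH (L (X b)) W = hH (L Y) W.
Proof.
move=> Ll; apply: (expand (l := fun y => hH (L y) W)) => a u v.
by rewrite Ll hHDl hHZl.
Qed.

Lemma frO_T L : (forall Y Z, hH Y (L Z) = - hH (L Y) Z) -> (frO L)^T = - frO L.
Proof. by move=> sL; apply/matrixP => a b; rewrite !mxE hH_sym sL. Qed.

(** Rows index the argument, so products of matrices reverse composition; hence the sign in
    [frO_12]. *)
Lemma frO_mul L M : linear M -> frO L *m frO M = frO (fun Y => M (L Y)).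
Proof.
move=> Ml; apply/matrixP => a b; rewrite !mxE.
by under eq_bigr => k _ do rewrite !mxE; rewrite expand_h.
Qed.

Lemma frO_A L : linear L -> frO L *m frA = \matrix_(a, b) g (J (L (X a))) (X b).
Proof.
move=> Ll; apply/matrixP => a b; rewrite !mxE.
by under eq_bigr => k _ do rewrite !mxE; rewrite expand_g.
Qed.

(** Skewness for g_H serves to expand in the frame, skewness for g to bring [L] back to the first
    argument. *)
Lemma frA_O L : linear L -> (forall Y Z, hH Y (L Z) = - hH (L Y) Z) ->
  (forall Y Z, g Y (L Z) = - g (L Y) Z) ->
  frA *m frO L = \matrix_(a, b) g (L (J (X a))) (X b).
Proof.
move=> Ll sL gL; apply/matrixP => a b; rewrite !mxE.
under eq_bigr => k _ do rewrite !mxE mulrC -[hH _ _]opprK -sL hH_sym mulNr -gJ.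
have lin : forall a' u v, g (J (X a)) (a' *: u + v) = a' * g (J (X a)) u + g (J (X a)) v.
  by move=> *; rewrite gDr gZr.
by rewrite sumrN; under eq_bigr => k _ do rewrite gJ; rewrite (expand lin) gL opprK.
Qed.

Local Notation O1 := (frO I1).
Local Notation O2 := (frO I2).
Local Notation O3 := (frO I3).

Lemma frO_sym1 : O1^T = - O1. Proof. by apply: frO_T => Y Z; rewrite hHI. Qed.
Lemma frO_sym2 : O2^T = - O2. Proof. by apply: frO_T => Y Z; rewrite hHI. Qed.
Lemma frO_sym3 : O3^T = - O3. Proof. by apply: frO_T => Y Z; rewrite hHI. Qed.
Lemma frO_11 : O1 *m O1 = - 1%:M.
Proof. by rewrite frO_mul //; apply/matrixP => a b; rewrite !mxE I11 hHNl onb. Qed.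
Lemma frO_22 : O2 *m O2 = - 1%:M.
Proof. by rewrite frO_mul //; apply/matrixP => a b; rewrite !mxE I22 hHNl onb. Qed.
Lemma frO_12 : O1 *m O2 = - O3.
Proof. by rewrite frO_mul //; apply/matrixP => a b; rewrite !mxE I21 hHNl. Qed.
Lemma frA_T : frA^T = frA.
Proof. by apply/matrixP => a b; rewrite !mxE gC gJ. Qed.

Lemma frA_O1 : frA *m O1 = \matrix_(a, b) g (I1 (J (X a))) (X b).
Proof. by apply: frA_O => // Y Z; rewrite hHI. Qed.
Lemma frA_O2 : frA *m O2 = \matrix_(a, b) g (I2 (J (X a))) (X b).
Proof. by apply: frA_O => // Y Z; rewrite hHI. Qed.
Lemma frA_O3 : frA *m O3 = \matrix_(a, b) g (I3 (J (X a))) (X b).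
Proof. by apply: frA_O => // Y Z; rewrite ?hHI ?gI3. Qed.
Lemma frO_A1 : O1 *m frA = frA *m O1.
Proof. by rewrite frA_O1 frO_A //; apply/matrixP => a b; rewrite !mxE JI1. Qed.
Lemma frO_A2 : O2 *m frA = - (frA *m O2).
Proof. by rewrite frA_O2 frO_A //; apply/matrixP => a b; rewrite !mxE JI2 gNl. Qed.
Lemma frO_A3 : O3 *m frA = - (frA *m O3).
Proof. by rewrite frA_O3 frO_A //; apply/matrixP => a b; rewrite !mxE JI3 gNl. Qed.

Definition Kinv W := fi^-1 *: (W - hi *: q4 (fun I => gam I W *: I zeta)).

Lemma g_Kinv W T : g (Kinv W) T = fi^-1 * (g W T - hi * s4 (fun I => gam I W * gam I T)).
Proof. by rewrite /Kinv /q4 /s4 /gam !(gDl, gZl, gNl). Qed.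

Lemma hH_Kinv W T : hH (Kinv W) T = g W T.
Proof.
have e I : gam I (Kinv W) = g (Kinv W) (I zeta) by rewrite /gam gC.
rewrite /hH /s4 !e !g_Kinv /s4 /gam /= !(gC W) !gII !gzE.
by field; rewrite fi0 hi0.
Qed.

Lemma g_JKinvJ W T : g (J (Kinv (J W))) T =
  fi ^- 2 * hH W T - (1 + hi / fi) * s4 (fun I => gam I W * gam I T).
Proof.
rewrite -gJ g_Kinv /hH /s4 /gam /= !gIJ !Jzeta JJ.
by field; rewrite fi0.
Qed.

Definition frG : 'M[R]_(4, d) := \matrix_(k, a) gam (nth id [:: id; I1; I2; I3] k) (X a).

(** Common squared g_H-length of the four covectors [gam], equal to f_Z^2 (1 - f_Z / f_H). *)
Definition rho := hi * fi ^- 2 * (hi^-1 - fi^-1).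

Lemma frG_orth : frG *m frG^T = rho%:M.
Proof.
have e (I L : V -> V) :
   \sum_a gam L (X a) * gam I (X a) = g (I zeta) (Kinv (L zeta)).
  have lin a u v : gam I (a *: u + v) = a * gam I u + gam I v by rewrite /gam gDr gZr.
  rewrite -[RHS]/(gam I _) -(expand lin).
  by apply: eq_bigr => a _; rewrite hH_Kinv.
apply/matrixP => k l; rewrite !mxE.
under eq_bigr => a _ do rewrite !mxE.
rewrite e // gC g_Kinv /s4 /gam /rho.
case: k l => [[|[|[|[|//]]]] ?] [[|[|[|[|//]]]] ?] /=; rewrite ?gII ?gzE.
all: by field; rewrite fi0 hi0.
Qed.

(** The form g (J -, -) is represented in g_H by [Kinv] after [J], so the square comes from
    [g_JKinvJ]. By [frG_orth] the eigenvalues are f_Z^2 on the kernel of [frG] and f_Z^4 / f_H^2 on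
    its four-dimensional row space. *)
Lemma frA_sqr : frA *m frA = (fi ^- 2)%:M - (1 + hi / fi) *: (frG^T *m frG).
Proof.
apply/matrixP => a b; rewrite !mxE.
under eq_bigr => k _ do rewrite !mxE -[g (J (X a)) _]hH_Kinv.
rewrite expand_g // g_JKinvJ onb !big_ord_recl big_ord0 !mxE /s4 /=.
by rewrite mulr_natr addr0 !addrA.
Qed.

Lemma tr_frGG : \tr (frG^T *m frG) = 4 * rho.
Proof. by rewrite mxtrace_mulC frG_orth mxtrace_scalar mulr_natl. Qed.

Lemma frGG_sqr : (frG^T *m frG) *m (frG^T *m frG) = rho *: (frG^T *m frG).
Proof. by rewrite mulmxA -[_ *m frG^T]mulmxA frG_orth mul_mx_scalar -scalemxAl. Qed.

Let x := fi ^- 2.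
Let y := - (1 + hi / fi).

Lemma tr_frA2 : \tr (frA *m frA) = d%:R * x + 4 * rho * y.
Proof.
rewrite frA_sqr raddfB /= mxtraceZ tr_frGG mxtrace_scalar /x /y.
by rewrite -[(_^-2) *+ d]mulr_natl; ring.
Qed.

Lemma tr_frA4 : \tr (frA *m frA *m frA *m frA) =
  d%:R * x ^+ 2 + 4 * rho * (2 * x * y + y ^+ 2 * rho).
Proof.
rewrite -mulmxA frA_sqr -scaleNr -/x -/y mulmxDl !mulmxDr.
rewrite -!scalemxAl -!scalemxAr frGG_sqr -scalar_mxM mul_scalar_mx mul_mx_scalar.
rewrite !raddfD /= !mxtraceZ tr_frGG mxtrace_scalar -[_ *+ d]mulr_natl; ring.
Qed.

Lemma frame_curvature a b c h : hH (Rhat (X a) (X b) (X c)) (X h) =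
  tadd (tscale 4^-1 (tO O1 O2 O3)) (tscale (- (4^-1 * hi * fi)) (tS O1 O2 O3 frA)) a b c h.
Proof.
rewrite hH_Rhat /curvH /tadd /tscale /tO /tS /tadd /tscale /tQ /tE.
by rewrite frA_O1 frA_O2 frA_O3 !mxE -!onb /s4 /=; ring.
Qed.

(** A quarter of the full contraction of [T]; the cross term of its two parts vanishes by
    [contr_OS]. The symmetries of [T] are read off its closed form. *)
Lemma frame_norm (T := fun a b c h => hH (Rhat (X a) (X b) (X c)) (X h)) :
  \sum_(a < d) \sum_(b < d | (a < b)%N) \sum_(c < d) \sum_(h < d | (c < h)%N)
    T a b c h * T c h a b =
  16^-1 * (5 * d%:R ^+ 2 + 4 * d%:R) + 64^-1 * (hi * fi) ^+ 2 * (12 * (d%:R * x + 4 * rho * y) ^+ 2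
    + 48 * (d%:R * x ^+ 2 + 4 * rho * (2 * x * y + y ^+ 2 * rho))).
Proof.
have Ts a b c h : T b a c h = - T a b c h.
  by rewrite /T !hH_Rhat /curvH /s4 /= !(hH_sym _ (X a)) !hHI !(gflip (X a) (X b)); ring.
have flip0 A B : hH A B = hH B A by exact: hH_sym.
have flip1 A B : hH (I1 A) B = - hH (I1 B) A by rewrite hH_sym hHI.
have flip2 A B : hH (I2 A) B = - hH (I2 B) A by rewrite hH_sym hHI.
have flip3 A B : hH (I3 A) B = - hH (I3 B) A by rewrite hH_sym hHI.
have Tp a b c h : T c h a b = T a b c h.
  rewrite /T !hH_Rhat /curvH /s4 /=.
  rewrite !(flip0 (X c) (X a), flip1 (X c) (X a), flip2 (X c) (X a), flip3 (X c) (X a)).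
  rewrite !(flip0 (X h) (X b), flip1 (X h) (X b), flip2 (X h) (X b), flip3 (X h) (X b)).
  rewrite !(flip0 (X h) (X a), flip1 (X h) (X a), flip2 (X h) (X a), flip3 (X h) (X a)).
  rewrite !(flip0 (X c) (X b), flip1 (X c) (X b), flip2 (X c) (X b), flip3 (X c) (X b)).
  by rewrite !(gflip (X a) (X c), gflip (X b) (X h), gflip (X a) (X h), gflip (X b) (X c)); ring.
rewrite sum_lt_contr //.
have -> : T = tadd (tscale 4^-1 (tO O1 O2 O3)) (tscale (- (4^-1 * hi * fi)) (tS O1 O2 O3 frA)).
  by do 4!(apply/funext => ?); exact: frame_curvature.
rewrite contr_comb.
rewrite (contr_OO frO_sym1 frO_sym2 frO_sym3 frO_11 frO_22 frO_12).
rewrite (@contr_OS _ _ O1 O2 O3 frA frO_sym1 frO_sym2 frO_sym3 frA_T frO_11 frO_22 frO_12 frO_A1 frO_A2 frO_A3).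
rewrite (@contr_SS _ _ O1 O2 O3 frA frO_sym1 frO_sym2 frO_sym3 frA_T frO_11 frO_22 frO_12 frO_A1 frO_A2 frO_A3).
rewrite tr_frA2 tr_frA4.
by field.
Qed.
End Frame.

End TwistedConnection.

(** * The flat example *)

Section FlatQuaternionicForm.
Context {R : realType} {m : nat}.
Local Notation E := (@flatE R m).
Implicit Types u v x : E.

Definition o0 : 'I_4 := @Ordinal 4 0 isT.
Definition o1 : 'I_4 := @Ordinal 4 1 isT.
Definition o2 : 'I_4 := @Ordinal 4 2 isT.
Definition o3 : 'I_4 := @Ordinal 4 3 isT.

Lemma flatE_eq u v : (forall j, [/\ u o0 j = v o0 j, u o1 j = v o1 j, u o2 j = v o2 j &
  u o3 j = v o3 j]) -> u = v.
Proof.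
move=> h; apply/matrixP => k j; have [e0 e1 e2 e3] := h j.
case: k => [[|[|[|[|//]]]] p].
- by rewrite (_ : Ordinal p = o0) //; exact: val_inj.
- by rewrite (_ : Ordinal p = o1) //; exact: val_inj.
- by rewrite (_ : Ordinal p = o2) //; exact: val_inj.
- by rewrite (_ : Ordinal p = o3) //; exact: val_inj.
Qed.

Definition rows (r0 r1 r2 r3 : 'I_m.+1 -> R) : E := \matrix_(k, j) [:: r0 j; r1 j; r2 j; r3 j]`_k.

Lemma rowsE r0 r1 r2 r3 j : (rows r0 r1 r2 r3 o0 j = r0 j) * (rows r0 r1 r2 r3 o1 j = r1 j) *
  (rows r0 r1 r2 r3 o2 j = r2 j) * (rows r0 r1 r2 r3 o3 j = r3 j).
Proof. by rewrite !mxE. Qed.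

Definition eps (j : 'I_m.+1) : R := if j == ord0 then -1 else 1.

Lemma eps2 j : eps j * eps j = 1.
Proof. by rewrite /eps; case: ifP; rewrite ?mulrNN mulr1. Qed.

Definition fI1 u := rows (fun j => - u o1 j) (fun j => u o0 j) (fun j => - u o3 j) (fun j => u o2 j).
(** The forms omega_2 and omega_3 carry no sign at index 0 while g does, hence the factors [eps] in
    [fI2] and [fI3]. *)
Definition fI2 u := rows (fun j => eps j * u o3 j) (fun j => eps j * u o2 j)
  (fun j => - eps j * u o1 j) (fun j => - eps j * u o0 j).
Definition fI3 u := rows (fun j => - eps j * u o2 j) (fun j => eps j * u o3 j)
  (fun j => eps j * u o0 j) (fun j => - eps j * u o1 j).
Definition fJ u := rows (fun j => u o0 j) (fun j => u o1 j) (fun j => - u o2 j) (fun j => - u o3 j).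

Lemma Re_add (a b : R[i]) : complex.Re (a + b) = complex.Re a + complex.Re b.
Proof. by case: a b => [a1 a2] [b1 b2]. Qed.
Lemma Re_opp (a : R[i]) : complex.Re (- a) = - complex.Re a.
Proof. by case: a. Qed.
Lemma Re_sum (I : Type) (r : seq I) (P : pred I) (F : I -> R[i]) :
  complex.Re (\sum_(i <- r | P i) F i) = \sum_(i <- r | P i) complex.Re (F i).
Proof. exact: (big_morph _ Re_add). Qed.
Lemma half_complex : (2^-1 : R[i]) = Complex 2^-1 0.
Proof. by rewrite -[Complex _ _]/(real_complex R 2^-1) fmorphV rmorph_nat. Qed.
Lemma Re_half (a : R[i]) : complex.Re (2^-1 * a) = 2^-1 * complex.Re a.
Proof. by rewrite half_complex; case: a => a1 a2 /=; rewrite mul0r subr0. Qed.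
Lemma Re_ihalf (a : R[i]) : complex.Re (Complex 0 1 / 2 * a) = - 2^-1 * complex.Im a.
Proof. by rewrite half_complex; case: a => a1 a2 /=; ring. Qed.
Lemma Im_add (a b : R[i]) : complex.Im (a + b) = complex.Im a + complex.Im b.
Proof. by case: a b => [a1 a2] [b1 b2]. Qed.
Lemma Im_opp (a : R[i]) : complex.Im (- a) = - complex.Im a.
Proof. by case: a. Qed.
Lemma Im_sum (I : Type) (r : seq I) (P : pred I) (F : I -> R[i]) :
  complex.Im (\sum_(i <- r | P i) F i) = \sum_(i <- r | P i) complex.Im (F i).
Proof. exact: (big_morph _ Im_add). Qed.

Lemma sum_eps (F : 'I_m.+1 -> R) : - F ord0 + \sum_(j | j != ord0) F j = \sum_j eps j * F j.
Proof.
rewrite [RHS](bigD1 ord0) //= /eps eqxx mulN1r; congr (_ + _).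
by apply: eq_bigr => j /negbTE ->; rewrite mul1r.
Qed.

Lemma flat_gE u v : flat_g u v =
  \sum_j eps j * (u o0 j * v o0 j + u o1 j * v o1 j + u o2 j * v o2 j + u o3 j * v o3 j).
Proof.
rewrite -sum_eps /flat_g /absq /=; congr (- _ + _); first by ring.
by apply: eq_bigr => j _; ring.
Qed.

Lemma zquadE x : zquad x = \sum_j eps j * (x o0 j * x o0 j + x o1 j * x o1 j).
Proof.
rewrite -sum_eps /zquad Re_add Re_opp Re_sum /=; congr (- _ + _); first by rewrite -/o0 -/o1; ring.
by apply: eq_bigr => j _ /=; rewrite -/o0 -/o1; ring.
Qed.

Lemma flat_om1E u v : flat_om1 u v = flat_g (fI1 u) v.
Proof.
rewrite flat_gE -sum_eps /flat_om1 Re_ihalf Im_add Im_opp Im_sum /= mulrDr mulrN mulr_sumr.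
rewrite !rowsE -/o0 -/o1 -/o2 -/o3; congr (_ + _); first by field.
by apply: eq_bigr => j _ /=; rewrite !rowsE -/o0 -/o1 -/o2 -/o3; field.
Qed.

Lemma flat_om2E u v : flat_om2 u v = flat_g (fI2 u) v.
Proof.
rewrite flat_gE /flat_om2 Re_ihalf Im_sum /= mulr_sumr.
apply: eq_bigr => j _ /=; rewrite !rowsE -/o0 -/o1 -/o2 -/o3.
by rewrite !mulrDr !mulNr !mulrN !mulrA eps2; field.
Qed.

Lemma flat_om3E u v : flat_om3 u v = flat_g (fI3 u) v.
Proof.
rewrite flat_gE /flat_om3 Re_half Re_sum /= mulr_sumr.
apply: eq_bigr => j _ /=; rewrite !rowsE -/o0 -/o1 -/o2 -/o3.
by rewrite !mulrDr !mulNr !mulrN !mulrA eps2; field.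
Qed.

Lemma flat_g_delta u k j : flat_g u (delta_mx k j) = eps j * u k j.
Proof.
rewrite flat_gE (bigD1 j) //= big1 ?addr0 => [|i /negbTE ij]; last first.
  by rewrite !mxE ij !andbF !mulr0 !addr0 mulr0.
rewrite !mxE eqxx !andbT; congr (_ * _).
case: k => [[|[|[|[|//]]]] p] /=; rewrite ?mulr0 ?mulr1 ?addr0 ?add0r; congr (u _ _); exact: val_inj.
Qed.

Lemma rows_linear (r0 r1 r2 r3 : E -> 'I_m.+1 -> R) :
  (forall a u v j, r0 (a *: u + v) j = a * r0 u j + r0 v j) ->
  (forall a u v j, r1 (a *: u + v) j = a * r1 u j + r1 v j) ->
  (forall a u v j, r2 (a *: u + v) j = a * r2 u j + r2 v j) ->
  (forall a u v j, r3 (a *: u + v) j = a * r3 u j + r3 v j) ->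
  linear (fun u => rows (r0 u) (r1 u) (r2 u) (r3 u)).
Proof.
move=> h0 h1 h2 h3 a u v; apply: flatE_eq => j.
have zE k (p q : E) : (a *: p + q) k j = a * p k j + q k j by rewrite !mxE.
by rewrite !zE !rowsE h0 h1 h2 h3.
Qed.

Lemma rows_opp u : - u = rows (fun j => - u o0 j) (fun j => - u o1 j) (fun j => - u o2 j) (fun j => - u o3 j).
Proof. by apply: flatE_eq => j; rewrite !rowsE !mxE. Qed.

Lemma flatDE u v k j : (u + v) k j = u k j + v k j. Proof. by rewrite mxE. Qed.
Lemma flatZE a u k j : (a *: u) k j = a * u k j. Proof. by rewrite mxE. Qed.

Lemma flat_form : quaternionic_form (@flat_g R m) fI1 fI2 fI3 fJ.
Proof.
split.
- move=> u v w; rewrite !flat_gE -big_split; apply: eq_bigr => j _ /=.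
  by rewrite !flatDE; ring.
- move=> a u w; rewrite !flat_gE mulr_sumr; apply: eq_bigr => j _ /=.
  by rewrite !flatZE; ring.
- by move=> u v; rewrite !flat_gE; apply: eq_bigr => j _; ring.
- move=> u v h; apply/matrixP => k j; have := h (delta_mx k j); rewrite !flat_g_delta.
  by move/(congr1 ( *%R (eps j))); rewrite !mulrA eps2 !mul1r.
- by apply: rows_linear => *; rewrite !mxE //; ring.
- by apply: rows_linear => *; rewrite !mxE //; ring.
- by apply: rows_linear => *; rewrite !mxE //; ring.
- by apply: rows_linear => *; rewrite !mxE //; ring.
- by move=> u; rewrite rows_opp; apply: flatE_eq => j; rewrite !rowsE.
- by move=> u; rewrite rows_opp; apply: flatE_eq => j; rewrite !rowsE !mulNr !mulrN !mulrA eps2 !mul1r.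
- by move=> u; apply: flatE_eq => j; rewrite !rowsE !mulNr ?opprK.
- by move=> u; rewrite rows_opp; apply: flatE_eq => j; rewrite !rowsE !mulNr ?mulrN ?opprK.
- by move=> u; apply: flatE_eq => j; rewrite !rowsE !opprK.
- by move=> u; apply: flatE_eq => j; rewrite !rowsE.
- by move=> u; rewrite rows_opp; apply: flatE_eq => j; rewrite !rowsE !mulNr ?mulrN ?opprK.
- by move=> u v; rewrite !flat_gE -sumrN; apply: eq_bigr => j _; rewrite !rowsE; ring.
- by move=> u v; rewrite !flat_gE -sumrN; apply: eq_bigr => j _; rewrite !rowsE; ring.
- by move=> u v; rewrite !flat_gE; apply: eq_bigr => j _; rewrite !rowsE; ring.
Qed.

Definition zpart x : E := 2^-1 *: (x + fJ x).

Lemma zpartE x : zpart x = rows (fun j => x o0 j) (fun j => x o1 j) (fun=> 0) (fun=> 0).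
Proof.
apply: flatE_eq => j; rewrite /zpart !flatZE !flatDE !rowsE.
by split; field.
Qed.

Lemma g_zpart x : flat_g (zpart x) (zpart x) = zquad x.
Proof.
rewrite flat_gE zquadE zpartE; apply: eq_bigr => j _; rewrite !rowsE; ring.
Qed.

Lemma fJ_zpart x : fJ (zpart x) = zpart x.
Proof. by rewrite zpartE; apply: flatE_eq => j; rewrite !rowsE !oppr0. Qed.

Lemma flat_Z_rows x : flat_Z x = rows (fun j => x o1 j) (fun j => - x o0 j) (fun=> 0) (fun=> 0).
Proof. by apply: flatE_eq => j; rewrite !mxE. Qed.

Lemma flat_Z_zpart x : flat_Z x = Zt fI1 (zpart x).
Proof.
rewrite /Zt flat_Z_rows rows_opp zpartE; apply: flatE_eq => j.
by rewrite !rowsE !opprK !oppr0.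
Qed.

Lemma flat_Z_ZZ x : flat_Z x = ZZ fI1 fJ x.
Proof.
have Q := flat_form; rewrite /ZZ -(linZ _ _ (qf_I1l Q)) -/(zpart x); exact: flat_Z_zpart.
Qed.

Lemma fH_zquad c x : fH c x = 2^-1 * zquad x - 2^-1 * c.
Proof.
have Q := flat_form; rewrite /fH /fZ flat_Z_zpart /Zt (gNl Q) (gNr Q) (qf_gI1 Q) (qf_I11 Q).
by rewrite (gNl Q) g_zpart; field.
Qed.

(** [zquad x < - c] gives f_Z > 0, and with [0 <= c] also f_H < 0, so both reciprocals are
    genuine. *)
Lemma flat_base_point c x : 0 <= c -> flatN m c x ->
  base_point (@flat_g R m) fJ (zpart x) (fZ c x)^-1 (fH c x)^-1.
Proof.
move=> c0; rewrite /flatN /= => xN; split; first exact: fJ_zpart.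
- by rewrite invr_eq0 /fZ gt_eqF //; lra.
- by rewrite invr_eq0 fH_zquad lt_eqF //; lra.
by rewrite !invrK g_zpart fH_zquad /fZ; field.
Qed.

(** Inserting Z = - I1 zeta permutes the four forms [gam] up to sign, which the squares absorb. *)
Lemma flat_gH_hH c x u v : flat_gH m c x u v =
  hH (@flat_g R m) fI1 fI2 fI3 (zpart x) (fZ c x)^-1 u v.
Proof.
have Q := flat_form.
rewrite /flat_gH /hH !flat_om1E !flat_om2E !flat_om3E flat_Z_zpart /Zt /s4 /gam /=.
rewrite !(linN _ (qf_I1l Q), linN _ (qf_I2l Q), linN _ (qf_I3l Q)).
rewrite !(qf_I11 Q) !(qf_I21 Q) !(I31 Q) !(gNl Q) !opprK -exprVn.
ring.
Qed.

End FlatQuaternionicForm.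

(** * The twisted connection along the bundle projection *)

Section TwistedLinearity.
Context {R : realFieldType} {V : lmodType R}.
Context (g : V -> V -> R) (I1 I2 I3 J : V -> V) (zeta : V) (fi hi : R).
Hypothesis Q : quaternionic_form g I1 I2 I3 J.
Local Notation Lam := (Lam g I1 I2 I3 J zeta fi hi).
Local Notation hH := (hH g I1 I2 I3 zeta fi).
Local Notation dhH := (dhH g I1 I2 I3 J zeta fi).
Local Notation omH := (omH g I1 J).
Local Notation ZZ := (ZZ I1 J).

Lemma ZZ_linear : linear ZZ.
Proof.
move=> a u v; rewrite /ZZ !(linE Q); apply: (qf_g_nd Q) => T.
by rewrite !(gE Q); ring.
Qed.

Lemma Lam_linearl Y : linear (Lam^~ Y).
Proof.
move=> a u v; apply: (qf_g_nd Q) => T /=.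
by rewrite [RHS](qf_gDl Q) [X in _ = X + _](qf_gZl Q) !(gLam _ _ _ Q) /s4 /= !(linE Q) !(gE Q); ring.
Qed.

Lemma Lam_linearr X : linear (Lam X).
Proof.
move=> a u v; apply: (qf_g_nd Q) => T /=.
by rewrite [RHS](qf_gDl Q) [X in _ = X + _](qf_gZl Q) !(gLam _ _ _ Q) /s4 /= !(linE Q) !(gE Q); ring.
Qed.

Lemma hHDr X Y Y' : hH X (Y + Y') = hH X Y + hH X Y'.
Proof. by rewrite !(hH_sym _ _ Q X) (hHDl _ _ Q). Qed.
Lemma hHZr a X Y : hH X (a *: Y) = a * hH X Y.
Proof. by rewrite !(hH_sym _ _ Q X) (hHZl _ _ Q). Qed.
Lemma dhH_linear a W W' X Y : dhH (a *: W + W') X Y = a * dhH W X Y + dhH W' X Y.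
Proof. by rewrite /dhH /s4 /gam /= !(linE Q) !(gE Q); ring. Qed.

Lemma omH_skew X Y : omH Y X = - omH X Y.
Proof. by rewrite /omH (gflipJ1 Q) !opprK. Qed.

Lemma omH_linear a X X' Y : omH (a *: X + X') Y = a * omH X Y + omH X' Y.
Proof. by rewrite /omH !(linE Q) !(gE Q); ring. Qed.

End TwistedLinearity.

(** Assembles metric compatibility of [nabla]: [d1], the derivative along the coframe, is balanced
    by [Lam], and [d2], the derivative along Z, by [ZZ]. *)
Lemma metric_alg (R : comNzRingType) (W : lmodType R) (h : W -> W -> R) a b da db La Lb Za Zb s d1 d2 :
  (forall X X' Y, h (X + X') Y = h X Y + h X' Y) -> (forall k X Y, h (k *: X) Y = k * h X Y) ->
  (forall X Y Y', h X (Y + Y') = h X Y + h X Y') -> (forall k X Y, h X (k *: Y) = k * h X Y) ->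
  d1 = h La b + h a Lb -> d2 + h Za b + h a Zb = 0 ->
  s * d2 + d1 + h da b + h a db = h (da + La - s *: Za) b + h a (db + Lb - s *: Zb).
Proof.
move=> hDl hZl hDr hZr ->; rewrite -!scaleNr !hDl !hZl !hDr !hZr => /eqP.
by rewrite -addrA addr_eq0 => /eqP ->; ring.
Qed.

Lemma linear_mx_continuous (R : realType) (W : normedModType R) m n (l : 'M[R]_(m, n) -> W) :
  linear l -> continuous l.
Proof.
move=> ll x; apply: differentiable_continuous.
pose L : {linear _ -> _} := HB.pack l (GRing.isLinear.Build _ _ _ _ _ ll).
have -> : l = (fun y => \sum_i \sum_j y i j *: l (delta_mx i j)).
  apply/funext => y; rewrite {1}[y]matrix_sum_delta -[l _]/(L _) linear_sum.
  apply: eq_bigr => i _; rewrite linear_sum; apply: eq_bigr => j _.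
  by rewrite linearZ.
by have [] := has_D_sum (index_enum _) (P := xpredT) (fun i _ =>
  has_D_sum (index_enum _) (P := xpredT) (fun j _ =>
   has_D_scale (has_D_coord i j (has_D_id x)) (has_D_cst (l (delta_mx i j)) x))).
Qed.

Lemma sum_3x4 (W : nmodType) (a1 b1 c1 a2 b2 c2 a3 b3 c3 a4 b4 c4 : W) :
  a1 + b1 + c1 + (a2 + b2 + c2) + (a3 + b3 + c3) + (a4 + b4 + c4) =
  a1 + a2 + a3 + a4 + (b1 + b2 + b3 + b4) + (c1 + c2 + c3 + c4).
Proof. by rewrite [LHS](AC (3*3*3*3) ((1*4*7*10)*(2*5*8*11)*(3*6*9*12))). Qed.

Lemma coframe_alg (R : comNzRingType) p q (w1 w2 w3 w4 w5 : 'M[R]_(p, q)) (a b s t : R) :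
  w5 - (a *: w4 + t *: (w1 + s *: w3)) - (w5 - (b *: w4 + s *: (w2 + t *: w3))) =
  - (a - b) *: w4 + s *: w2 - t *: w1.
Proof. by apply/matrixP => i j; rewrite !mxE; ring. Qed.

Lemma commutator_Lam_alg (R : comNzRingType) p q (D L0 Z dL dL' LL LL' Lu Lv LT : 'M[R]_(p, q))
    (h o k : R) :
  D + (- (h * o) *: L0 + LT + Lv + dL) - (h * o + k) *: Z + (Lu + LL)
  - (D + (LT + Lu + dL') - k *: Z + (Lv + LL')) =
  dL - dL' + LL - LL' - (o * h) *: (L0 + Z).
Proof. by apply/matrixP => i j; rewrite !mxE; ring. Qed.

Section AlongProjection.
Context {R : realType} {m : nat} {V : normedModType R} (U : set V).
Local Notation E := (@flatE R m).
Local Notation g := (@flat_g R m).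
Local Notation J := (@fJ R m).
Local Notation I1 := (@fI1 R m).
Local Notation I2 := (@fI2 R m).
Local Notation I3 := (@fI3 R m).
Let Q : quaternionic_form g I1 I2 I3 J := flat_form.
Opaque flat_g fI1 fI2 fI3 fJ.

Lemma bilin_g : bilin g.
Proof.
apply: bilin_mx => [y a u v|x a u v].
  by rewrite (qf_gDl Q) (qf_gZl Q).
by rewrite (gDr Q) (gZr Q).
Qed.

Lemma has_D_linmx (W : normedModType R) (l : E -> W) (f : V -> E) x df : linear l ->
  has_D f x df -> has_D (fun y => l (f y)) x (fun v => l (df v)).
Proof. by move=> ll; apply: has_D_lin => //; exact: linear_mx_continuous. Qed.

Lemma smooth_linmx (W : normedModType R) (l : E -> W) (f : V -> E) : open U -> linear l ->
  smooth_on U f -> smooth_on U (fun y => l (f y)).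
Proof. by move=> oU ll; apply: smooth_lin => //; exact: linear_mx_continuous. Qed.

(** One summand of [Lam], with the derivative grouped by what varies: [a], [b], or the coefficients,
    the last group being a summand of [dLam]. *)
Lemma has_D_Lam1 (I : E -> E) (ze a b : V -> E) (fi hi : V -> R) x dze dfi dhi da db :
  linear I -> has_D ze x dze -> has_D a x da -> has_D b x db ->
  has_D fi x dfi -> has_D hi x dhi ->
  has_D (fun y => (fi y / 2 * gam g (ze y) I (b y)) *: I (a y)
     + (fi y / 2 * gam g (ze y) I (a y)) *: I (b y)
     + (hi y / 2 * g (I (J (a y))) (b y)) *: I (ze y)) x
   (fun v => (fi x / 2 * gam g (ze x) I (b x)) *: I (da v)
     + (fi x / 2 * gam g (ze x) I (da v)) *: I (b x)
     + (hi x / 2 * g (I (J (da v))) (b x)) *: I (ze x)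
     + ((fi x / 2 * gam g (ze x) I (db v)) *: I (a x)
       + (fi x / 2 * gam g (ze x) I (a x)) *: I (db v)
       + (hi x / 2 * g (I (J (a x))) (db v)) *: I (ze x))
     + ((fi x / 2 * g (I (dze v)) (b x) + dfi v / 2 * gam g (ze x) I (b x)) *: I (a x)
       + (fi x / 2 * g (I (dze v)) (a x) + dfi v / 2 * gam g (ze x) I (a x)) *: I (b x)
       + (hi x / 2 * g (I (J (a x))) (b x)) *: I (dze v)
       + (dhi v / 2 * g (I (J (a x))) (b x)) *: I (ze x))).
Proof.
move=> lI hz ha hb hf hh; rewrite /gam.
have hf2 := has_D_mul hf (has_D_cst (2^-1 : R) x).
have hh2 := has_D_mul hh (has_D_cst (2^-1 : R) x).
have hIa := has_D_linmx lI ha; have hIb := has_D_linmx lI hb; have hIz := has_D_linmx lI hz.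
have hJa := has_D_linmx lI (has_D_linmx (qf_Jl Q) ha).
have B (p q : V -> E) dp dq : has_D p x dp -> has_D q x dq -> has_D (fun y => g (p y) (q y)) x _ :=
  has_D_bilin bilin_g.
apply: has_D_eq (has_D_add (has_D_add (has_D_scale (has_D_mul hf2 (B _ _ _ _ hIz hb)) hIa)
   (has_D_scale (has_D_mul hf2 (B _ _ _ _ hIz ha)) hIb))
   (has_D_scale (has_D_mul hh2 (B _ _ _ _ hJa hb)) hIz)) _ => v /=.
(* Only bookkeeping remains: with these vectors and scalars as atoms the identity is entrywise
   polynomial. *)
move: (I (a x)) (I (b x)) (I (ze x)) (I (J (a x))) (I (da v)) (I (db v)) (I (dze v))
  (I (J (da v))) => v1 v2 v3 v4 v5 v6 v7 v8.
move: (g v3 (b x)) (g v3 (a x)) (g v4 (b x)) (g v3 (db v)) (g v3 (da v)) (g v4 (db v))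
  (g v7 (b x)) (g v7 (a x)) (g v8 (b x)) => r1 r2 r3 r4 r5 r6 r7 r8 r9.
by apply/matrixP => i j; rewrite !mxE; ring.
Qed.

Local Notation Lam := (Lam g I1 I2 I3 J).
Local Notation dLam := (dLam g I1 I2 I3 J).
Local Notation hH := (hH g I1 I2 I3).
Local Notation dhH := (dhH g I1 I2 I3 J).
Local Notation omH := (omH g I1 J).
Local Notation ZZ := (ZZ I1 J).

Context (c : R) (c0 : 0 <= c) (pi : V -> E).
Hypothesis oU : open U.
Hypothesis spi : smooth_on U pi.
Hypothesis piN : forall x, U x -> flatN m c (pi x).

Let ze y := zpart (pi y).
Let fi y := (fZ c (pi y))^-1.
Let hi y := (fH c (pi y))^-1.

Lemma base_point_pi x : U x -> base_point g J (ze x) (fi x) (hi x).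
Proof. by move=> /piN; exact: flat_base_point. Qed.

Lemma zpart_linear : linear (@zpart R m).
Proof.
move=> a u v; rewrite /zpart (linD _ _ (qf_Jl Q)) (linZ _ _ (qf_Jl Q)).
by apply/matrixP => i j; rewrite !mxE; ring.
Qed.

Lemma smooth_ze : smooth_on U ze.
Proof. by apply: smooth_linmx spi => //; exact: zpart_linear. Qed.

Lemma smooth_zquad : smooth_on U (fun y => zquad (pi y)).
Proof.
apply: (smooth_eq oU (f := fun y => g (ze y) (ze y))).
  by move=> x _; exact: g_zpart.
by apply: smooth_bilin => //; [exact: bilin_g|exact: smooth_ze|exact: smooth_ze].
Qed.

Lemma smooth_fH : smooth_on U (fun y => fH c (pi y)).
Proof.
apply: (smooth_eq oU (f := fun y => 2^-1 * zquad (pi y) + (- (2^-1 * c)))).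
  by move=> x _; rewrite fH_zquad.
apply: smooth_add => //; last exact: smooth_cst.
by apply: smooth_mul => //; [exact: smooth_cst|exact: smooth_zquad].
Qed.

Lemma fZ_neq0 x : U x -> fZ c (pi x) != 0.
Proof. by move=> Ux; have := bp_fi (base_point_pi Ux); rewrite invr_eq0. Qed.
Lemma fH_neq0 x : U x -> fH c (pi x) != 0.
Proof. by move=> Ux; have := bp_hi (base_point_pi Ux); rewrite invr_eq0. Qed.

Lemma smooth_hi : smooth_on U hi.
Proof. by apply: smooth_inv => //; [exact: fH_neq0|exact: smooth_fH]. Qed.

Lemma has_D_ze x : U x -> has_D ze x (fun v => 2^-1 *: ('D_v pi x + J ('D_v pi x))).
Proof.
move=> Ux; exact: (has_D_linmx zpart_linear (smooth_has_D spi Ux)).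
Qed.

Lemma has_D_zquad x : U x -> has_D (fun y => zquad (pi y)) x
  (fun v => 2 * g (ze x) ('D_v pi x)).
Proof.
move=> Ux; have -> : (fun y => zquad (pi y)) = (fun y => g (ze y) (ze y)).
  by apply/funext => y; rewrite g_zpart.
apply: has_D_eq (has_D_bilin bilin_g (has_D_ze Ux) (has_D_ze Ux)) _ => v /=.
rewrite (qf_gC Q (2^-1 *: _)) (gZr Q) (gDr Q) (qf_gJ Q) /ze fJ_zpart.
by field.
Qed.

Lemma has_D_fi x : U x -> has_D fi x (fun v => fi x ^+ 2 * g (ze x) ('D_v pi x)).
Proof.
move=> Ux; have h : has_D (fun y => fZ c (pi y)) x (fun v => - g (ze x) ('D_v pi x)).
  have -> : (fun y => fZ c (pi y)) = (fun y => (- 2^-1) * zquad (pi y) - 2^-1 * c).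
    by apply/funext => y; rewrite /fZ; ring.
  apply: has_D_eq (has_D_sub (has_D_mul (has_D_cst _ _) (has_D_zquad Ux)) (has_D_cst _ _)) _ => v.
  by field.
have h2 := has_D_inv (f := fun y => fZ c (pi y)) (fZ_neq0 Ux) h.
by apply: has_D_eq h2 _ => v; rewrite /fi -exprVn; ring.
Qed.

Lemma has_D_hi x : U x -> has_D hi x (fun v => - hi x ^+ 2 * g (ze x) ('D_v pi x)).
Proof.
move=> Ux; have h : has_D (fun y => fH c (pi y)) x (fun v => g (ze x) ('D_v pi x)).
  have -> : (fun y => fH c (pi y)) = (fun y => 2^-1 * zquad (pi y) - 2^-1 * c).
    by apply/funext => y; rewrite fH_zquad.
  apply: has_D_eq (has_D_sub (has_D_mul (has_D_cst _ _) (has_D_zquad Ux)) (has_D_cst _ _)) _ => v.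
  by field.
have h2 := has_D_inv (f := fun y => fH c (pi y)) (fH_neq0 Ux) h.
by apply: has_D_eq h2 _ => v; rewrite /hi -exprVn; ring.
Qed.

Lemma has_D_Lam (a b : V -> E) x da db : U x -> has_D a x da -> has_D b x db ->
  has_D (fun y => Lam (ze y) (fi y) (hi y) (a y) (b y)) x
   (fun v => Lam (ze x) (fi x) (hi x) (da v) (b x) + Lam (ze x) (fi x) (hi x) (a x) (db v)
     + dLam (ze x) (fi x) (hi x) ('D_v pi x) (a x) (b x)).
Proof.
move=> Ux ha hb.
have h I lI := has_D_Lam1 (I := I) lI (has_D_ze Ux) ha hb (has_D_fi Ux) (has_D_hi Ux).
have lid : linear (id : E -> E) by [].
apply: has_D_eq (has_D_add (has_D_add (has_D_add (h id lid) (h I1 (qf_I1l Q)))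
  (h I2 (qf_I2l Q))) (h I3 (qf_I3l Q))) _ => v.
have e (s w z : R) : fi x / 2 * s + fi x ^+ 2 * w / 2 * z = fi x / 2 * s + fi x ^+ 2 / 2 * w * z.
  by rewrite -!mulrA [w * (_ * _)]mulrCA.
have e' (w z : R) (u : E) : (- hi x ^+ 2 * w / 2 * z) *: u = - ((hi x ^+ 2 / 2 * w * z) *: u).
  by rewrite -(scaleNr _ u); congr (_ *: u); ring.
rewrite /Lam /dLam /q4 /gam /= !e !e'.
exact: sum_3x4.
Qed.

Lemma has_D_hH (a b : V -> E) x da db : U x -> has_D a x da -> has_D b x db ->
  has_D (fun y => hH (ze y) (fi y) (a y) (b y)) x
   (fun v => dhH (ze x) (fi x) ('D_v pi x) (a x) (b x) + hH (ze x) (fi x) (da v) (b x)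
     + hH (ze x) (fi x) (a x) (db v)).
Proof.
move=> Ux ha hb; have hz := has_D_ze Ux; have hf := has_D_fi Ux.
have B (p q : V -> E) dp dq : has_D p x dp -> has_D q x dq -> has_D (fun y => g (p y) (q y)) x _ :=
  has_D_bilin bilin_g.
have h (I : E -> E) : linear I -> has_D (fun y => g (I (ze y)) (a y) * g (I (ze y)) (b y)) x _ :=
  fun lI => has_D_mul (B _ _ _ _ (has_D_linmx lI hz) ha) (B _ _ _ _ (has_D_linmx lI hz) hb).
have lid : linear (id : E -> E) by [].
have hf2 := has_D_mul hf hf.
have hs := has_D_add (has_D_add (has_D_add (h id lid) (h I1 (qf_I1l Q)))
  (h I2 (qf_I2l Q))) (h I3 (qf_I3l Q)).
apply: has_D_eq (has_D_add (has_D_mul hf (B _ _ _ _ ha hb)) (has_D_mul hf2 hs)) _ => v.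
by rewrite /hH /dhH /s4 /gam /=; ring.
Qed.

Context (eta : V -> V -> R).
Hypothesis seta : forall w, smooth_on U (eta^~ w).
Hypothesis deta : forall x u v, U x ->
  'D_u (eta^~ v) x - 'D_v (eta^~ u) x = omH ('D_u pi x) ('D_v pi x).

(* The connection form divided by f_H: it takes the value 1 on Z_P. *)
Definition normalized_eta w y := eta y w * hi y.
Local Notation sg := normalized_eta.

(* The differential of pi followed by the projection along Z_P. *)
Definition coframe w y : E := 'D_w pi y - sg w y *: ZZ (pi y).
Local Notation T := coframe.

(** Along Z_P, where the coframe vanishes and [normalized_eta] is 1, this is the Lie derivative by
    Z, [ZZ] being the differential of Z. *)
Definition nabla u (a : V -> E) y : E :=
  'D_u a y + Lam (ze y) (fi y) (hi y) (T u y) (a y) - sg u y *: ZZ (a y).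

Hypothesis coframe_onto : forall x e, U x -> exists v, T v x = e.

Lemma ZZ_pi x : ZZ (pi x) = Zt I1 (ze x).
Proof. by rewrite -flat_Z_ZZ flat_Z_zpart. Qed.

Lemma smooth_normalized_eta w : smooth_on U (sg w).
Proof. by apply: smooth_mul => //; exact: smooth_hi. Qed.

Lemma smooth_ZZpi : smooth_on U (fun y => ZZ (pi y)).
Proof. by apply: smooth_linmx => //; exact: ZZ_linear Q. Qed.

Lemma smooth_coframe w : smooth_on U (T w).
Proof.
apply: smooth_add => //; first exact: smooth_D.
apply: smooth_opp => //; apply: smooth_scale => //; [exact: smooth_normalized_eta|exact: smooth_ZZpi].
Qed.

Lemma derive_pi x u : 'D_u pi x = T u x + sg u x *: Zt I1 (ze x).
Proof. by rewrite /coframe ZZ_pi subrK. Qed.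

Lemma omH_Zt x W : U x -> omH (Zt I1 (ze x)) W = - g (ze x) W.
Proof.
move=> Ux; rewrite /omH /Zt (linN _ (qf_Jl Q)) (qf_JI1 Q) (bp_J (base_point_pi Ux)).
by rewrite (linN _ (qf_I1l Q)) (qf_I11 Q) opprK.
Qed.

Lemma g_ze_Zt x : g (ze x) (Zt I1 (ze x)) = 0.
Proof. by rewrite /Zt (gNr Q) (qf_gI1 Q) (gz1 _ Q) opprK. Qed.

(** By iota_Z omega_H = - d f_H, the Z-components of the differential of [pi] in d eta cancel
    against the derivative of 1 / f_H. *)
Lemma derive_normalized_eta x u v : U x ->
  'D_u (sg v) x - 'D_v (sg u) x = hi x * omH (T u x) (T v x).
Proof.
move=> Ux.
have h w z : 'D_w (sg z) x = 'D_w (eta^~ z) x * hi x + eta x z * (- hi x ^+ 2 * g (ze x) ('D_w pi x)).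
  by have [_ ->] := has_D_mul (smooth_has_D (seta z) Ux) (has_D_hi Ux).
have := deta u v Ux; rewrite !h !derive_pi.
have gT w : g (ze x) (T w x + sg w x *: Zt I1 (ze x)) = g (ze x) (T w x).
  by rewrite (gDr Q) (gZr Q) g_ze_Zt mulr0 addr0.
have hom (X Y : E) s t : omH (X + s *: Zt I1 (ze x)) (Y + t *: Zt I1 (ze x)) =
    omH X Y + t * g (ze x) X - s * g (ze x) Y.
  rewrite [X + _]addrC (omH_linear Q) (omH_Zt _ Ux) (omH_skew Q _ X) [Y + _]addrC.
  rewrite (omH_linear Q) (omH_Zt _ Ux) (gDr Q) (gZr Q) g_ze_Zt (omH_skew Q X); ring.
rewrite !gT hom => /eqP; rewrite subr_eq => /eqP ->.
by rewrite /normalized_eta; ring.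
Qed.

(** The first term is cancelled by [Lam_torsion], the other two by the [ZZ] term of [nabla]. *)
Lemma derive_coframe x u v : U x -> 'D_u (T v) x - 'D_v (T u) x =
  - (hi x * omH (T u x) (T v x)) *: Zt I1 (ze x) + sg u x *: ZZ (T v x) - sg v x *: ZZ (T u x).
Proof.
move=> Ux; have hZ := has_D_linmx (ZZ_linear Q) (smooth_has_D spi Ux).
have h w z : 'D_w (T z) x = 'D_w ('D_z pi) x
    - ('D_w (sg z) x *: ZZ (pi x) + sg z x *: ZZ ('D_w pi x)).
  have [_ ->] // := has_D_sub (smooth_has_D (smooth_D z spi) Ux)
    (has_D_scale (smooth_has_D (smooth_normalized_eta z) Ux) hZ).
rewrite !h (derive_comm_mx v u oU spi Ux) -(derive_normalized_eta _ _ Ux) ZZ_pi !derive_pi.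
rewrite !(linD _ _ (ZZ_linear Q)) !(linZ _ _ (ZZ_linear Q)).
exact: coframe_alg.
Qed.

Lemma has_D_nabla (a : V -> E) u x : U x -> smooth_on U a ->
  has_D (nabla u a) x (fun v => 'D_v ('D_u a) x
    + (Lam (ze x) (fi x) (hi x) ('D_v (T u) x) (a x) + Lam (ze x) (fi x) (hi x) (T u x) ('D_v a x)
       + dLam (ze x) (fi x) (hi x) ('D_v pi x) (T u x) (a x))
    - ('D_v (sg u) x *: ZZ (a x) + sg u x *: ZZ ('D_v a x))).
Proof.
move=> Ux sa; apply: has_D_sub; last first.
  apply: has_D_scale; first exact: smooth_has_D (smooth_normalized_eta u) Ux.
  exact: (has_D_linmx (ZZ_linear Q) (smooth_has_D sa Ux)).
apply: has_D_add; first exact: smooth_has_D (smooth_D u sa) Ux.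
exact: has_D_Lam Ux (smooth_has_D (smooth_coframe u) Ux) (smooth_has_D sa Ux).
Qed.

Lemma soldered_coframe : soldered_LC U (fun y => hH (ze y) (fi y)) T nabla.
Proof.
split.
- by move=> x a b Ux; exact: (hH_sym _ _ Q).
- move=> x u a b Ux da db.
  have [_ ->] := has_D_hH Ux (has_D_diff da) (has_D_diff db).
  rewrite derive_pi [T u x + _]addrC (dhH_linear _ _ Q).
  have M : dhH (ze x) (fi x) (T u x) (a x) (b x) = _ :=
    hH_metric Q (base_point_pi Ux) (T u x) (a x) (b x).
  have Z := dhH_Zt Q (base_point_pi Ux) (a x) (b x).
  exact: (metric_alg _ _ _ (hHDl _ _ Q) (hHZl _ _ Q) (hHDr _ _ Q) (hHZr _ _ Q) M Z).
- move=> x u v Ux; apply/eqP; rewrite -subr_eq0; apply/eqP.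
  have hT := derive_coframe u v Ux.
  have hL := Lam_torsion (ze x) (fi x) (hi x) Q (T u x) (T v x).
  rewrite /nabla.
  have -> : 'D_u (T v) x = 'D_v (T u) x + (- (hi x * omH (T u x) (T v x)) *: Zt I1 (ze x)
     + sg u x *: ZZ (T v x) - sg v x *: ZZ (T u x)) by rewrite -hT addrC subrK.
  have -> : Lam (ze x) (fi x) (hi x) (T u x) (T v x) = Lam (ze x) (fi x) (hi x) (T v x) (T u x)
    + (omH (T u x) (T v x) * hi x) *: Zt I1 (ze x) by rewrite -hL addrC subrK.
  move: (Lam _ _ _ _ _) (ZZ _) (ZZ _) (Zt _ _) ('D_v _ _) => w1 w2 w3 w4 w5.
  by apply/matrixP => i j; rewrite !mxE; ring.
- by move=> x v Ux; exact: smooth_diff (smooth_coframe v) Ux.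
- by move=> x u v Ux; have [] := has_D_nabla u Ux (smooth_coframe v).
- by move=> x w Ux; exact: coframe_onto.
Qed.

(** [normalized_eta] vanishes on [u] and [v] only at [x]; its derivatives survive there and feed the
    omega_H term of [Rhat]. *)
Lemma nabla_commutator (a : V -> E) u v x : U x -> smooth_on U a ->
  sg u x = 0 -> sg v x = 0 ->
  nabla u (nabla v a) x - nabla v (nabla u a) x =
  Rhat g I1 I2 I3 J (ze x) (fi x) (hi x) (T u x) (T v x) (a x).
Proof.
move=> Ux sa su sv.
have h w z : sg w x = 0 -> sg z x = 0 -> nabla w (nabla z a) x = 'D_w ('D_z a) x
    + (Lam (ze x) (fi x) (hi x) ('D_w (T z) x) (a x) + Lam (ze x) (fi x) (hi x) (T z x) ('D_w a x)
       + dLam (ze x) (fi x) (hi x) (T w x) (T z x) (a x)) - 'D_w (sg z) x *: ZZ (a x)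
    + (Lam (ze x) (fi x) (hi x) (T w x) ('D_z a x)
      + Lam (ze x) (fi x) (hi x) (T w x) (Lam (ze x) (fi x) (hi x) (T z x) (a x))).
  move=> sw sz; rewrite {1}/nabla sw scale0r subr0.
  have [_ ->] := has_D_nabla z Ux sa.
  rewrite derive_pi sw sz !scale0r !addr0 /nabla sz scale0r subr0.
  by rewrite (linD _ _ (Lam_linearr _ _ _ Q _)).
rewrite !h // (derive_comm_mx v u oU sa Ux) /Rhat.
have hT := derive_coframe u v Ux; rewrite su sv !scale0r addr0 subr0 in hT.
have -> : 'D_u (T v) x = (- (hi x * omH (T u x) (T v x))) *: Zt I1 (ze x) + 'D_v (T u) x.
  by rewrite -hT subrK.
have hs := derive_normalized_eta u v Ux.
have -> : 'D_u (sg v) x = hi x * omH (T u x) (T v x) + 'D_v (sg u) x by rewrite -hs subrK.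
have L := Lam_linearl (ze x) (fi x) (hi x) Q (a x); rewrite (L _ _ ('D_v (T u) x)).
exact: commutator_Lam_alg.
Qed.

End AlongProjection.

(** * The quotient by the twist field *)

Lemma derive_along_curve (R : realType) (V W : normedModType R) (ga : R^o -> V)
    (t : R^o) (v : V) (f : V -> W) :
  is_derive t 1 ga v -> differentiable f (ga t) ->
  (\forall s \near t, f (ga s) = f (ga t)) -> 'D_v f (ga t) = 0.
Proof.
move=> [dga vga] df fc.
have dg : differentiable ga t by exact/derivable1_diffP.
have [_ /(_ 1)] := has_D_comp (has_D_diff dg) (has_D_diff df).
rewrite vga => <-; rewrite -(derive_cst (f (ga t)) t (1 : R^o)).
exact: near_eq_derive.
Qed.

Lemma smooth_deriveD (R : realType) (V W : normedModType R) (f : V -> W) x u v :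
  differentiable f x -> 'D_(u + v) f x = 'D_u f x + 'D_v f x.
Proof. by move=> df; rewrite !deriveE // linearD. Qed.

Lemma smooth_deriveZ (R : realType) (V W : normedModType R) (f : V -> W) x k v :
  differentiable f x -> 'D_(k *: v) f x = k *: 'D_v f x.
Proof. by move=> df; rewrite !deriveE // linearZ. Qed.

Lemma ev1_linear (R : realType) d (a : 'cV[R]_d) k u v :
  ev1 a (k *: u + v) = k * ev1 a u + ev1 a v.
Proof. by rewrite /ev1 mulmxDl -scalemxAl !mxE. Qed.

Section Charts.
Context {R : realType} {d : nat} {M : manifold R d} {c : @chart R M d}.

Lemma cimg_cmap p : atlas c -> cdom c p -> cimg c (cmap c p) /\ cinv c (cmap c p) = p.
Proof. by move=> hc; case: (atlas_chart hc) => _ h _ _ _; exact: h. Qed.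
Lemma cdom_cinv x : atlas c -> cimg c x -> cdom c (cinv c x) /\ cmap c (cinv c x) = x.
Proof. by move=> hc; case: (atlas_chart hc) => _ _ h _ _; exact: h. Qed.

End Charts.

Section Bundle.
Context {R : realType} {E : normedModType R} {N : set E} {d : nat}.
Context (P : circle_bundle N d) (eta : covfield P) (heta : connection_form eta).
Context (c : chart P d) (hc : atlas c).

Let chc := atlas_chart hc.

Lemma diff_proj_loc x : cimg c x -> differentiable (proj_loc c) x.
Proof. exact: smooth_diff (cb_proj_smooth hc). Qed.

(** The projection is constant along the circle orbit, whose velocity is the generator. *)
Lemma dproj_generator x : cimg c x -> dproj c x (generator c x) = 0.
Proof.
move=> cx; have [dx mx] := cdom_cinv hc cx.
pose ga := fun t : R^o => cmap c (cb_act t (cinv c x)).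
have ga0 : ga 0 = x by rewrite /ga cb_act0.
have dga : differentiable ga 0.
  pose f := fun tx : R^o * 'rV[R]_d => cmap c (cb_act tx.1 (cinv c tx.2)).
  have df : differentiable f (0, x).
    by apply: (smooth_diff (cb_act_smooth hc hc)) => /=; rewrite cb_act0.
  have dp : differentiable (fun t : R^o => (t, x)) (0 : R^o).
    by apply: differentiable_pair => //; exact: differentiable_cst.
  exact: (@differentiable_comp _ _ _ _ (fun t : R^o => (t, x)) f).
have gv : is_derive (0 : R^o) (1 : R^o) ga (generator c x).
  by apply: DeriveDef => //; exact: diff_derivable.
have dpi : differentiable (proj_loc c) (ga 0) by rewrite ga0; exact: diff_proj_loc.
rewrite /dproj -[X in 'D__ _ X]ga0; apply: (derive_along_curve gv dpi).
(* [cinv] undoes [cmap] only inside the chart domain, in which the orbit stays for small times by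
   continuity. *)
have ac : {for (0 : R), continuous (fun t => cb_act t (cinv c x))}.
  have h := @cb_act_cont R E N d P (0, cinv c x).
  apply: (@cvg_comp _ _ _ (fun t : R => (t, cinv c x)) (fun tp => cb_act tp.1 tp.2) _ _ _ _ h).
  exact: (cvg_pair (f := id) (g := fun=> cinv c x) cvg_id (cvg_cst _)).
have oc : open (cdom c) by case: chc => -[].
have : \forall t \near (0 : R), cdom c (cb_act t (cinv c x)).
  by apply: ac; apply: open_nbhs_nbhs; split => //; rewrite cb_act0.
apply: filterS => t ct; rewrite /proj_loc /ga; have [_ ->] := cimg_cmap hc ct.
rewrite cb_act0 mx.
apply/esym/cb_fibers; exists t => //.
Qed.

Lemma dprojD x u v : cimg c x -> dproj c x (u + v) = dproj c x u + dproj c x v.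
Proof. by move=> cx; apply: smooth_deriveD; exact: diff_proj_loc. Qed.
Lemma dprojZ x k v : cimg c x -> dproj c x (k *: v) = k *: dproj c x v.
Proof. by move=> cx; apply: smooth_deriveZ; exact: diff_proj_loc. Qed.

Lemma eta_generator x : cimg c x -> ev1 (eta c x) (generator c x) = 1.
Proof. by case: heta => _ _; apply. Qed.

(** A lift given by submersivity is corrected along the generator, on which eta is 1 and the
    projection has derivative 0. *)
Lemma exists_hor_lift x w : cimg c x -> exists v, ev1 (eta c x) v = 0 /\ dproj c x v = w.
Proof.
move=> cx; have [v0 hv0] := cb_proj_submersion hc cx w.
exists ((- ev1 (eta c x) v0) *: generator c x + v0); split.
  by rewrite ev1_linear eta_generator // mulr1 addNr.
by rewrite dprojD // dprojZ // dproj_generator // scaler0 add0r.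
Qed.

Lemma hor_liftP Z x : cimg c x ->
  ev1 (eta c x) (hor_lift eta Z c x) = 0 /\ dproj c x (hor_lift eta Z c x) = Z (proj_loc c x).
Proof.
move=> cx; have [v hv] := exists_hor_lift (Z (proj_loc c x)) cx.
exact: (@xgetPex _ 0 [set v | ev1 (eta c x) v = 0 /\ dproj c x v = Z (proj_loc c x)] (ex_intro _ v hv)).
Qed.

Lemma eta_twist_field td x : cimg c x ->
  ev1 (eta c x) (twist_field eta td c x) = td_f td (proj_loc c x).
Proof.
move=> cx; rewrite /twist_field addrC ev1_linear eta_generator // mulr1.
by rewrite (hor_liftP _ cx).1 addr0.
Qed.

Lemma dproj_twist_field td x : cimg c x ->
  dproj c x (twist_field eta td c x) = td_Z td (proj_loc c x).
Proof.
move=> cx; rewrite /twist_field dprojD // dprojZ // dproj_generator // scaler0 addr0.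
exact: (hor_liftP _ cx).2.
Qed.

Context (td : twist_data (E := E)) {d' : nat} (B : twist eta td d') (b : chart B d') (hb : atlas b).

Definition twist_loc : 'rV[R]_d -> 'rV[R]_d' := loc (@tw_proj _ _ _ _ _ _ _ _ B) c b.

Definition twist_dom : set 'rV[R]_d :=
  cimg c `&` cinv c @^-1` (tw_dom B `&` @tw_proj _ _ _ _ _ _ _ _ B @^-1` cdom b).

Lemma open_twist_dom : open twist_dom.
Proof.
have ob : open (cdom b) by case: (atlas_chart hb) => -[].
have oi : open (cimg c) by case: chc => -[].
rewrite openE => x [cx [Wx bx]]; rewrite /interior.
have ci : {for x, continuous (cinv c)} by case: chc => _ _ _ _; apply.
apply: filterI; first exact: open_nbhs_nbhs.
apply: ci; apply: filterI; first by apply: open_nbhs_nbhs; split => //; exact: tw_open.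
apply: (tw_smooth B).1 => //; exact: open_nbhs_nbhs.
Qed.

Lemma smooth_twist_loc : smooth_on twist_dom twist_loc.
Proof. exact: (tw_smooth B).2. Qed.

(* Orbits of Z_P being the fibres of the quotient map, a point is in its own
   orbit, which yields an integral curve of Z_P inside its fibre. *)
Lemma derive_twist_field x : twist_dom x -> 'D_(twist_field eta td c x) twist_loc x = 0.
Proof.
move=> Ux; have [cx [Wx bx]] := Ux; have [dx mx] := cdom_cinv hc cx.
have [ga [a0 [b0 [s [t [/andP[as0 sb0] tab icga gas gat]]]]]] :=
  (tw_fibers Wx Wx).1 erefl.
have sab : a0 < s < b0 by rewrite as0 sb0.
have [Ws cs dgas] := icga s sab.
have dxs : cdom c (ga s) by rewrite gas.
have := dgas c hc dxs; rewrite gas mx => gv.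
pose gx := fun s' : R^o => cmap c (ga s').
have gxs : gx s = x by rewrite /gx gas.
have dphi : differentiable twist_loc (gx s).
  by rewrite gxs; exact: smooth_diff smooth_twist_loc Ux.
rewrite -[X in 'D__ _ X]gxs; apply: (derive_along_curve gv dphi).
have oc : open (cdom c) by case: chc => -[].
have n1 : \forall s' \near (s : R), cdom c (ga s').
  by apply: cs; apply: open_nbhs_nbhs.
have n2 : \forall s' \near (s : R), s' \in `]a0, b0[%R.
  by apply: near_in_itvoo; rewrite in_itv /= sab.
apply: filterS2 n1 n2 => s' c1; rewrite in_itv /= => s2.
rewrite /twist_loc /loc /gx (cimg_cmap hc c1).2 (cimg_cmap hc dxs).2; congr (cmap b _).
have [Ws' _ _] := icga s' s2.
by apply/(tw_fibers Ws' Ws); exists ga, a0, b0, s', s; split.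
Qed.

End Bundle.

(** * The curvature of the twist *)

Lemma flat_omH_omH (R : realType) m (x u v : @flatE R m) :
  flat_omH m x u v = omH (@flat_g R m) fI1 fJ u v.
Proof.
have Q := @flat_form R m.
have h (w z : @flatE R m) : 'D_w (fun y => flat_g (flat_Z y) z : R^o) x = flat_g (flat_Z w) z.
  have hb : has_D (fun y : @flatE R m => flat_g (flat_Z y) z) x (fun w => flat_g (flat_Z w) z).
    apply: (has_D_linmx (l := fun y => flat_g (flat_Z y) z)) (has_D_id x) => a p q.
    by rewrite !flat_Z_ZZ (ZZ_linear Q) (qf_gDl Q) (qf_gZl Q).
  by have [_ ->] := hb.
rewrite /flat_omH /ext_d !h flat_om1E !flat_Z_ZZ /omH /ZZ.
rewrite !(gE Q) !(linE Q) !(gE Q) (gflip1 Q u v) (gflipJ1 Q u v).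
by field.
Qed.

(** Orthonormality says that the coordinate matrix of the family has a right inverse; the family has
    as many members as the dimension, so the inverse is two-sided. *)
Lemma orthonormal_span (R : realType) p q (h : 'M[R]_(p, q) -> 'M[R]_(p, q) -> R)
    (X : 'I_(p * q) -> 'M[R]_(p, q)) :
  (forall Y, linear (h Y)) -> (forall a b, h (X a) (X b) = (a == b)%:R) ->
  forall Y, Y = \sum_b h (X b) Y *: X b.
Proof.
move=> hl ho Y.
pose B : 'M[R]_(p * q) := \matrix_(a, k) mxvec (X a) 0 k.
pose C : 'M[R]_(p * q) := \matrix_(k, b) h (X b) (vec_mx (delta_mx 0 k)).
have hC Z b : h (X b) Z = \sum_k mxvec Z 0 k * C k b.
  pose L : {linear _ -> _} := HB.pack (h (X b)) (GRing.isLinear.Build _ _ _ _ _ (hl (X b))).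
  rewrite -[in LHS](mxvecK Z) {1}[mxvec Z]row_sum_delta linear_sum -[h _ _]/(L _) linear_sum.
  by apply: eq_bigr => k _; rewrite !linearZ /= mxE.
have BC : B *m C = 1%:M.
  apply/matrixP => a b; rewrite !mxE eq_sym -ho hC; apply: eq_bigr => k _.
  by rewrite mxE.
have CB := mulmx1C BC.
apply: (can_inj mxvecK); rewrite linear_sum -[LHS]mulmx1 -CB mulmxA.
apply/rowP => k; rewrite mxE summxE; apply: eq_bigr => b _.
by rewrite linearZ hC !mxE.
Qed.

Lemma hHBl (R : realFieldType) (V : lmodType R) (g : V -> V -> R) (I1 I2 I3 J : V -> V)
    zeta fi (Q : quaternionic_form g I1 I2 I3 J) X Y Z :
  hH g I1 I2 I3 zeta fi (X - Y) Z = hH g I1 I2 I3 zeta fi X Z - hH g I1 I2 I3 zeta fi Y Z.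
Proof. by rewrite (hHDl _ _ Q) (hHNl _ _ Q). Qed.

Lemma ev2Bl (R : realType) d (M : 'M[R]_d) u v w : ev2 M (u - v) w = ev2 M u w - ev2 M v w.
Proof. by rewrite /ev2 !mulmxBl [LHS]mxE [X in _ + X]mxE. Qed.

(** * Both soldered connections on a chart of the circle bundle *)

Section FlatTwist.
Context {R : realType} {m : nat} (c0 : R) (c00 : 0 <= c0).
Context (P : circle_bundle (flatN m c0) (4 * m.+1).+1).
Context (eta : covfield P) (heta : connection_form eta).
Hypothesis hcurv : has_curvature eta (flat_omH m).
Context (B : twist eta (flat_twist_data m c0) (4 * m.+1)).
Context (gQ : tens2 B) (hgQ : riemannian_metric gQ).
Hypothesis hrel : H_related (flat_gH m c0) gQ.
Context (c : chart P (4 * m.+1).+1) (hc : atlas c) (b : chart B (4 * m.+1)) (hb : atlas b).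

Local Notation E := (@flatE R m).
Local Notation g := (@flat_g R m).
Local Notation J := (@fJ R m).
Local Notation I1 := (@fI1 R m).
Local Notation I2 := (@fI2 R m).
Local Notation I3 := (@fI3 R m).
Local Notation F := 'rV[R]_(4 * m.+1).+1.
Let Q : quaternionic_form g I1 I2 I3 J := flat_form.
Let U := twist_dom c b.
Let phi : F -> 'rV[R]_(4 * m.+1) := twist_loc c b.
Let pi : F -> E := proj_loc c.
Let et (y w : F) := ev1 (eta c y) w.
Let G := gQ b.
Let Om := cimg b.

Let cU x : U x -> cimg c x. Proof. by case. Qed.
Let oU : open U. Proof. exact: open_twist_dom. Qed.
Let sphi : smooth_on U phi. Proof. exact: smooth_twist_loc. Qed.
Let spi : smooth_on U pi.
Proof. by apply: smooth_sub (cb_proj_smooth hc) => x /cU. Qed.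
Let piN x : U x -> flatN m c0 (pi x).
Proof. by move=> _; rewrite -(cb_range P); exists (cinv c x). Qed.
Let set_ w : smooth_on U (et^~ w).
Proof.
have se : smooth_on U (eta c) by case: heta => + _ _ => /(_ c hc); apply: smooth_sub => x /cU.
apply: (smooth_lin (l := fun a : 'cV[R]_(4 * m.+1).+1 => ev1 a w)) se => //.
  by move=> k u v; rewrite /ev1 mulmxDr -scalemxAr !mxE.
by apply: linear_mx_continuous => k u v; rewrite /ev1 mulmxDr -scalemxAr !mxE.
Qed.
Let det_ x u v : U x ->
  'D_u (et^~ v) x - 'D_v (et^~ u) x = omH g I1 J ('D_u pi x) ('D_v pi x).
Proof. by move=> /cU cx; have := hcurv u v hc cx; rewrite flat_omH_omH. Qed.

Local Notation ze y := (zpart (pi y)).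
Local Notation fi y := (fZ c0 (pi y))^-1.
Local Notation hi y := (fH c0 (pi y))^-1.
Local Notation T := (coframe c0 pi et).
Local Notation sg := (normalized_eta c0 pi et).
Local Notation ZP := (twist_field eta (flat_twist_data m c0) c).

Let dpi x : U x -> differentiable pi x. Proof. exact: smooth_diff spi. Qed.
Let dphi x : U x -> differentiable phi x. Proof. exact: smooth_diff sphi. Qed.
Let et_lin x k u v : et x (k *: u + v) = k * et x u + et x v.
Proof. exact: ev1_linear. Qed.
Let et_ZP x : U x -> et x (ZP x) = fH c0 (pi x).
Proof. by move=> /cU; exact: eta_twist_field. Qed.
Let pi_ZP x : U x -> 'D_(ZP x) pi x = ZZ I1 J (pi x).
Proof. by move=> /cU cx; rewrite -flat_Z_ZZ; exact: (dproj_twist_field heta hc). Qed.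
Let phi_ZP x : U x -> 'D_(ZP x) phi x = 0.
Proof. exact: derive_twist_field. Qed.
Let fH0 x : U x -> fH c0 (pi x) != 0.
Proof. by move=> Ux; exact: (fH_neq0 c00 piN Ux). Qed.

(** Horizontal correction of [v] along Z_P, which does not change its image in the quotient. *)
Definition hor x v : F := - sg v x *: ZP x + v.

Lemma et_hor x v : U x -> et x (hor x v) = 0.
Proof.
move=> Ux; rewrite et_lin et_ZP // /normalized_eta mulNr divfK ?fH0 // addNr //.
Qed.

Lemma pi_hor x v : U x -> 'D_(hor x v) pi x = T v x.
Proof.
move=> Ux; rewrite /hor (smooth_deriveD _ _ (dpi Ux)) (smooth_deriveZ _ _ (dpi Ux)) (pi_ZP Ux).
by rewrite /coframe scaleNr addrC.
Qed.

Lemma phi_hor x v : U x -> 'D_(hor x v) phi x = 'D_v phi x.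
Proof.
by move=> Ux; rewrite /hor (smooth_deriveD _ _ (dphi Ux)) (smooth_deriveZ _ _ (dphi Ux)) (phi_ZP Ux) scaler0 add0r.
Qed.

(** [H_related] speaks of horizontal vectors only. Replacing [v] by [hor x v] keeps the derivative
    of [phi] and turns that of [pi] into the coframe. *)
Lemma metric_pullback x v w : U x ->
  ev2 (G (phi x)) ('D_v phi x) ('D_w phi x) = hH g I1 I2 I3 (ze x) (fi x) (T v x) (T w x).
Proof.
move=> Ux; have [cx [Wx bx]] := Ux.
rewrite -(phi_hor v Ux) -(phi_hor w Ux).
have := hrel hc hb cx Wx bx (et_hor v Ux) (et_hor w Ux).
by rewrite -!pi_hor // -flat_gH_hH.
Qed.

Lemma coframe_surj x e : U x -> exists v, T v x = e.
Proof.
move=> Ux; have [v [ev dv]] := exists_hor_lift heta hc e (cU Ux).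
by exists v; rewrite /coframe /normalized_eta /et ev mul0r scale0r subr0.
Qed.

Lemma phi_cimg x : U x -> Om (phi x).
Proof. by case=> _ [_ bx]; have [] := cimg_cmap hb bx. Qed.

Let oOm : open Om. Proof. by case: (atlas_chart hb) => -[]. Qed.
Let sG : smooth_on Om G. Proof. by case: hgQ => /(_ b hb)[]. Qed.
Let symG y : Om y -> (G y)^T = G y.
Proof. by case: hgQ => /(_ b hb)[_ h _] _; exact: h. Qed.
Let posG y v : Om y -> v != 0 -> 0 < ev2 (G y) v v.
Proof. by case: hgQ => /(_ b hb)[_ _ h] _; exact: h. Qed.
(** A kernel vector would have length zero, against positivity. *)
Let uG y : Om y -> G y \in unitmx.
Proof.
move=> Oy; rewrite unitmxE unitfE; apply/negP => /eqP/eqP/det0P[v v0 vG].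
by have := posG Oy v0; rewrite /ev2 vG mul0mx mxE ltxx.
Qed.

Lemma ev2_sym y u v : Om y -> ev2 (G y) u v = ev2 (G y) v u.
Proof.
move=> Oy; rewrite !ev2E exchange_big; apply: eq_bigr => i _; apply: eq_bigr => j _.
by rewrite (gram_sym symG j i Oy); ring.
Qed.

Lemma soldered_phi : soldered_LC U (fun y => ev2 (G (phi y))) (fun v => 'D_v phi) (cov G phi).
Proof.
split.
- by move=> x u v Ux; apply: ev2_sym; exact: phi_cimg.
- move=> x u a a' Ux da da'.
  by apply: (cov_metric oOm sG symG uG) => //; [exact: phi_cimg|exact: dphi].
- move=> x u v Ux; rewrite /cov (derive_comm_mx v u oU sphi Ux).
  by rewrite (Gam_sym oOm symG) //; exact: phi_cimg.
- by move=> x v Ux; exact: smooth_diff (smooth_D v sphi) Ux.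
- move=> x u v Ux; have [] // := has_D_add (smooth_has_D (smooth_D u (smooth_D v sphi)) Ux)
   (has_D_Gam oOm sG uG (phi_cimg Ux) (dphi Ux) (smooth_has_D (smooth_D u sphi) Ux)
      (smooth_has_D (smooth_D v sphi) Ux)).
- move=> x w Ux; have [cx [Wx bx]] := Ux.
  exact: (tw_submersion hc hb cx Wx bx w).
Qed.

Lemma twist_curvature x u v w z : U x -> et x u = 0 -> et x v = 0 ->
  curv_form G (phi x) ('D_u phi x) ('D_v phi x) ('D_w phi x) ('D_z phi x) =
  hH g I1 I2 I3 (ze x) (fi x)
    (Rhat g I1 I2 I3 J (ze x) (fi x) (hi x) (T u x) (T v x) (T w x)) (T z x).
Proof.
move=> Ux eu ev.
have S2 := soldered_coframe c00 oU spi piN set_ det_ coframe_surj.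
have := curvature_iso oU soldered_phi S2 metric_pullback u v w z Ux.
rewrite /curv_form.
rewrite -(cov_commutator oOm sG uG u v oU Ux phi_cimg sphi (smooth_D w sphi)).
have sT := smooth_coframe c00 oU spi piN set_ w.
have su : sg u x = 0 by rewrite /normalized_eta eu mul0r.
have sv : sg v x = 0 by rewrite /normalized_eta ev mul0r.
rewrite -(nabla_commutator c00 oU spi piN set_ det_ Ux sT su sv).
move=> H; apply: (etrans _ (esym (hHBl (ze x) (fi x) Q _ _ _))).
by apply: (etrans _ H); exact: ev2Bl.
Qed.

(** The frame has [4 * n] members; the identity is the evaluation of both traces at the eigenvalues
    f^2 and f^4 / h^2 of A^2. *)
Lemma frame_numbers (f h n : R) : f != 0 -> h != 0 ->
  16^-1 * (5 * (4 * n) ^+ 2 + 4 * (4 * n)) + 64^-1 * (h^-1 * f^-1) ^+ 2 *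
    (12 * (4 * n * f^-1 ^- 2 + 4 * rho f^-1 h^-1 * - (1 + h^-1 / f^-1)) ^+ 2
    + 48 * (4 * n * (f^-1 ^- 2) ^+ 2 + 4 * rho f^-1 h^-1 *
        (2 * f^-1 ^- 2 * - (1 + h^-1 / f^-1) + (- (1 + h^-1 / f^-1)) ^+ 2 * rho f^-1 h^-1))) =
  n * (5 * n + 1) + 3 * (f ^+ 3 / h ^+ 3 + (n - 1) * (f / h)) ^+ 2
    + 3 * (f ^+ 6 / h ^+ 6 + (n - 1) * (f ^+ 2 / h ^+ 2)).
Proof.
by move=> f0 h0; rewrite /rho; field; rewrite f0 h0.
Qed.

Theorem twist_curv_norm2 x (e : 'I_(4 * m.+1) -> 'rV[R]_(4 * m.+1)) : U x ->
  orthonormal_frame G (phi x) e ->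
  let f := fZ c0 (pi x) in let h := fH c0 (pi x) in let n := m.+1%:R : R in
  curv_norm2 G (phi x) e =
  n * (5 * n + 1) + 3 * (f ^+ 3 / h ^+ 3 + (n - 1) * (f / h)) ^+ 2
    + 3 * (f ^+ 6 / h ^+ 6 + (n - 1) * (f ^+ 2 / h ^+ 2)).
Proof.
move=> Ux he f h n; have [cx [Wx bx]] := Ux.
have f0 : f != 0 by exact: (fZ_neq0 c00 piN Ux).
have h0 : h != 0 by exact: fH0.
(* Horizontal lifts of the frame to P: horizontality is what [twist_curvature] asks of its first two
   arguments. *)
have /choice[u hu] a : exists v, et x v = 0 /\ 'D_v phi x = e a.
  have [v hv] := tw_submersion hc hb cx Wx bx (e a).
  by exists (hor x v); split; [exact: et_hor|rewrite phi_hor].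
pose X a := T (u a) x.
have onb i j : hH g I1 I2 I3 (ze x) f^-1 (X i) (X j) = (i == j)%:R.
  by rewrite -metric_pullback // (hu i).2 (hu j).2.
have lh Y : linear (hH g I1 I2 I3 (ze x) f^-1 Y).
  by move=> k p q; rewrite (hHDr _ _ Q) (hHZr _ _ Q).
have span := orthonormal_span lh onb.
rewrite -(frame_numbers n f0 h0).
have -> : 4 * n = (4 * m.+1)%:R by rewrite natrM.
rewrite -(frame_norm Q (base_point_pi c00 piN Ux) onb span) /curv_norm2.
do 4!(apply: eq_bigr => ? _).
by rewrite -!(hu _).2 !twist_curvature ?(hu _).1.
Qed.

End FlatTwist.

Unset Implicit Arguments.
Set Strict Implicit.
Set Printing Implicit Defensive.

Theorem theorem4p2 (R : realType) (n : nat) (hn : (1 <= n)%N)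
    (c : R) (hc : 0 <= c)
    (P : circle_bundle (flatN n.-1 c) (4 * n).+1)
    (eta : covfield P) (heta : connection_form eta)
    (hcurv : has_curvature eta (flat_omH n.-1))
    (B : twist eta (flat_twist_data n.-1 c) (4 * n))
    (gQ : tens2 B) (hgQ : riemannian_metric gQ)
    (hrel : H_related (flat_gH n.-1 c) gQ)
    (p : P) (hp : tw_dom B p)
    (b : chart B (4 * n)) (hb : atlas b) (hpb : cdom b (tw_proj B p))
    (e : 'I_(4 * n) -> 'rV[R]_(4 * n))
    (he : orthonormal_frame (gQ b) (cmap b (tw_proj B p)) e) :
  let f_Z := fZ c (cb_proj p) in
  let f_H := fH c (cb_proj p) in
  curv_norm2 (gQ b) (cmap b (tw_proj B p)) e =
    n%:R * (5 * n%:R + 1)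
    + 3 * (f_Z ^+ 3 / f_H ^+ 3 + (n%:R - 1) * (f_Z / f_H)) ^+ 2
    + 3 * (f_Z ^+ 6 / f_H ^+ 6 + (n%:R - 1) * (f_Z ^+ 2 / f_H ^+ 2)).
Proof.
(* Writing [n] as [m.+1] makes [n.-1] compute, so the types match those of [twist_curv_norm2]. *)
case: n hn P eta heta hcurv B gQ hgQ hrel p hp b hb hpb e he => [//|m] _.
move=> P eta heta hcurv B gQ hgQ hrel p hp b hb hpb e he.
(* Any chart of P around [p] will do, since the result involves only the projection of [p] and its
   image in the twist. *)
have [a ha ap] := atlas_cover p.
have [ax ai] := cimg_cmap ha ap.
have Ux : twist_dom a b (cmap a p) by split=> //; rewrite /preimage /= ai.
have := twist_curv_norm2 hc heta hcurv hgQ hrel ha hb Ux.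
by rewrite /twist_loc /loc /proj_loc ai => /(_ e he).
Qed.
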